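(* There exist $\epsilon_0>0$ and a constant $C_1>0$ (depending on $\epsilon_0$) such that for every $0<\epsilon<\epsilon_0$ there is a smooth function $\psi_\epsilon$ on $\mathbb{T}^2$ satisfying $\psi_\epsilon=\Delta^{-1}(F_\epsilon(\psi_\epsilon))$ and $$\|\psi_\epsilon-\psi_0\|_{C^1(\mathbb{T}^2)}\le C_1\sqrt{\epsilon}\sqrt{-\ln\epsilon},$$ and moreover, for every $\alpha\in[0,1)$, $$\lim_{\epsilon\to0}\|\psi_\epsilon-\psi_0\|_{C^{1,\alpha}(\mathbb{T}^2)}=0.$$
   Context: $\mathbb{T}^2=[-\tfrac12,\tfrac12]^2$ with opposite sides identified. $\Delta^{-1}$ is the inverse Laplacian on mean-zero functions on $\mathbb{T}^2$ (convolution with the torus Green's function $G(x,y)=\frac1{2\pi}\ln|x-y|+f(x-y)$, $f$ smooth). $\mathrm{sgn}(t)=1$ for $t>0$, $-1$ for $t\le 0$. $\psi_0=\Delta^{-1}[\mathrm{sgn}(x)\mathrm{sgn}(y)]$ (Bahouri–Chemin stream function). Let $K$ be a smooth nonnegative even function on $\mathbb{R}$ supported in $(-1,1)$ with $\int K=1$, $K_\epsilon(x)=\frac1\epsilon K(x/\epsilon)$, and $F_\epsilon=-\,\mathrm{sgn}*K_\epsilon$. *)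

(* Defs.v *)
From Stdlib Require Import Reals.
From Coquelicot Require Import Coquelicot.
Open Scope R_scope.

Definition sgn (t : R) : R := if Rlt_dec 0 t then 1 else -1.

(* Functions on T^2 are 1-periodic functions R -> R -> R. *)
Definition periodic2 (f : R -> R -> R) : Prop :=
  forall x y, f (x + 1) y = f x y /\ f x (y + 1) = f x y.

Definition dx (f : R -> R -> R) : R -> R -> R := fun x y => Derive (fun t => f t y) x.
Definition dy (f : R -> R -> R) : R -> R -> R := fun x y => Derive (fun t => f x t) y.

Definition cont2 (f : R -> R -> R) : Prop :=
  forall x y, continuous (fun p : R * R => f (fst p) (snd p)) (x, y).

Fixpoint Ck (k : nat) (f : R -> R -> R) {struct k} : Prop :=
  match k with
  | O => cont2 f
  | S k' => cont2 f
            /\ (forall x y, ex_derive (fun t => f t y) x /\ ex_derive (fun t => f x t) y)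
            /\ Ck k' (dx f) /\ Ck k' (dy f)
  end.

Definition smooth2 (f : R -> R -> R) : Prop := forall k, Ck k f.

Definition smooth1 (K : R -> R) : Prop := forall n x, ex_derive_n K n x.

Definition laplacian (f : R -> R -> R) : R -> R -> R :=
  fun x y => dx (dx f) x y + dy (dy f) x y.

Definition torus_int (h : R -> R -> R) : R :=
  RInt (fun x => RInt (fun y => h x y) (-1/2) (1/2)) (-1/2) (1/2).

(* mollifier K_eps and F_eps = - sgn * K_eps.  Since supp K is contained in
   (-1,1), supp K_eps is contained in (-eps,eps) and the convolution integral
   over R reduces to an integral over [-eps,eps]. *)
Definition Keps (K : R -> R) (eps : R) (x : R) : R := / eps * K (x / eps).

Definition Feps (K : R -> R) (eps : R) (t : R) : R :=
  - RInt (fun s => sgn (t - s) * Keps K eps s) (- eps) eps.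

Definition mollifier (K : R -> R) : Prop :=
  smooth1 K /\ (forall x, 0 <= K x) /\ (forall x, K (- x) = K x)
  /\ (exists r, r < 1 /\ forall x, r < Rabs x -> K x = 0)
  /\ RInt K (-1) 1 = 1.

Definition supn (h : R -> R -> R) : Rbar :=
  Lub_Rbar (fun r => exists x y, r = Rabs (h x y)).

Definition holder_semi (alpha : R) (h : R -> R -> R) : Rbar :=
  Lub_Rbar (fun r => exists x1 y1 x2 y2, (x1, y1) <> (x2, y2) /\
     r = Rabs (h x1 y1 - h x2 y2) /
         Rpower (sqrt ((x1 - x2) ^ 2 + (y1 - y2) ^ 2)) alpha).

Definition C1_norm (g : R -> R -> R) : Rbar :=
  Rbar_plus (supn g) (Rbar_plus (supn (dx g)) (supn (dy g))).

Definition C1alpha_norm (alpha : R) (g : R -> R -> R) : Rbar :=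
  Rbar_plus (C1_norm g)
    (Rbar_plus (holder_semi alpha (dx g)) (holder_semi alpha (dy g))).

(* psi0 = Delta^{-1}[sgn x sgn y]: the C^1 periodic mean-zero function
   whose distributional Laplacian on T^2 is sgn(x) sgn(y) *)
Definition is_psi0 (psi0 : R -> R -> R) : Prop :=
  Ck 1 psi0 /\ periodic2 psi0 /\ torus_int psi0 = 0 /\
  forall phi, smooth2 phi -> periodic2 phi ->
    torus_int (fun x y => psi0 x y * laplacian phi x y)
    = torus_int (fun x y => sgn x * sgn y * phi x y).

(* Main.v *)
(* Write [u = - psi] and [g = - Feps]. By oddness the problem lives on the quarter cell
   [Q = (0,1/2)^2], where one solves [- Δ u = g u] with zero boundary values, and every
   estimate comes from the maximum principle on boxes.

   Existence: the trigonometric polynomial [Wsub] is a subsolution for all small [eps], so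
   the monotone iteration [- Δ u_(n+1) = g u_n] started at [Wsub] converges to a solution
   [u >= Wsub >= c sin(2 pi x) sin(2 pi y)]. Poisson's equation is solved exactly for the
   trigonometric polynomials approximating the source, and the a priori bound
   [|u| + |∇ u| <= C |Δ u|] for periodic [u] vanishing at [0] passes to the limit.

   Convergence: for [eps' < eps] the difference [v] of two solutions satisfies
   [|Δ v| <= 1] with [Δ v = 0] where [sin(2 pi x) sin(2 pi y) >= 600 eps]. Comparison with
   the barrier [s ln (1 + 600 eps / s)], [s = sin(2 pi x) sin(2 pi y)], gives
   [|v| <= 600 eps], hence [|∇ v| <= C sqrt eps] by interpolation with the bounded Laplacian;
   moreover [∇ v] is bounded in every Hoelder class. Finally [psi_eps'] tends to [psi0]
   pointwise, because the smoothed functions [Pn n psi_eps'] and [Pn n psi0] are integrals of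
   [Feps' (psi_eps')] and [sgn x sgn y] against the same kernel, so all the bounds on [v] pass
   to [psi_eps - psi0]. *)

Require Import Defs.
From Stdlib Require Import Reals Ranalysis5 Lra Lia ZArith Psatz List.
From Stdlib Require Import Classical ClassicalEpsilon FunctionalExtensionality.
From Coquelicot Require Import Coquelicot.
Open Scope R_scope.

(** Since [g] is increasing, [- Δ u = g u] has the wrong monotonicity for a comparison principle
    between its solutions, and [u = 0] always solves it. The subsolution answers both difficulties:
    it keeps the iteration away from zero, and its lower bound, linear in
    [s = sin(2 pi x) sin(2 pi y)], forces [g u = 1] outside a neighbourhood of the boundary of the
    cell whose size is known in advance. Two solutions then solve linear equations whose sources
    differ only in that neighbourhood.

    The gradient estimates require second derivatives everywhere, while the Laplacian of [psi0]
    jumps across the axes; hence the detour through pairs of smooth solutions.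

    The gradient bound [2 M / d + d N / 2] has a free length [d]; with [M] of order [eps], the
    choice [d = sqrt eps] yields [sqrt eps]. The factor [sqrt (- ln eps)] of the claim is at least 1
    for the [eps] considered. The range [eps <= 7 / 10000] serves twice: it lets [g] saturate where
    the subsolution is superharmonic, and it keeps [600 eps] below [1 / 2], as the barrier
    requires. *)

Lemma functional_choice {A B : Type} (P : A -> B -> Prop) :
  (forall x, exists y, P x y) -> exists f, forall x, P x (f x).
Proof.
  intros H. exists (fun x => proj1_sig (constructive_indefinite_description _ (H x))).
  intros x. apply proj2_sig.
Qed.

(** * The maximum principle and the interior gradient estimate *)

Notation RV := R_NormedModule.
Notation CRV := R_CompleteNormedModule.

Ltac abs_lra :=
  repeat match goal with
  | H : Rabs _ <= _ |- _ => apply Rabs_le_between in H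
  | H : Rabs _ < _ |- _ => apply Rabs_def2 in H
  end;
  repeat split; try apply Rabs_le; try apply Rabs_def1; lra.

Ltac continuous_by_derive :=
  match goal with |- continuous ?f ?x => apply (ex_derive_continuous f x); auto_derive; exact I end.

(** A relation at one point rather than a value of [Derive_n]: the barrier [Phi e (ss x y)] is not
    differentiable where [ss] vanishes, and the maximum principle asks for second derivatives at
    interior points only. *)
Definition has_d2 (f : R -> R) (x l : R) : Prop :=
  exists f' : R -> R, locally x (fun t => is_derive f t (f' t)) /\ is_derive f' x l.

Lemma has_d2_ext (f g : R -> R) x l :
  (forall t, f t = g t) -> has_d2 f x l -> has_d2 g x l.
Proof.
  intros E [f' [H1 H2]]; exists f'; split; [|exact H2].
  eapply filter_imp; [|exact H1]; intros t Ht.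
  now apply is_derive_ext with f.
Qed.

Lemma has_d2_plus (f g : R -> R) x l m :
  has_d2 f x l -> has_d2 g x m -> has_d2 (fun t => f t + g t) x (l + m).
Proof.
  intros [f' [H1 H2]] [g' [H3 H4]]; exists (fun t => f' t + g' t); split.
  - generalize (filter_and _ _ H1 H3); apply filter_imp; intros t [A B].
    exact (is_derive_plus _ _ _ _ _ A B).
  - exact (is_derive_plus _ _ _ _ _ H2 H4).
Qed.

Lemma has_d2_scal (c : R) (f : R -> R) x l :
  has_d2 f x l -> has_d2 (fun t => c * f t) x (c * l).
Proof.
  intros [f' [H1 H2]]; exists (fun t => c * f' t); split.
  - revert H1; apply filter_imp; intros t A. exact (is_derive_scal _ _ c _ A).
  - exact (is_derive_scal _ _ c _ H2).
Qed.

Lemma has_d2_minus (f g : R -> R) x l m :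
  has_d2 f x l -> has_d2 g x m -> has_d2 (fun t => f t - g t) x (l - m).
Proof.
  intros Hf Hg. replace (l - m) with (l + (-1) * m) by ring.
  apply has_d2_ext with (fun t => f t + (-1) * g t); [intros; ring|].
  apply has_d2_plus; [exact Hf|]. now apply has_d2_scal.
Qed.

Lemma has_d2_affine (a b : R) (f : R -> R) x l :
  has_d2 f (a * x + b) l -> has_d2 (fun t => f (a * t + b)) x (a * a * l).
Proof.
  intros [f' [H1 H2]]; exists (fun t => a * f' (a * t + b)).
  assert (D : forall t, is_derive (fun t => a * t + b) t a)
    by (intros t; auto_derive; [exact I | ring]).
  split.
  - assert (C : continuous (fun t => a * t + b) x)
      by (apply (ex_derive_continuous (fun t => a * t + b) x); exists a; apply D).
    generalize (C _ H1); unfold filtermap; apply filter_imp; intros t A.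
    exact (is_derive_comp f (fun t => a * t + b) t _ _ A (D t)).
  - replace (a * a * l) with (a * (a * l)) by ring.
    apply is_derive_scal.
    exact (is_derive_comp f' (fun t => a * t + b) x _ _ H2 (D x)).
Qed.

Lemma has_d2_quad (a b c x : R) : has_d2 (fun t => a * t ^ 2 + b * t + c) x (2 * a).
Proof.
  exists (fun t => 2 * a * t + b); split.
  - apply filter_forall; intros t. auto_derive; [exact I | ring].
  - auto_derive; [exact I | ring].
Qed.

Lemma mvt (f f' : R -> R) (a b : R) :
  (forall t, Rmin a b <= t <= Rmax a b -> is_derive f t (f' t)) ->
  exists c, Rmin a b <= c <= Rmax a b /\ f b - f a = f' c * (b - a).
Proof.
  intros H. apply MVT_gen; intros t Ht.
  - apply H; lra.
  - apply continuity_pt_filterlim.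
    apply (ex_derive_continuous f t). eexists; now apply H.
Qed.

(** If [l < 0], the first derivative, which is zero at the minimum, is negative just to the right of
    it, and the mean value theorem produces a smaller value of [f]. *)
Lemma has_d2_local_min (f : R -> R) x l :
  has_d2 f x l -> locally x (fun t => f x <= f t) -> 0 <= l.
Proof.
  intros [f' [[r1 H1] H2]] [r2 H3].
  apply Rnot_lt_le; intros Hl.
  assert (Hx : is_derive f x (f' x)) by (apply H1, ball_center).
  assert (Z : f' x = 0).
  { apply is_derive_Reals in Hx.
    set (pr := exist (fun l => derivable_pt_abs f x l) (f' x) Hx : derivable_pt f x).
    change (f' x) with (derive_pt f x pr).
    apply (deriv_minimum f (x - r2) (x + r2)); try (generalize (cond_pos r2); lra).
    intros t Ha Hb. apply H3. unfold ball; simpl; unfold AbsRing_ball, abs, minus, plus, opp; simpl.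
    apply Rabs_def1; lra. }
  apply is_derive_Reals in H2.
  (* With the tolerance [- l / 2] the difference quotients of [f'] stay below [l / 2 < 0]. *)
  destruct (H2 (- l / 2) ltac:(lra)) as [d Hd].
  set (h := Rmin (Rmin (r1 / 2) (r2 / 2)) (d / 2)).
  assert (Hh : 0 < h /\ h < r1 /\ h < r2 /\ h < d).
  { unfold h. generalize (cond_pos r1) (cond_pos r2) (cond_pos d).
    unfold Rmin; repeat destruct Rle_dec; lra. }
  assert (Hloc : forall t, x <= t <= x + h -> ball x r1 t /\ ball x r2 t).
  { intros t Ht. unfold ball; simpl; unfold AbsRing_ball, abs, minus, plus, opp; simpl.
    split; apply Rabs_def1; lra. }
  destruct (MVT_cor2 f f' x (x + h) ltac:(lra)) as [c [Ec Hc]].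
  { intros t Ht. apply is_derive_Reals, H1. now apply Hloc. }
  assert (Hfx : f x <= f (x + h)) by (apply H3, Hloc; lra).
  assert (Hq := Hd (c - x) ltac:(lra) ltac:(apply Rabs_def1; lra)).
  replace (x + (c - x)) with c in Hq by ring. rewrite Z in Hq.
  apply Rabs_def2 in Hq.
  assert (f' c < 0).
  { replace (f' c) with ((f' c - 0) / (c - x) * (c - x)) by (field; lra). nra. }
  assert (f' c * (x + h - x) < 0) by nra.
  lra.
Qed.

Lemma cont2_pt (f : R -> R -> R) : cont2 f <-> forall x y, continuity_2d_pt f x y.
Proof.
  split; intros H x y; apply continuity_2d_pt_filterlim, H.
Qed.

Lemma cont2_slice_y (f : R -> R -> R) x y : cont2 f -> continuity_pt (fun t => f x t) y.
Proof.
  intros H. apply continuity_pt_filterlim.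
  apply (continuous_comp_2 (fun _ : R => x) (fun t : R => t) f y).
  - apply continuous_const.
  - apply continuous_id.
  - apply H.
Qed.

(** Minimise in [y] for each [x], then in [x]. The minimiser [m x] may jump, but the minimal value
    is continuous in [x]: by uniform continuity, [m x] is a nearly optimal competitor at [t] and
    conversely. *)
Lemma box_min (f : R -> R -> R) (a b c d : R) :
  cont2 f -> a <= b -> c <= d ->
  exists x0 y0, a <= x0 <= b /\ c <= y0 <= d /\
    forall x y, a <= x <= b -> c <= y <= d -> f x0 y0 <= f x y.
Proof.
  intros Hf Hab Hcd.
  assert (Hm : forall x, exists y0, (forall y, c <= y <= d -> f x y0 <= f x y) /\ c <= y0 <= d).
  { intros x. apply continuity_ab_min; [exact Hcd|].
    intros y _. now apply cont2_slice_y. }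
  apply functional_choice in Hm. destruct Hm as [m Hm].
  destruct (continuity_ab_min (fun x => f x (m x)) a b Hab) as [x0 [H1 H2]].
  - intros x Hx e He.
    destruct (uniform_continuity_2d f (a - 1) (b + 1) c d
      (fun u v _ _ => proj1 (cont2_pt f) Hf u v) (mkposreal e He)) as [del Hdel].
    exists (Rmin del 1). split; [apply Rmin_pos; [apply cond_pos | lra]|].
    intros t [_ Ht]. unfold dist in *; simpl in *; unfold Rdist in *.
    assert (T1 : Rabs (t - x) < del) by (eapply Rlt_le_trans; [exact Ht | apply Rmin_l]).
    assert (T2 : Rabs (t - x) < 1) by (eapply Rlt_le_trans; [exact Ht | apply Rmin_r]).
    apply Rabs_def2 in T2.
    destruct (Hm x) as [A1 A2]. destruct (Hm t) as [B1 B2].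
    assert (C1 := Hdel x (m x) t (m x) ltac:(lra) A2 ltac:(lra) A2 T1
       ltac:(rewrite Rminus_diag, Rabs_R0; apply cond_pos)).
    assert (C2 := Hdel x (m t) t (m t) ltac:(lra) B2 ltac:(lra) B2 T1
       ltac:(rewrite Rminus_diag, Rabs_R0; apply cond_pos)).
    simpl in C1, C2. apply Rabs_def2 in C1. apply Rabs_def2 in C2.
    specialize (A1 _ B2). specialize (B1 _ A2).
    apply Rabs_def1; lra.
  - exists x0, (m x0). split; [exact H2|]. split; [apply Hm|].
    intros x y Hx Hy. apply Rle_trans with (f x (m x)); [now apply H1|].
    now apply Hm.
Qed.

Definition lap_at (v : R -> R -> R) (x y l : R) : Prop :=
  exists p q, has_d2 (fun t => v t y) x p /\ has_d2 (fun t => v x t) y q /\ l = p + q.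

Lemma lap_at_plus u v x y l m :
  lap_at u x y l -> lap_at v x y m -> lap_at (fun x y => u x y + v x y) x y (l + m).
Proof.
  intros [p [q [A [B ->]]]] [p' [q' [A' [B' ->]]]].
  exists (p + p'), (q + q'). repeat split; [now apply has_d2_plus .. | ring].
Qed.

Lemma lap_at_scal c u x y l :
  lap_at u x y l -> lap_at (fun x y => c * u x y) x y (c * l).
Proof.
  intros [p [q [A [B ->]]]].
  exists (c * p), (c * q). repeat split; [now apply has_d2_scal .. | ring].
Qed.

Lemma lap_at_minus u v x y l m :
  lap_at u x y l -> lap_at v x y m -> lap_at (fun x y => u x y - v x y) x y (l - m).
Proof.
  intros [p [q [A [B ->]]]] [p' [q' [A' [B' ->]]]].
  exists (p - p'), (q - q'). repeat split; [now apply has_d2_minus .. | ring].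
Qed.

Lemma lap_at_ext u v x y l :
  (forall x y, u x y = v x y) -> lap_at u x y l -> lap_at v x y l.
Proof.
  intros E [p [q [A [B ->]]]]. exists p, q.
  split; [|split; [|reflexivity]].
  - apply has_d2_ext with (fun t => u t y); auto.
  - apply has_d2_ext with (fun t => u x t); auto.
Qed.

(** The condition [a * a = 1] admits translations and also the reflection [a = -1], from which the
    odd part of a function is built. *)
Lemma lap_at_affine a b c u x y l :
  a * a = 1 -> lap_at u (a * x + b) (y + c) l ->
  lap_at (fun x y => u (a * x + b) (y + c)) x y l.
Proof.
  intros Ha [p [q [A [B ->]]]]. exists p, q. split; [|split; [|reflexivity]].
  - replace p with (a * a * p) by (rewrite Ha; ring).
    exact (has_d2_affine a b (fun t => u t (y + c)) x p A).
  - replace q with (1 * 1 * q) by ring.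
    apply has_d2_ext with (fun t => u (a * x + b) (1 * t + c)).
    + intros t; f_equal; ring.
    + apply (has_d2_affine 1 c (fun t => u (a * x + b) t)).
      now replace (1 * y + c) with (y + c) by ring.
Qed.

Lemma locally_open_interval (a b x : R) (P : R -> Prop) :
  a < x < b -> (forall t, a <= t <= b -> P t) -> locally x P.
Proof.
  intros Hx H.
  assert (Hr : 0 < Rmin (x - a) (b - x)) by (apply Rmin_pos; lra).
  exists (mkposreal _ Hr). intros t Ht.
  unfold ball in Ht; simpl in Ht; unfold AbsRing_ball, abs, minus, plus, opp in Ht; simpl in Ht.
  apply Rabs_def2 in Ht. generalize (Rmin_l (x - a) (b - x)) (Rmin_r (x - a) (b - x)).
  intros; apply H; lra.
Qed.

Section MinPrinciple.

Variables (v : R -> R -> R) (a b c d : R).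
Hypothesis Hv : cont2 v.
Hypothesis Hbd : forall x y, a <= x <= b -> c <= y <= d ->
  x = a \/ x = b \/ y = c \/ y = d -> 0 <= v x y.

Lemma min_principle_strict :
  (forall x y, a < x < b -> c < y < d -> exists l, lap_at v x y l /\ l < 0) ->
  forall x y, a <= x <= b -> c <= y <= d -> 0 <= v x y.
Proof.
  intros Hint x y Hx Hy.
  destruct (box_min v a b c d Hv ltac:(lra) ltac:(lra)) as [x0 [y0 [Hx0 [Hy0 Hmin]]]].
  apply Rle_trans with (v x0 y0); [|now apply Hmin].
  destruct (Req_dec x0 a) as [E|Ea]; [now apply Hbd; auto|].
  destruct (Req_dec x0 b) as [E|Eb]; [now apply Hbd; auto|].
  destruct (Req_dec y0 c) as [E|Ec]; [now apply Hbd; auto|].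
  destruct (Req_dec y0 d) as [E|Ed]; [now apply Hbd; auto|].
  exfalso.
  destruct (Hint x0 y0 ltac:(lra) ltac:(lra)) as [l [[p [q [A [B ->]]]] Hl]].
  apply has_d2_local_min in A; [apply has_d2_local_min in B; [lra|]|].
  - apply locally_open_interval with c d; [lra|]. intros; now apply Hmin.
  - apply locally_open_interval with a b; [lra|]. intros; now apply Hmin.
Qed.

End MinPrinciple.

Lemma cont2_plus f g : cont2 f -> cont2 g -> cont2 (fun x y => f x y + g x y).
Proof.
  intros Hf Hg; apply cont2_pt; intros x y; apply continuity_2d_pt_plus;
    now apply cont2_pt.
Qed.

Lemma cont2_minus f g : cont2 f -> cont2 g -> cont2 (fun x y => f x y - g x y).
Proof.
  intros Hf Hg; apply cont2_pt; intros x y; apply continuity_2d_pt_minus;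
    now apply cont2_pt.
Qed.

Lemma cont2_mult f g : cont2 f -> cont2 g -> cont2 (fun x y => f x y * g x y).
Proof.
  intros Hf Hg; apply cont2_pt; intros x y; apply continuity_2d_pt_mult;
    now apply cont2_pt.
Qed.

Lemma cont2_const c : cont2 (fun _ _ => c).
Proof. intros x y; apply continuous_const. Qed.

Lemma cont2_fst (f : R -> R) : (forall x, continuous f x) -> cont2 (fun x _ => f x).
Proof.
  intros H x y. apply (continuous_comp (@fst R R) f); [apply continuous_fst | apply H].
Qed.

Lemma cont2_snd (f : R -> R) : (forall x, continuous f x) -> cont2 (fun _ y => f y).
Proof.
  intros H x y. apply (continuous_comp (@snd R R) f); [apply continuous_snd | apply H].
Qed.

Lemma cont2_comp (h : R -> R) f :
  (forall t, continuous h t) -> cont2 f -> cont2 (fun x y => h (f x y)).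
Proof.
  intros Hh Hf x y.
  apply (continuous_comp (fun p : R * R => f (fst p) (snd p)) h); [apply Hf | apply Hh].
Qed.

Lemma cont2_comp2 (f g h : R -> R -> R) :
  cont2 f -> cont2 g -> cont2 h -> cont2 (fun x y => f (g x y) (h x y)).
Proof.
  intros Hf Hg Hh x y.
  apply (continuous_comp_2 (fun p : R * R => g (fst p) (snd p))
           (fun p : R * R => h (fst p) (snd p)) f); [apply Hg | apply Hh | apply Hf].
Qed.

Lemma continuous_derivable (f f' : R -> R) :
  (forall x, is_derive f x (f' x)) -> forall x, continuous f x.
Proof. intros H x. apply (ex_derive_continuous f). eexists; apply H. Qed.

(** The strict case applies after adding [e (x - a) (b - x)], which is nonnegative on the box and
    has Laplacian [- 2 e]; then [e] becomes small. *)
Lemma min_principle (v : R -> R -> R) (a b c d : R) :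
  cont2 v ->
  (forall x y, a <= x <= b -> c <= y <= d ->
     x = a \/ x = b \/ y = c \/ y = d -> 0 <= v x y) ->
  (forall x y, a < x < b -> c < y < d -> exists l, lap_at v x y l /\ l <= 0) ->
  forall x y, a <= x <= b -> c <= y <= d -> 0 <= v x y.
Proof.
  intros Hv Hbd Hint x y Hx Hy.
  assert (Hp : forall e, 0 < e -> 0 <= v x y + e * ((x - a) * (b - x))).
  { intros e He.
    apply (min_principle_strict (fun x y => v x y + e * ((x - a) * (b - x))) a b c d);
      try assumption.
    - apply cont2_plus; [exact Hv|].
      apply (cont2_fst (fun x => e * ((x - a) * (b - x)))).
      intros t. continuous_by_derive.
    - intros x1 y1 Hx1 Hy1 H1. specialize (Hbd x1 y1 Hx1 Hy1 H1).
      assert (0 <= e * ((x1 - a) * (b - x1))); [|lra].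
      apply Rmult_le_pos; [lra|]. apply Rmult_le_pos; lra.
    - intros x1 y1 Hx1 Hy1. destruct (Hint x1 y1 Hx1 Hy1) as [l [Hl1 Hl2]].
      exists (l + - (2 * e)). split; [|lra].
      apply (lap_at_plus v (fun x y => e * ((x - a) * (b - x)))); [exact Hl1|].
      exists (2 * (- e)), (2 * 0). split; [|split; [|ring]].
      + apply has_d2_ext with (fun t => - e * t ^ 2 + e * (a + b) * t + - e * a * b);
          [intros; ring|]. apply has_d2_quad.
      + apply has_d2_ext with (fun t => 0 * t ^ 2 + 0 * t + e * ((x1 - a) * (b - x1)));
          [intros; ring|]. apply has_d2_quad. }
  apply Rnot_lt_le; intros Hneg.
  set (P := (x - a) * (b - x)) in *.
  assert (HP : 0 <= P) by (apply Rmult_le_pos; lra).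
  (* For this [e] one has [e P < - v / 2], so the perturbed value would still be negative. *)
  assert (He : 0 < - v x y / (2 * (P + 1))) by (apply Rdiv_lt_0_compat; lra).
  specialize (Hp _ He).
  replace (- v x y / (2 * (P + 1)) * P) with (- v x y / 2 * (P / (P + 1))) in Hp by (field; lra).
  assert (P / (P + 1) < 1) by (apply Rlt_div_l; lra).
  assert (0 <= P / (P + 1)) by (apply Rdiv_le_0_compat; lra).
  nra.
Qed.

Lemma cont2_affine f a b c : cont2 f -> cont2 (fun x y => f (a * x + b) (y + c)).
Proof.
  intros Hf. apply (cont2_comp2 f (fun x _ => a * x + b) (fun _ y => y + c) Hf).
  - apply (cont2_fst (fun x => a * x + b)). intros t. continuous_by_derive.
  - apply (cont2_snd (fun y => y + c)). intros t. continuous_by_derive.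
Qed.

(* The barrier is the one used for the interior gradient estimate of Poisson's
   equation in Gilbarg-Trudinger, Section 3.4: it is compared with the part of [u]
   that is odd about [x0] on half of a square of side [2 d]. *)
Lemma odd_part_le (u : R -> R -> R) (L : R -> R -> R) (M N d : R) :
  cont2 u -> (forall x y, lap_at u x y (L x y)) ->
  (forall x y, Rabs (u x y) <= M) -> (forall x y, Rabs (L x y) < N) -> 0 < d ->
  forall x0 y0 p, 0 <= p <= d ->
  u (x0 + p) y0 - u (x0 - p) y0 <= 2 * p * (2 * M / d + d * N / 2).
Proof.
  intros Hu HL HM HN Hd x0 y0 p Hp.
  assert (HM0 : 0 <= M) by (eapply Rle_trans; [apply Rabs_pos | apply (HM 0 0)]).
  assert (HN0 : 0 < N) by (eapply Rle_lt_trans; [apply Rabs_pos | apply (HN 0 0)]).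
  (* The first term of [B] is harmonic and at least [M] on the three sides away from [p = 0]; the
     second has Laplacian [- N] and vanishes at [p = 0] and [p = d]. On the side [p = 0] the odd
     part [phi] itself vanishes. *)
  set (B := fun p q : R => M / d ^ 2 * (q ^ 2 + p * (2 * d - p)) + N * (p * (d - p)) / 2).
  set (phi := fun p q : R => / 2 * (u (1 * p + x0) (q + y0) - u ((-1) * p + x0) (q + y0))).
  assert (HMd : M / d ^ 2 * d ^ 2 = M) by (field; lra).
  assert (HMd0 : 0 <= M / d ^ 2) by (apply Rdiv_le_0_compat; [exact HM0 | nra]).
  assert (Key : forall p q, 0 <= p <= d -> - d <= q <= d -> 0 <= B p q - phi p q).
  { apply (min_principle_strict (fun p q => B p q - phi p q)).
    - apply cont2_minus.
      + apply cont2_plus.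
        * apply cont2_mult; [apply cont2_const|].
          apply cont2_plus.
          -- apply (cont2_snd (fun q => q ^ 2)). intros t. continuous_by_derive.
          -- apply (cont2_fst (fun p => p * (2 * d - p))). intros t. continuous_by_derive.
        * apply (cont2_fst (fun p => N * (p * (d - p)) / 2)). intros t. continuous_by_derive.
      + apply cont2_mult; [apply cont2_const|].
        apply cont2_minus; now apply cont2_affine.
    - intros s q Hs Hq Hb.
      assert (HB1 : 0 <= N * (s * (d - s)) / 2).
      { assert (0 <= s * (d - s)) by (apply Rmult_le_pos; lra). nra. }
      assert (Hphi : phi s q <= M).
      { unfold phi. generalize (HM (1 * s + x0) (q + y0)) (HM ((-1) * s + x0) (q + y0)).
        intros A1 A2. abs_lra. }
      destruct (Req_dec s 0) as [->|Hs0].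
      + assert (E : phi 0 q = 0) by (unfold phi; replace (1 * 0 + x0) with x0 by ring;
          replace ((-1) * 0 + x0) with x0 by ring; ring).
        rewrite E. unfold B. assert (0 <= M / d ^ 2 * q ^ 2) by (apply Rmult_le_pos; nra).
        nra.
      + assert (d ^ 2 <= q ^ 2 + s * (2 * d - s)).
        { destruct Hb as [E|[E|[E|E]]]; [lra | subst; nra ..]. }
        unfold B. assert (M / d ^ 2 * d ^ 2 <= M / d ^ 2 * (q ^ 2 + s * (2 * d - s)))
          by (now apply Rmult_le_compat_l).
        lra.
    - intros s q Hs Hq.
      exists ((- N) - / 2 * (L (1 * s + x0) (q + y0) - L ((-1) * s + x0) (q + y0))).
      split.
      + apply lap_at_minus.
        * exists (2 * (- (M / d ^ 2) - N / 2)), (2 * (M / d ^ 2)).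
          split; [|split; [|lra]].
          -- apply has_d2_ext with (fun t => (- (M / d ^ 2) - N / 2) * t ^ 2
               + (M / d ^ 2 * (2 * d) + N * d / 2) * t + M / d ^ 2 * q ^ 2);
               [intros t; unfold B; field; lra|]. apply has_d2_quad.
          -- apply has_d2_ext with (fun t => M / d ^ 2 * t ^ 2 + 0 * t
               + (M / d ^ 2 * (s * (2 * d - s)) + N * (s * (d - s)) / 2));
               [intros t; unfold B; field; lra|]. apply has_d2_quad.
        * apply lap_at_scal. apply lap_at_minus.
          -- apply (lap_at_affine 1 x0 y0 u); [ring | apply HL].
          -- apply (lap_at_affine (-1) x0 y0 u); [ring | apply HL].
      + generalize (HN (1 * s + x0) (q + y0)) (HN ((-1) * s + x0) (q + y0)).
        intros A1 A2. abs_lra. }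
  specialize (Key p 0 Hp ltac:(lra)). unfold B, phi in Key.
  replace (1 * p + x0) with (x0 + p) in Key by ring.
  replace ((-1) * p + x0) with (x0 - p) in Key by ring.
  rewrite Rplus_0_l in Key.
  assert (Hup : M / d ^ 2 * (0 ^ 2 + p * (2 * d - p)) + N * (p * (d - p)) / 2
     <= p * (2 * M / d + d * N / 2)).
  { replace (p * (2 * M / d + d * N / 2)) with
      (M / d ^ 2 * (p * (2 * d)) + N * (p * d) / 2) by (field; lra).
    assert (M / d ^ 2 * (0 ^ 2 + p * (2 * d - p)) <= M / d ^ 2 * (p * (2 * d)))
      by (apply Rmult_le_compat_l; [assumption | nra]).
    assert (0 <= p * p) by nra. nra. }
  lra.
Qed.

(** If [l > C], both one-sided quotients at a small step exceed [(l + C) / 2], and so does their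
    mean, the symmetric quotient. *)
Lemma is_derive_sym_quotient (f : R -> R) (x l C d : R) :
  is_derive f x l -> 0 < d ->
  (forall p, 0 <= p <= d -> f (x + p) - f (x - p) <= 2 * p * C) -> l <= C.
Proof.
  intros Hf Hd H. apply Rnot_lt_le; intros HC.
  apply is_derive_Reals in Hf.
  destruct (Hf ((l - C) / 2) ltac:(lra)) as [e He].
  set (h := Rmin (e / 2) d).
  assert (Hh : 0 < h /\ h < e /\ h <= d).
  { unfold h. generalize (cond_pos e). unfold Rmin; destruct Rle_dec; lra. }
  assert (A := He h ltac:(lra) ltac:(apply Rabs_def1; lra)).
  assert (B := He (- h) ltac:(lra) ltac:(apply Rabs_def1; lra)).
  apply Rabs_def2 in A. apply Rabs_def2 in B.
  specialize (H h ltac:(lra)).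
  assert (E1 : (f (x + h) - f x) / h * h = f (x + h) - f x) by (field; lra).
  assert (E2 : (f (x + - h) - f x) / - h * h = f x - f (x - h))
    by (unfold Rminus; field; lra).
  nra.
Qed.

(** The length [d] stays free: [d = 4] closes the a priori bound, [d = 1] gives a plain gradient
    bound, [d = sqrt e1] interpolates between a small function and a bounded Laplacian, and a power
    of the increment serves the Hoelder estimate. *)
Lemma gradient_bound_x (u : R -> R -> R) (L : R -> R -> R) (M N d : R) :
  cont2 u -> (forall x y, lap_at u x y (L x y)) ->
  (forall x y, Rabs (u x y) <= M) -> (forall x y, Rabs (L x y) < N) -> 0 < d ->
  forall x y l, is_derive (fun t => u t y) x l -> Rabs l <= 2 * M / d + d * N / 2.
Proof.
  intros Hu HL HM HN Hd x y l Hl. apply Rabs_le. split.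
  - assert (- l <= 2 * M / d + d * N / 2); [|lra].
    apply (is_derive_sym_quotient (fun t => - u t y) x _ _ d).
    + exact (is_derive_opp _ _ _ Hl).
    + exact Hd.
    + intros p Hp.
      apply (odd_part_le (fun x y => - u x y) (fun x y => - L x y)); try assumption.
      * apply (cont2_comp (fun t => - t)); [|exact Hu]. intros t. continuous_by_derive.
      * intros x1 y1. replace (- L x1 y1) with ((-1) * L x1 y1) by ring.
        apply lap_at_ext with (fun x y => (-1) * u x y); [intros; ring|].
        now apply lap_at_scal.
      * intros; now rewrite Rabs_Ropp.
      * intros; now rewrite Rabs_Ropp.
  - apply (is_derive_sym_quotient (fun t => u t y) x _ _ d); try assumption.
    intros p Hp. now apply (odd_part_le u L).
Qed.

Lemma cont2_swap f : cont2 f -> cont2 (fun x y => f y x).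
Proof.
  intros H. apply (cont2_comp2 f (fun _ y => y) (fun x _ => x) H).
  - apply (cont2_snd (fun y => y)). intros; apply continuous_id.
  - apply (cont2_fst (fun y => y)). intros; apply continuous_id.
Qed.

Lemma lap_at_swap u x y l : lap_at u y x l -> lap_at (fun x y => u y x) x y l.
Proof.
  intros [p [q [A [B ->]]]]. exists q, p. split; [|split]; [assumption..|ring].
Qed.

Lemma gradient_bound_y (u : R -> R -> R) (L : R -> R -> R) (M N d : R) :
  cont2 u -> (forall x y, lap_at u x y (L x y)) ->
  (forall x y, Rabs (u x y) <= M) -> (forall x y, Rabs (L x y) < N) -> 0 < d ->
  forall x y l, is_derive (fun t => u x t) y l -> Rabs l <= 2 * M / d + d * N / 2.
Proof.
  intros Hu HL HM HN Hd x y l Hl.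
  apply (gradient_bound_x (fun x y => u y x) (fun x y => L y x)) with y x; auto.
  - now apply cont2_swap.
  - intros; apply lap_at_swap, HL.
Qed.

(** * Periodic odd functions, subsolution and barrier *)

Lemma periodic_Z (f : R -> R) :
  (forall x, f (x + 1) = f x) -> forall (k : Z) x, f (x + IZR k) = f x.
Proof.
  intros Hf.
  assert (Hn : forall n x, f (x + INR n) = f x).
  { induction n; intros x; [now rewrite Rplus_0_r|].
    rewrite S_INR, <- Rplus_assoc, Hf. apply IHn. }
  intros k x. destruct (Z_le_gt_dec 0 k) as [Hk|Hk].
  - rewrite <- (Z2Nat.id k Hk), <- INR_IZR_INZ. apply Hn.
  - rewrite <- (Hn (Z.to_nat (- k)) (x + IZR k)), INR_IZR_INZ, Z2Nat.id, opp_IZR by lia.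
    f_equal; ring.
Qed.

Lemma nearest_Z (x : R) : exists k : Z, - / 2 <= x + IZR k <= / 2.
Proof.
  exists (- (up (x - / 2)))%Z. rewrite opp_IZR.
  destruct (archimed (x - / 2)). lra.
Qed.

Lemma periodic2_reduce (x y : R) :
  exists x' y', - / 2 <= x' <= / 2 /\ - / 2 <= y' <= / 2 /\
    forall f, periodic2 f -> f x y = f x' y'.
Proof.
  destruct (nearest_Z x) as [k Hk]. destruct (nearest_Z y) as [l Hl].
  exists (x + IZR k), (y + IZR l). split; [|split]; [assumption..|].
  intros f Hf.
  rewrite (periodic_Z (fun t => f t (y + IZR l))); [|intros; apply Hf].
  now rewrite (periodic_Z (fun t => f x t)); [|intros; apply Hf].
Qed.

Lemma periodic_max_abs f :
  cont2 f -> periodic2 f -> exists x0 y0, forall x y, Rabs (f x y) <= Rabs (f x0 y0).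
Proof.
  intros Hf Hp.
  destruct (box_min (fun x y => - Rabs (f x y)) (- / 2) (/ 2) (- / 2) (/ 2))
    as [x0 [y0 [_ [_ H]]]]; try lra.
  - apply (cont2_comp (fun t => - Rabs t)); [|exact Hf].
    intros t. apply (continuous_opp (V := R_NormedModule) Rabs). apply continuous_Rabs.
  - exists x0, y0. intros x y.
    destruct (periodic2_reduce x y) as [x' [y' [Hx [Hy E]]]].
    rewrite (E f Hp). specialize (H x' y' Hx Hy). lra.
Qed.

Lemma bounded_derive_lipschitz (f : R -> R) G :
  (forall t, ex_derive f t) -> (forall t l, is_derive f t l -> Rabs l <= G) ->
  forall a b, Rabs (f b - f a) <= G * Rabs (b - a).
Proof.
  intros Hd HG a b.
  destruct (mvt f (Derive f) a b) as [c [_ E]].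
  { intros; now apply Derive_correct. }
  rewrite E, Rabs_mult. apply Rmult_le_compat_r; [apply Rabs_pos|].
  apply (HG c). now apply Derive_correct.
Qed.

Lemma has_d2_ex_derive (f : R -> R) x l : has_d2 f x l -> ex_derive f x.
Proof.
  intros [f' [H _]]. exists (f' x). exact (locally_singleton _ _ H).
Qed.

Lemma lap_at_ex_derive u x y l :
  lap_at u x y l -> ex_derive (fun t => u t y) x /\ ex_derive (fun t => u x t) y.
Proof.
  intros [p [q [A [B _]]]]. split; eapply has_d2_ex_derive; eassumption.
Qed.

(** Every point of the torus is within [1/2] of the origin in each coordinate, so [u 0 0 = 0] gives
    [M <= G] for the gradient bound [G]. With [d = 4], [G = M / 2 + 2 N], and the term [M / 2] is
    absorbed, leaving [G <= 4 N]. *)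
Lemma normalized_bound (u L : R -> R -> R) (N : R) :
  cont2 u -> periodic2 u -> u 0 0 = 0 ->
  (forall x y, lap_at u x y (L x y)) -> (forall x y, Rabs (L x y) < N) ->
  (forall x y, Rabs (u x y) <= 4 * N) /\
  (forall x y l, is_derive (fun t => u t y) x l -> Rabs l <= 4 * N) /\
  (forall x y l, is_derive (fun t => u x t) y l -> Rabs l <= 4 * N).
Proof.
  intros Hu Hp H0 HL HN.
  destruct (periodic_max_abs u Hu Hp) as [x0 [y0 HM]].
  set (M := Rabs (u x0 y0)) in *.
  set (G := 2 * M / 4 + 4 * N / 2).
  assert (Gx : forall x y l, is_derive (fun t => u t y) x l -> Rabs l <= G).
  { apply (gradient_bound_x u L M N 4); auto; lra. }
  assert (Gy : forall x y l, is_derive (fun t => u x t) y l -> Rabs l <= G).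
  { apply (gradient_bound_y u L M N 4); auto; lra. }
  assert (HMG : M <= G).
  { destruct (periodic2_reduce x0 y0) as [x [y [Hx [Hy E]]]].
    unfold M. rewrite (E u Hp).
    assert (A := bounded_derive_lipschitz (fun t => u t y) G
      (fun t => proj1 (lap_at_ex_derive _ _ _ _ (HL t y))) (fun t => Gx t y) 0 x).
    assert (B := bounded_derive_lipschitz (fun t => u 0 t) G
      (fun t => proj2 (lap_at_ex_derive _ _ _ _ (HL 0 t))) (fun t => Gy 0 t) 0 y).
    simpl in A, B. rewrite Rminus_0_r in A, B. rewrite H0, Rminus_0_r in B.
    assert (HG0 : 0 <= G).
    { generalize (Rabs_pos (u x0 y0)) (Rabs_pos (L 0 0)) (HN 0 0). fold M. unfold G. lra. }
    assert (Rabs x <= / 2) by (apply Rabs_le; lra).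
    assert (Rabs y <= / 2) by (apply Rabs_le; lra).
    replace (u x y) with ((u x y - u 0 y) + u 0 y) by ring.
    eapply Rle_trans; [apply Rabs_triang|].
    assert (G * Rabs x <= G * / 2) by (now apply Rmult_le_compat_l).
    assert (G * Rabs y <= G * / 2) by (now apply Rmult_le_compat_l).
    lra. }
  assert (HG4 : G <= 4 * N) by (unfold G in *; lra).
  split; [|split].
  - intros x y. eapply Rle_trans; [apply HM|]. lra.
  - intros x y l Hl. eapply Rle_trans; [eapply Gx, Hl|]; lra.
  - intros x y l Hl. eapply Rle_trans; [eapply Gy, Hl|]; lra.
Qed.

Definition odd2 (f : R -> R -> R) : Prop :=
  forall x y, f (- x) y = - f x y /\ f x (- y) = - f x y.

Lemma odd2_minus f g : odd2 f -> odd2 g -> odd2 (fun x y => f x y - g x y).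
Proof.
  intros Hf Hg x y. rewrite (proj1 (Hf x y)), (proj2 (Hf x y)), (proj1 (Hg x y)), (proj2 (Hg x y)).
  split; ring.
Qed.

Lemma periodic2_minus f g : periodic2 f -> periodic2 g -> periodic2 (fun x y => f x y - g x y).
Proof.
  intros Hf Hg x y.
  now rewrite (proj1 (Hf x y)), (proj2 (Hf x y)), (proj1 (Hg x y)), (proj2 (Hg x y)).
Qed.

Lemma fold1 (x : R) :
  exists x' s, 0 <= x' <= / 2 /\ (s = 1 \/ s = -1) /\
    forall f : R -> R, (forall t, f (t + 1) = f t) -> (forall t, f (- t) = - f t) ->
      f x = s * f x'.
Proof.
  destruct (nearest_Z x) as [k Hk].
  destruct (Rle_dec 0 (x + IZR k)) as [H|H].
  - exists (x + IZR k), 1. split; [lra|]. split; [auto|].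
    intros f Hp _. rewrite (periodic_Z f Hp). ring.
  - exists (- (x + IZR k)), (-1). split; [lra|]. split; [auto|].
    intros f Hp Ho. rewrite Ho, (periodic_Z f Hp). ring.
Qed.

Lemma fold2 (x y : R) :
  exists x' y', 0 <= x' <= / 2 /\ 0 <= y' <= / 2 /\
    exists s, (s = 1 \/ s = -1) /\
    forall f, periodic2 f -> odd2 f -> f x y = s * f x' y'.
Proof.
  destruct (fold1 x) as [x' [s [Hx [Hs Ex]]]]. destruct (fold1 y) as [y' [r [Hy [Hr Ey]]]].
  exists x', y'. split; [|split]; [assumption..|]. exists (s * r). split.
  - destruct Hs as [->| ->], Hr as [->| ->]; lra.
  - intros f Hp Ho.
    rewrite (Ex (fun t => f t y)); [|intros; apply Hp | intros; apply Ho].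
    rewrite (Ey (fun t => f x' t)); [ring|intros; apply Hp | intros; apply Ho].
Qed.

Lemma odd2_abs_bound f B :
  periodic2 f -> odd2 f ->
  (forall x y, 0 <= x <= / 2 -> 0 <= y <= / 2 -> Rabs (f x y) <= B) ->
  forall x y, Rabs (f x y) <= B.
Proof.
  intros Hp Ho H x y.
  destruct (fold2 x y) as [x' [y' [Hx [Hy [s [Hs E]]]]]].
  rewrite (E f Hp Ho), Rabs_mult.
  replace (Rabs s) with 1; [rewrite Rmult_1_l; auto|].
  destruct Hs as [->| ->]; [now rewrite Rabs_R1 | now rewrite Rabs_left by lra; ring].
Qed.

(** On the lines through [1/2], period one identifies [1/2] with [- 1/2], which oddness sends to the
    opposite value. This is how odd periodic functions acquire zero boundary values on the quarter
    cell. *)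
Lemma odd2_zero f x y :
  periodic2 f -> odd2 f -> x = 0 \/ x = / 2 \/ y = 0 \/ y = / 2 -> f x y = 0.
Proof.
  intros Hp Ho [->|[->|[->| ->]]].
  - generalize (proj1 (Ho 0 y)). rewrite Ropp_0. lra.
  - generalize (proj1 (Ho (/ 2) y)) (proj1 (Hp (- / 2) y)).
    replace (- / 2 + 1) with (/ 2) by field. lra.
  - generalize (proj2 (Ho x 0)). rewrite Ropp_0. lra.
  - generalize (proj2 (Ho x (/ 2))) (proj2 (Hp x (- / 2))).
    replace (- / 2 + 1) with (/ 2) by field. lra.
Qed.

Lemma odd2_nonneg (v L : R -> R -> R) :
  cont2 v -> periodic2 v -> odd2 v ->
  (forall x y, lap_at v x y (L x y)) ->
  (forall x y, 0 < x < / 2 -> 0 < y < / 2 -> L x y <= 0) ->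
  forall x y, 0 <= x <= / 2 -> 0 <= y <= / 2 -> 0 <= v x y.
Proof.
  intros Hv Hp Ho HL HL0.
  apply min_principle; [exact Hv| |].
  - intros x y _ _ Hb. rewrite (odd2_zero v x y Hp Ho Hb). lra.
  - intros x y Hx Hy. exists (L x y). auto.
Qed.

Definition sin2pi (x : R) : R := sin (2 * PI * x).

Lemma sin2pi_periodic x : sin2pi (x + 1) = sin2pi x.
Proof.
  unfold sin2pi. replace (2 * PI * (x + 1)) with (2 * PI * x + 2 * PI) by ring.
  rewrite sin_plus, cos_2PI, sin_2PI; ring.
Qed.

Lemma sin2pi_odd x : sin2pi (- x) = - sin2pi x.
Proof. unfold sin2pi. rewrite <- sin_neg. f_equal; ring. Qed.

Lemma sin2pi_pos x : 0 < x < / 2 -> 0 < sin2pi x.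
Proof.
  intros Hx. generalize PI_RGT_0; intros. apply sin_gt_0; nra.
Qed.

Lemma sin2pi_nonneg x : 0 <= x <= / 2 -> 0 <= sin2pi x.
Proof.
  intros Hx. generalize PI_RGT_0; intros. apply sin_ge_0; nra.
Qed.

Lemma sin2pi_le_1 x : sin2pi x <= 1.
Proof. apply SIN_bound. Qed.

Lemma sin2pi_derive x : is_derive sin2pi x (2 * PI * cos (2 * PI * x)).
Proof. unfold sin2pi; auto_derive; [exact I | ring]. Qed.

Lemma sin2pi_continuous x : continuous sin2pi x.
Proof. apply (continuous_derivable _ _ sin2pi_derive). Qed.

Lemma sin2pi_has_d2 x : has_d2 sin2pi x (- (2 * PI) ^ 2 * sin2pi x).
Proof.
  exists (fun x => 2 * PI * cos (2 * PI * x)). split.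
  - apply filter_forall. apply sin2pi_derive.
  - unfold sin2pi; auto_derive; [exact I | ring].
Qed.

Lemma sin2pi_cube_has_d2 x :
  has_d2 (fun x => sin2pi x ^ 3) x ((2 * PI) ^ 2 * (6 * sin2pi x - 9 * sin2pi x ^ 3)).
Proof.
  exists (fun x => 3 * sin2pi x ^ 2 * (2 * PI * cos (2 * PI * x))). split.
  - apply filter_forall. intros t. unfold sin2pi; auto_derive; [exact I | ring].
  - unfold sin2pi; auto_derive; [exact I|].
    generalize (sin2_cos2 (2 * PI * x)); unfold Rsqr; intros E.
    set (si := sin _) in *; set (co := cos _) in *.
    replace (6 * si - 9 * si ^ 3) with (6 * si * (si * si + co * co) - 9 * si ^ 3)
      by (rewrite E; ring).
    ring.
Qed.

Definition ss (x y : R) : R := sin2pi x * sin2pi y.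

(* A trigonometric polynomial which is subharmonic near the boundary of the
   quarter cell, where [g] may vanish, see [Wsub_lap]. *)
Definition Wsub (x y : R) : R :=
  / 5000 * (ss x y * (9 + 3 * (sin2pi x ^ 2 + sin2pi y ^ 2) + 5 * ss x y ^ 2)).

(** The coefficients 3 and 5 are tuned so that the terms in [sin^3 sin] cancel in the Laplacian,
    which becomes a function of [ss] alone; its sign is then read off from [5 ss^2 <= 1]. *)
Lemma Wsub_lap x y :
  lap_at Wsub x y (/ 5000 * ((2 * PI) ^ 2 * (18 * ss x y * (1 - 5 * ss x y ^ 2)))).
Proof.
  unfold ss.
  exists (/ 5000 * sin2pi y * ((9 + 3 * sin2pi y ^ 2) * (- (2 * PI) ^ 2 * sin2pi x)
         + (3 + 5 * sin2pi y ^ 2) * ((2 * PI) ^ 2 * (6 * sin2pi x - 9 * sin2pi x ^ 3)))),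
     (/ 5000 * sin2pi x * ((9 + 3 * sin2pi x ^ 2) * (- (2 * PI) ^ 2 * sin2pi y)
         + (3 + 5 * sin2pi x ^ 2) * ((2 * PI) ^ 2 * (6 * sin2pi y - 9 * sin2pi y ^ 3)))).
  split; [|split; [|ring]].
  - apply has_d2_ext with (fun t => / 5000 * sin2pi y * ((9 + 3 * sin2pi y ^ 2) * sin2pi t
      + (3 + 5 * sin2pi y ^ 2) * sin2pi t ^ 3)); [intros; unfold Wsub, ss; ring|].
    apply has_d2_scal, has_d2_plus; apply has_d2_scal; [apply sin2pi_has_d2 | apply sin2pi_cube_has_d2].
  - apply has_d2_ext with (fun t => / 5000 * sin2pi x * ((9 + 3 * sin2pi x ^ 2) * sin2pi t
      + (3 + 5 * sin2pi x ^ 2) * sin2pi t ^ 3)); [intros; unfold Wsub, ss; ring|].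
    apply has_d2_scal, has_d2_plus; apply has_d2_scal; [apply sin2pi_has_d2 | apply sin2pi_cube_has_d2].
Qed.

Lemma Wsub_periodic : periodic2 Wsub.
Proof. intros x y; unfold Wsub, ss; now rewrite !sin2pi_periodic. Qed.

Lemma Wsub_odd : odd2 Wsub.
Proof. intros x y; unfold Wsub, ss; rewrite !sin2pi_odd; split; ring. Qed.

Lemma ss_cont : cont2 ss.
Proof.
  apply (cont2_mult (fun x _ => sin2pi x) (fun _ y => sin2pi y));
    [apply cont2_fst | apply cont2_snd]; apply sin2pi_continuous.
Qed.

Lemma ss_range x y : 0 <= x <= / 2 -> 0 <= y <= / 2 -> 0 <= ss x y <= 1.
Proof.
  intros Hx Hy; unfold ss. generalize (sin2pi_nonneg x Hx) (sin2pi_nonneg y Hy) (sin2pi_le_1 x) (sin2pi_le_1 y).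
  intros; nra.
Qed.

Lemma Wsub_ge x y : 0 <= x <= / 2 -> 0 <= y <= / 2 -> 9 / 5000 * ss x y <= Wsub x y.
Proof.
  intros Hx Hy. generalize (ss_range x y Hx Hy); intros H. unfold Wsub.
  assert (0 <= sin2pi x ^ 2) by apply pow2_ge_0. assert (0 <= sin2pi y ^ 2) by apply pow2_ge_0.
  assert (0 <= ss x y ^ 2) by apply pow2_ge_0.
  assert (0 <= ss x y * (3 * (sin2pi x ^ 2 + sin2pi y ^ 2) + 5 * ss x y ^ 2)) by (apply Rmult_le_pos; lra).
  lra.
Qed.

(* Superharmonic barrier for a source supported in [{ss < e}]: its second
   derivative in [ss] behaves like [- 1 / ss] there while it stays below [e]. *)
Definition Phi (e t : R) : R := Rabs t * (ln (Rabs t + e) - ln (Rabs t)).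

Lemma ln_1p_le z : 0 <= z -> ln (1 + z) <= z.
Proof.
  intros Hz. destruct (Req_dec z 0) as [->|Hz0]; [rewrite Rplus_0_r, ln_1; lra|].
  rewrite <- (ln_exp z) at 2. left. apply ln_increasing; [lra|].
  apply exp_ineq1; lra.
Qed.

Lemma Phi_pos_eq e t : 0 < e -> 0 < t -> Phi e t = t * ln (1 + e / t).
Proof.
  intros He Ht. unfold Phi. rewrite Rabs_right by lra.
  rewrite <- ln_div by lra. do 2 f_equal. field; lra.
Qed.

Lemma Phi_nonneg e t : 0 < e -> 0 <= Phi e t.
Proof.
  intros He. unfold Phi. destruct (Req_dec t 0) as [->|Ht]; [rewrite Rabs_R0; lra|].
  apply Rabs_pos_lt in Ht. apply Rmult_le_pos; [lra|].
  assert (ln (Rabs t) < ln (Rabs t + e)) by (apply ln_increasing; lra). lra.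
Qed.

Lemma Phi_le e t : 0 < e -> 0 <= t -> Phi e t <= e.
Proof.
  intros He Ht. destruct (Req_dec t 0) as [->|Ht0].
  - unfold Phi. rewrite Rabs_R0. lra.
  - rewrite Phi_pos_eq by lra.
    assert (0 < e / t) by (apply Rdiv_lt_0_compat; lra).
    replace e with (t * (e / t)) at 2 by (field; lra).
    apply Rmult_le_compat_l; [lra|]. apply ln_1p_le; lra.
Qed.

(** With [q = sqrt (e / t)], [1 + q^2 <= (1 + q)^2] gives [ln (1 + e / t) <= 2 ln (1 + q) <= 2 q].
    Serves only the continuity of [Phi] at 0. *)
Lemma Phi_le_sqrt e t : 0 < e -> 0 < t -> Phi e t <= 2 * sqrt (e * t).
Proof.
  intros He Ht. rewrite Phi_pos_eq by lra.
  assert (Hz : 0 < e / t) by (apply Rdiv_lt_0_compat; lra).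
  assert (Hq := sqrt_lt_R0 _ Hz). assert (Eq := sqrt_sqrt (e / t) ltac:(lra)).
  set (q := sqrt (e / t)) in *.
  assert (A : ln (1 + e / t) <= 2 * q).
  { apply Rle_trans with (ln ((1 + q) * (1 + q))).
    - apply ln_le; nra.
    - rewrite ln_mult by lra. generalize (ln_1p_le q ltac:(lra)); lra. }
  replace (sqrt (e * t)) with (q * t).
  - nra.
  - symmetry. apply sqrt_lem_1; try nra.
    replace (q * t * (q * t)) with (q * q * (t * t)) by ring. rewrite Eq. field; lra.
Qed.

(** The minimum principle asks for continuity on the whole plane, where [ss] changes sign; this is
    the reason for the absolute values in [Phi]. *)
Lemma Phi_continuous e t : 0 < e -> continuous (Phi e) t.
Proof.
  intros He. destruct (Req_dec t 0) as [->|Ht].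
  - apply continuity_pt_filterlim. intros r Hr.
    exists (r * r / (8 * e)). split; [apply Rdiv_lt_0_compat; nra|].
    intros x [_ Hx]. simpl in *; unfold Rdist in *. rewrite Rminus_0_r in Hx.
    replace (Phi e 0) with 0 by (unfold Phi; rewrite Rabs_R0; ring).
    rewrite Rminus_0_r, Rabs_right by (apply Rle_ge, Phi_nonneg; lra).
    destruct (Req_dec x 0) as [->|Hx0]; [unfold Phi; rewrite Rabs_R0; lra|].
    apply Rabs_pos_lt in Hx0.
    replace (Phi e x) with (Phi e (Rabs x)) by (unfold Phi; now rewrite Rabs_Rabsolu).
    eapply Rle_lt_trans; [now apply Phi_le_sqrt|].
    assert (Hlt : e * Rabs x < (r / 2) * (r / 2)).
    { apply (Rmult_lt_compat_l e) in Hx; [|lra].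
      replace (e * (r * r / (8 * e))) with (r * r / 8) in Hx by (field; lra). nra. }
    apply sqrt_lt_1 in Hlt; [|nra..]. rewrite sqrt_square in Hlt by lra. lra.
  - assert (Ht' := Rabs_pos_lt _ Ht).
    apply (continuous_comp Rabs (fun a => a * (ln (a + e) - ln a))); [apply continuous_Rabs|].
    apply (ex_derive_continuous (fun a => a * (ln (a + e) - ln a))).
    auto_derive; repeat split; lra.
Qed.

Lemma has_d2_comp (h h1 f f1 : R -> R) x m l :
  locally (f x) (fun t => is_derive h t (h1 t)) -> is_derive h1 (f x) m ->
  (forall t, is_derive f t (f1 t)) -> is_derive f1 x l ->
  has_d2 (fun t => h (f t)) x (m * f1 x ^ 2 + h1 (f x) * l).
Proof.
  intros Hh Hm Hf Hl. exists (fun t => f1 t * h1 (f t)). split.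
  - assert (C := continuous_derivable _ _ Hf x).
    generalize (C _ Hh). unfold filtermap. apply filter_imp. intros t A.
    exact (is_derive_comp h f t _ _ A (Hf t)).
  - replace (m * f1 x ^ 2 + h1 (f x) * l) with (l * h1 (f x) + f1 x * (f1 x * m)) by ring.
    apply (is_derive_mult f1 (fun t => h1 (f t))); [exact Hl| |intros; apply Rmult_comm].
    exact (is_derive_comp h1 f x _ _ Hm (Hf x)).
Qed.

(** The Laplacian of [Phi(ss)] is [Phi'' |∇ ss|^2 + Phi' Δ ss]. The second term is nonpositive, and
    with [|∇ ss|^2 >= 8 pi^2 s (1 - s)] the first is at most [- 8 pi^2 k (1 - s)],
    [k = e^2 / (s + e)^2]. Where [s < e <= 1/2] one has [k >= 1/4] and [1 - s >= 1/2]. *)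
Lemma barrier_lap (e x y : R) :
  0 < e <= / 2 -> 0 < x < / 2 -> 0 < y < / 2 ->
  exists l, lap_at (fun x y => Phi e (ss x y)) x y l /\ l <= 0 /\
    (ss x y < e -> l <= -1).
Proof.
  intros He Hx Hy.
  assert (HX := sin2pi_pos x Hx). assert (HY := sin2pi_pos y Hy).
  assert (HX1 := sin2pi_le_1 x). assert (HY1 := sin2pi_le_1 y).
  set (h1 := fun t => ln (t + e) - ln t - e / (t + e)).
  set (s := ss x y). assert (Hs : 0 < s) by (apply Rmult_lt_0_compat; assumption).
  set (m := - e ^ 2 / (s * (s + e) ^ 2)).
  assert (Hh : locally s (fun t => is_derive (Phi e) t (h1 t))).
  { apply locally_open_interval with (s / 2) (2 * s); [lra|]. intros t Ht.
    apply is_derive_ext_loc with (fun t => t * (ln (t + e) - ln t)).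
    - apply locally_open_interval with (s / 4) (4 * s); [lra|]. intros r Hr.
      unfold Phi. rewrite Rabs_right by lra. reflexivity.
    - unfold h1. auto_derive; [repeat split; lra | field; lra]. }
  assert (Hm : is_derive h1 s m).
  { unfold h1, m. auto_derive; [repeat split; lra | field; lra]. }
  set (cx := cos (2 * PI * x)). set (cy := cos (2 * PI * y)).
  exists ((m * (2 * PI * cx * sin2pi y) ^ 2 + h1 s * (- (2 * PI) ^ 2 * sin2pi x * sin2pi y))
    + (m * (sin2pi x * (2 * PI * cy)) ^ 2 + h1 s * (- (2 * PI) ^ 2 * sin2pi x * sin2pi y))).
  split; [eexists; eexists; split; [|split; [|reflexivity]]|].
  - apply (has_d2_comp (Phi e) h1 (fun t => ss t y) (fun t => 2 * PI * cos (2 * PI * t) * sin2pi y));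
      [exact Hh | exact Hm | |].
    + intros t. unfold ss, sin2pi. auto_derive; [exact I | ring].
    + unfold sin2pi. auto_derive; [exact I | ring].
  - apply (has_d2_comp (Phi e) h1 (fun t => ss x t) (fun t => sin2pi x * (2 * PI * cos (2 * PI * t))));
      [exact Hh | exact Hm | |].
    + intros t. unfold ss, sin2pi. auto_derive; [exact I | ring].
    + unfold sin2pi. auto_derive; [exact I | ring].
  (* [Phi' >= 0] amounts to [ln r <= r - 1] for [r = s / (s + e)]. *)
  - assert (Hh1 : 0 <= h1 s).
    { unfold h1.
      assert (A := ln_1p_le ((e / s)) ltac:(apply Rlt_le, Rdiv_lt_0_compat; lra)).
      assert (0 < e / (s + e)) by (apply Rdiv_lt_0_compat; lra).
      assert (0 < s / (s + e)) by (apply Rdiv_lt_0_compat; lra).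
      assert (E : ln (s + e) - ln s = - ln (s / (s + e))) by (rewrite ln_div; lra).
      rewrite E.
      assert (B : ln (s / (s + e)) <= s / (s + e) - 1).
      { rewrite <- (ln_exp (s / (s + e) - 1)). apply ln_le; [assumption|].
        generalize (exp_ineq1_le (s / (s + e) - 1)). lra. }
      replace (e / (s + e)) with (1 - s / (s + e)) by (field; lra). lra. }
    assert (Ex : cx ^ 2 = 1 - sin2pi x ^ 2).
    { unfold cx, sin2pi. generalize (sin2_cos2 (2 * PI * x)); unfold Rsqr. lra. }
    assert (Ey : cy ^ 2 = 1 - sin2pi y ^ 2).
    { unfold cy, sin2pi. generalize (sin2_cos2 (2 * PI * y)); unfold Rsqr. lra. }
    assert (HP : 9 < PI ^ 2) by (generalize PI2_3_2; intros; nra).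
    set (k := e ^ 2 / (s + e) ^ 2).
    assert (Hk : 0 < k) by (unfold k; apply Rdiv_lt_0_compat; nra).
    assert (Em : m * s = - k) by (unfold m, k; field; lra).
    (* For [X], [Y] the two sines the right side is [X^2 + Y^2 - 2 X^2 Y^2], and
       [X^2 + Y^2 >= 2 X Y]. *)
    assert (Hgrad : 2 * s * (1 - s) <= cx ^ 2 * sin2pi y ^ 2 + sin2pi x ^ 2 * cy ^ 2).
    { rewrite Ex, Ey. unfold s, ss. assert (0 <= (sin2pi x - sin2pi y) ^ 2) by apply pow2_ge_0. nra. }
    assert (Hm0 : m <= 0).
    { apply Rnot_lt_le; intros Hm0. assert (0 < m * s) by (now apply Rmult_lt_0_compat). lra. }
    assert (Hs1 : s <= 1) by (unfold s, ss; nra).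
    assert (Hle : m * (2 * PI * cx * sin2pi y) ^ 2 + h1 s * (- (2 * PI) ^ 2 * sin2pi x * sin2pi y)
      + (m * (sin2pi x * (2 * PI * cy)) ^ 2 + h1 s * (- (2 * PI) ^ 2 * sin2pi x * sin2pi y))
      <= - (8 * PI ^ 2 * (k * (1 - s)))).
    { replace (m * (2 * PI * cx * sin2pi y) ^ 2 + h1 s * (- (2 * PI) ^ 2 * sin2pi x * sin2pi y)
      + (m * (sin2pi x * (2 * PI * cy)) ^ 2 + h1 s * (- (2 * PI) ^ 2 * sin2pi x * sin2pi y)))
      with (4 * PI ^ 2 * (m * (cx ^ 2 * sin2pi y ^ 2 + sin2pi x ^ 2 * cy ^ 2)) - 8 * PI ^ 2 * (h1 s * s))
        by (unfold s, ss; ring).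
      assert (m * (cx ^ 2 * sin2pi y ^ 2 + sin2pi x ^ 2 * cy ^ 2) <= m * (2 * s * (1 - s)))
        by (now apply Rmult_le_compat_neg_l).
      replace (m * (2 * s * (1 - s))) with (- (2 * (k * (1 - s)))) in H
        by (replace k with (- (m * s)) by lra; ring).
      assert (0 <= h1 s * s) by (apply Rmult_le_pos; lra). nra. }
    split.
    + eapply Rle_trans; [exact Hle|]. assert (0 <= k * (1 - s)) by (apply Rmult_le_pos; lra). nra.
    + intros Hse. eapply Rle_trans; [exact Hle|].
      assert (/ 4 <= k).
      { unfold k. apply Rle_div_r; nra. }
      assert (/ 4 * / 2 <= k * (1 - s)) by (apply Rmult_le_compat; lra). nra.
Qed.

(** * Functions of class C^k *)

Lemma ext2 (f g : R -> R -> R) : (forall x y, f x y = g x y) -> f = g.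
Proof.
  intros E. apply functional_extensionality; intros x.
  apply functional_extensionality; intros y. apply E.
Qed.

Lemma Ck_cont2 k f : Ck k f -> cont2 f.
Proof. destruct k; [auto | intros H; apply H]. Qed.

Lemma Ck_S k f : Ck (S k) f -> Ck k f.
Proof.
  revert f; induction k; intros f [H1 [H2 [H3 H4]]]; [exact H1|].
  split; [exact H1|]. split; [exact H2|]. split; now apply IHk.
Qed.

Lemma Ck_is_derive_x k f x y : Ck (S k) f -> is_derive (fun t => f t y) x (dx f x y).
Proof. intros [_ [H _]]. exact (Derive_correct (fun t => f t y) x (proj1 (H x y))). Qed.

Lemma Ck_is_derive_y k f x y : Ck (S k) f -> is_derive (fun t => f x t) y (dy f x y).
Proof. intros [_ [H _]]. exact (Derive_correct (fun t => f x t) y (proj2 (H x y))). Qed.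

Lemma is_derive_dx f fx :
  (forall x y, is_derive (fun t => f t y) x (fx x y)) -> dx f = fx.
Proof. intros H. apply ext2; intros x y. now apply is_derive_unique. Qed.

Lemma is_derive_dy f fy :
  (forall x y, is_derive (fun t => f x t) y (fy x y)) -> dy f = fy.
Proof. intros H. apply ext2; intros x y. now apply is_derive_unique. Qed.

Lemma Ck_intro k f fx fy :
  cont2 f -> (forall x y, is_derive (fun t => f t y) x (fx x y)) ->
  (forall x y, is_derive (fun t => f x t) y (fy x y)) ->
  Ck k fx -> Ck k fy -> Ck (S k) f.
Proof.
  intros H0 Hx Hy H1 H2. split; [exact H0|].
  split; [intros x y; split; eexists; [apply Hx | apply Hy]|].
  now rewrite (is_derive_dx f fx Hx), (is_derive_dy f fy Hy).
Qed.

Lemma Ck_const k c : Ck k (fun _ _ => c).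
Proof.
  revert c; induction k; intros c; [apply cont2_const|].
  apply Ck_intro with (fun _ _ => 0) (fun _ _ => 0); auto using cont2_const.
  - intros x y. exact (is_derive_const c x).
  - intros x y. exact (is_derive_const c y).
Qed.

Lemma Ck_plus k f g : Ck k f -> Ck k g -> Ck k (fun x y => f x y + g x y).
Proof.
  revert f g; induction k; intros f g Hf Hg; [now apply cont2_plus|].
  apply Ck_intro with (fun x y => dx f x y + dx g x y) (fun x y => dy f x y + dy g x y).
  - apply cont2_plus; eapply Ck_cont2; eassumption.
  - intros x y. exact (is_derive_plus _ _ _ _ _ (Ck_is_derive_x k f x y Hf) (Ck_is_derive_x k g x y Hg)).
  - intros x y. exact (is_derive_plus _ _ _ _ _ (Ck_is_derive_y k f x y Hf) (Ck_is_derive_y k g x y Hg)).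
  - apply IHk; [apply Hf | apply Hg].
  - apply IHk; [apply Hf | apply Hg].
Qed.

Lemma Ck_mult k f g : Ck k f -> Ck k g -> Ck k (fun x y => f x y * g x y).
Proof.
  revert f g; induction k; intros f g Hf Hg; [now apply cont2_mult|].
  apply Ck_intro with (fun x y => dx f x y * g x y + f x y * dx g x y)
                      (fun x y => dy f x y * g x y + f x y * dy g x y).
  - apply cont2_mult; eapply Ck_cont2; eassumption.
  - intros x y.
    apply (is_derive_mult (fun t => f t y) (fun t => g t y));
      [now apply Ck_is_derive_x with k .. | intros; apply Rmult_comm].
  - intros x y.
    apply (is_derive_mult (fun t => f x t) (fun t => g x t));
      [now apply Ck_is_derive_y with k .. | intros; apply Rmult_comm].
  - apply Ck_plus; apply IHk; (apply Ck_S; assumption) || (apply Hf || apply Hg).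
  - apply Ck_plus; apply IHk; (apply Ck_S; assumption) || (apply Hf || apply Hg).
Qed.

Lemma Ck_scal k c f : Ck k f -> Ck k (fun x y => c * f x y).
Proof. intros H. apply (Ck_mult k (fun _ _ => c)); [apply Ck_const | exact H]. Qed.

Lemma Ck_minus k f g : Ck k f -> Ck k g -> Ck k (fun x y => f x y - g x y).
Proof.
  intros Hf Hg. replace (fun x y => f x y - g x y) with (fun x y => f x y + (-1) * g x y)
    by (apply ext2; intros; ring).
  apply Ck_plus; [exact Hf | now apply Ck_scal].
Qed.

Section SmoothFamily.

Variable H : nat -> R -> R.
Hypothesis HH : forall n x, is_derive (H n) x (H (S n) x).

Lemma family_continuous n x : continuous (H n) x.
Proof. apply (continuous_derivable _ _ (HH n)). Qed.

(** General in [n] because the derivative of a composition with [H n] involves [H (S n)], to which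
    the induction hypothesis on [k] must apply. *)
Lemma Ck_comp k n u : Ck k u -> Ck k (fun x y => H n (u x y)).
Proof.
  revert n u; induction k; intros n u Hu.
  - apply cont2_comp; [apply family_continuous | exact Hu].
  - apply Ck_intro with (fun x y => dx u x y * H (S n) (u x y))
                        (fun x y => dy u x y * H (S n) (u x y)).
    + apply cont2_comp; [apply family_continuous | eapply Ck_cont2, Hu].
    + intros x y. exact (is_derive_comp (H n) (fun t => u t y) x _ _ (HH n _) (Ck_is_derive_x k u x y Hu)).
    + intros x y. exact (is_derive_comp (H n) (fun t => u x t) y _ _ (HH n _) (Ck_is_derive_y k u x y Hu)).
    + apply Ck_mult; [apply Hu | apply IHk, Ck_S, Hu].
    + apply Ck_mult; [apply Hu | apply IHk, Ck_S, Hu].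
Qed.

Lemma Ck_fst k n : Ck k (fun x _ => H n x).
Proof.
  revert n; induction k; intros n; [apply cont2_fst, family_continuous|].
  apply Ck_intro with (fun x _ => H (S n) x) (fun _ _ => 0).
  - apply cont2_fst, family_continuous.
  - intros x _. apply HH.
  - intros x y. exact (is_derive_const (H n x) y).
  - apply IHk.
  - apply Ck_const.
Qed.

Lemma Ck_snd k n : Ck k (fun _ y => H n y).
Proof.
  revert n; induction k; intros n; [apply cont2_snd, family_continuous|].
  apply Ck_intro with (fun _ _ => 0) (fun _ y => H (S n) y).
  - apply cont2_snd, family_continuous.
  - intros x y. exact (is_derive_const (H n y) x).
  - intros _ y. apply HH.
  - apply Ck_const.
  - apply IHk.
Qed.

End SmoothFamily.

(** The [n]-th derivative of [sin (a x + b)] in a single formula: each derivative shifts the phase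
    by [PI / 2]. The phase [b] makes cosines a special case. *)
Definition sinusoid (a b : R) (n : nat) (x : R) : R := a ^ n * sin (a * x + b + INR n * (PI / 2)).

Lemma sinusoid_derive a b n x : is_derive (sinusoid a b n) x (sinusoid a b (S n) x).
Proof.
  unfold sinusoid. auto_derive; [exact I|].
  rewrite S_INR. replace (a * x + b + (INR n + 1) * (PI / 2)) with
    (PI / 2 + (a * x + b + INR n * (PI / 2))) by field.
  rewrite <- (cos_sin (a * x + b + INR n * (PI / 2))). simpl. ring.
Qed.

Lemma smooth_sin_fst a b : smooth2 (fun x _ => sin (a * x + b)).
Proof.
  intros k. replace (fun x _ : R => sin (a * x + b)) with (fun x _ : R => sinusoid a b 0 x).
  - apply Ck_fst, sinusoid_derive.
  - apply ext2; intros; unfold sinusoid. simpl. rewrite Rmult_1_l. f_equal; ring.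
Qed.

Lemma smooth_sin_snd a b : smooth2 (fun _ y => sin (a * y + b)).
Proof.
  intros k. replace (fun _ y : R => sin (a * y + b)) with (fun _ y : R => sinusoid a b 0 y).
  - apply Ck_snd, sinusoid_derive.
  - apply ext2; intros; unfold sinusoid. simpl. rewrite Rmult_1_l. f_equal; ring.
Qed.

Lemma smooth_sin_tensor a b c d : smooth2 (fun x y => sin (a * x + b) * sin (c * y + d)).
Proof. intros k. exact (Ck_mult k _ _ (smooth_sin_fst a b k) (smooth_sin_snd c d k)). Qed.

Lemma Ck_lap_at u x y : Ck 2 u -> lap_at u x y (laplacian u x y).
Proof.
  intros Hu. exists (dx (dx u) x y), (dy (dy u) x y). split; [|split; [|reflexivity]].
  - exists (fun t => dx u t y). split.
    + apply filter_forall; intros t. now apply Ck_is_derive_x with 1%nat.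
    + apply (Ck_is_derive_x 0 (dx u)). apply Hu.
  - exists (fun t => dy u x t). split.
    + apply filter_forall; intros t. now apply Ck_is_derive_y with 1%nat.
    + apply (Ck_is_derive_y 0 (dy u)). apply Hu.
Qed.

Definition lsum {A : Type} (l : list A) (F : A -> R) : R := fold_right (fun a s => F a + s) 0 l.

Lemma lsum_ext {A} (l : list A) F G : (forall a, F a = G a) -> lsum l F = lsum l G.
Proof. intros E; induction l as [|a l IH]; simpl; [reflexivity | now rewrite E, IH]. Qed.

Lemma lsum_plus {A} (l : list A) F G : lsum l (fun a => F a + G a) = lsum l F + lsum l G.
Proof. induction l as [|a l IH]; simpl; [ring | rewrite IH; ring]. Qed.

Lemma lsum_scal {A} (l : list A) c F : lsum l (fun a => c * F a) = c * lsum l F.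
Proof. induction l as [|a l IH]; simpl; [ring | rewrite IH; ring]. Qed.

Lemma lsum_app {A} (l m : list A) F : lsum (l ++ m) F = lsum l F + lsum m F.
Proof. induction l as [|a l IH]; simpl; [ring | rewrite IH; ring]. Qed.

Lemma lsum_flat_map {A B} (l : list A) (g : A -> list B) F :
  lsum (flat_map g l) F = lsum l (fun a => lsum (g a) F).
Proof. induction l as [|a l IH]; simpl; [reflexivity | now rewrite lsum_app, IH]. Qed.

Lemma Ck_lsum {A} k (l : list A) (F : A -> R -> R -> R) :
  (forall a, Ck k (F a)) -> Ck k (fun x y => lsum l (fun a => F a x y)).
Proof.
  intros H; induction l as [|a l IH]; simpl; [apply Ck_const|].
  now apply (Ck_plus k (F a)).
Qed.

Lemma lap_at_const c x y : lap_at (fun _ _ => c) x y 0.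
Proof.
  exists (2 * 0), (2 * 0). split; [|split; [|ring]];
    (eapply has_d2_ext; [|apply (has_d2_quad 0 0 c)]); intros; simpl; ring.
Qed.

Lemma lap_at_lsum {A} (l : list A) (F : A -> R -> R -> R) (L : A -> R) x y :
  (forall a, lap_at (F a) x y (L a)) ->
  lap_at (fun x y => lsum l (fun a => F a x y)) x y (lsum l L).
Proof.
  intros H; induction l as [|a l IH]; simpl; [apply lap_at_const|].
  now apply (lap_at_plus (F a)).
Qed.

Lemma is_derive_lsum {A} (l : list A) (F : A -> R -> R) (D : A -> R) x :
  (forall a, is_derive (F a) x (D a)) ->
  is_derive (fun t => lsum l (fun a => F a t)) x (lsum l D).
Proof.
  intros H; induction l as [|a l IH]; simpl; [exact (is_derive_const 0 x)|].
  exact (is_derive_plus (F a) _ x _ _ (H a) IH).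
Qed.

(** * Integration and convolution on the torus *)

Definition int1 (f : R -> R) : R := RInt f (-1/2) (1/2).

Definition continuous1 (f : R -> R) : Prop := forall x, continuous f x.

Lemma ex_int (f : R -> R) a b : continuous1 f -> ex_RInt f a b.
Proof. intros H. apply (ex_RInt_continuous (V := CRV)). auto. Qed.

Lemma int1_ext f g : (forall x, f x = g x) -> int1 f = int1 g.
Proof. intros E. apply RInt_ext; auto. Qed.

Lemma int1_plus f g : continuous1 f -> continuous1 g ->
  int1 (fun x => f x + g x) = int1 f + int1 g.
Proof. intros Hf Hg. apply (RInt_plus (V := CRV)); now apply ex_int. Qed.

Lemma int1_scal c f : continuous1 f -> int1 (fun x => c * f x) = c * int1 f.
Proof. intros Hf. apply (RInt_scal (V := CRV)); now apply ex_int. Qed.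

Lemma int1_const c : int1 (fun _ => c) = c.
Proof.
  unfold int1. rewrite (RInt_const (V := CRV)).
  unfold scal; simpl; unfold mult; simpl. field.
Qed.

Lemma int1_le f g : continuous1 f -> continuous1 g -> (forall x, f x <= g x) ->
  int1 f <= int1 g.
Proof. intros Hf Hg H. apply RInt_le; auto using ex_int; lra. Qed.

Lemma int1_abs_le f g : continuous1 f -> continuous1 g -> (forall x, Rabs (f x) <= g x) ->
  Rabs (int1 f) <= int1 g.
Proof.
  intros Hf Hg H. eapply Rle_trans.
  - apply abs_RInt_le; [lra | now apply ex_int].
  - apply int1_le; [|exact Hg|exact H].
    intros x. apply (continuous_comp f Rabs); [apply Hf | apply continuous_Rabs].
Qed.

Lemma cont2_slice h x : cont2 h -> continuous1 (fun y => h x y).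
Proof. intros H y. apply continuity_pt_filterlim. now apply cont2_slice_y. Qed.

Lemma RInt_param_continuous h a b : a < b -> cont2 h ->
  continuous1 (fun x => RInt (fun y => h x y) a b).
Proof.
  intros Hab Hh x. apply continuity_pt_filterlim. intros e He.
  assert (He' : 0 < e / (2 * (b - a))) by (apply Rdiv_lt_0_compat; lra).
  destruct (uniform_continuity_2d h (x - 1) (x + 1) a b
      (fun u v _ _ => proj1 (cont2_pt h) Hh u v) (mkposreal _ He')) as [del Hdel].
  exists (Rmin del 1). split; [apply Rmin_pos; [apply cond_pos | lra]|].
  intros t [_ Ht]. simpl in *; unfold Rdist in *.
  assert (T1 : Rabs (t - x) < del) by (eapply Rlt_le_trans; [exact Ht | apply Rmin_l]).
  assert (T2 : Rabs (t - x) < 1) by (eapply Rlt_le_trans; [exact Ht | apply Rmin_r]).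
  apply Rabs_def2 in T2.
  assert (Hex : forall s, ex_RInt (fun y => h s y) a b)
    by (intros s; apply ex_int; now apply cont2_slice).
  change (Rabs (minus (RInt (fun y => h t y) a b) (RInt (fun y => h x y) a b)) < e).
  rewrite <- (RInt_minus (V := CRV) _ _ _ _ (Hex t) (Hex x)).
  apply Rle_lt_trans with ((b - a) * (e / (2 * (b - a)))).
  - apply abs_RInt_le_const; [lra | |].
    + exact (ex_RInt_minus (V := RV) _ _ _ _ (Hex t) (Hex x)).
    + intros y Hy. left. change (Rabs (h t y - h x y) < e / (2 * (b - a))).
      apply (Hdel x y t y); try lra; try exact T1.
      rewrite Rminus_diag, Rabs_R0. apply cond_pos.
  - replace ((b - a) * (e / (2 * (b - a)))) with (e / 2) by (field; lra). lra.
Qed.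

Lemma int1_continuous h : cont2 h -> continuous1 (fun x => int1 (fun y => h x y)).
Proof. apply RInt_param_continuous; lra. Qed.

Lemma tint_ext f g : (forall x y, f x y = g x y) -> torus_int f = torus_int g.
Proof. intros E. apply int1_ext; intros x. apply int1_ext; auto. Qed.

Lemma tint_plus f g : cont2 f -> cont2 g ->
  torus_int (fun x y => f x y + g x y) = torus_int f + torus_int g.
Proof.
  intros Hf Hg. unfold torus_int; fold (int1 (fun y => f 0 y)).
  change (int1 (fun x => int1 (fun y => f x y + g x y))
    = int1 (fun x => int1 (fun y => f x y)) + int1 (fun x => int1 (fun y => g x y))).
  rewrite <- int1_plus; try now apply int1_continuous.
  apply int1_ext; intros x. apply int1_plus; now apply cont2_slice.
Qed.

Lemma tint_scal c f : cont2 f -> torus_int (fun x y => c * f x y) = c * torus_int f.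
Proof.
  intros Hf.
  change (int1 (fun x => int1 (fun y => c * f x y)) = c * int1 (fun x => int1 (fun y => f x y))).
  rewrite <- int1_scal; try now apply int1_continuous.
  apply int1_ext; intros x. apply int1_scal; now apply cont2_slice.
Qed.

Lemma tint_minus f g : cont2 f -> cont2 g ->
  torus_int (fun x y => f x y - g x y) = torus_int f - torus_int g.
Proof.
  intros Hf Hg.
  rewrite (tint_ext _ (fun x y => f x y + (-1) * g x y)) by (intros; ring).
  rewrite tint_plus, tint_scal; [ring | assumption..|].
  apply cont2_mult; [apply cont2_const | assumption].
Qed.

Lemma tint_abs_le f g : cont2 f -> cont2 g -> (forall x y, Rabs (f x y) <= g x y) ->
  Rabs (torus_int f) <= torus_int g.
Proof.
  intros Hf Hg H. apply int1_abs_le; try now apply int1_continuous.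
  intros x. apply int1_abs_le; auto; now apply cont2_slice.
Qed.

Lemma tint_const c : torus_int (fun _ _ => c) = c.
Proof.
  change (int1 (fun _ => int1 (fun _ => c)) = c). now rewrite int1_const, int1_const.
Qed.

Lemma tint_prod p q : continuous1 p -> continuous1 q ->
  torus_int (fun x y => p x * q y) = int1 p * int1 q.
Proof.
  intros Hp Hq. change (int1 (fun x => int1 (fun y => p x * q y)) = int1 p * int1 q).
  rewrite (int1_ext _ (fun x => int1 q * p x)).
  - rewrite int1_scal by assumption. ring.
  - intros x. rewrite int1_scal by assumption. ring.
Qed.

Lemma tint_lsum {A} (l : list A) (F : A -> R -> R -> R) : (forall a, cont2 (F a)) ->
  torus_int (fun x y => lsum l (fun a => F a x y)) = lsum l (fun a => torus_int (F a)).
Proof.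
  intros H; induction l as [|a l IH]; simpl; [apply tint_const|].
  rewrite (tint_plus (F a)); [now rewrite IH | apply H | apply (Ck_lsum 0 l F H)].
Qed.

Lemma RInt_period (f : R -> R) c : continuous1 f -> (forall x, f (x + 1) = f x) ->
  RInt f c (c + 1) = int1 f.
Proof.
  intros Hf Hp. unfold int1.
  assert (H1 : forall a b, RInt f (a + 1) (b + 1) = RInt f a b).
  { intros a b. assert (E := RInt_comp_lin (V := CRV) f 1 1 a b
      ltac:(apply ex_int, Hf)).
    rewrite !Rmult_1_l in E. rewrite <- E. apply RInt_ext. intros x _.
    unfold scal; simpl; unfold mult; simpl. rewrite !Rmult_1_l. apply Hp. }
  assert (E1 := RInt_Chasles (V := CRV) f c (-1/2) (c + 1)
    ltac:(apply ex_int, Hf) ltac:(apply ex_int, Hf)).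
  assert (E2 := RInt_Chasles (V := CRV) f (-1/2) (c + 1) (1/2)
    ltac:(apply ex_int, Hf) ltac:(apply ex_int, Hf)).
  assert (E3 := H1 c (-1/2)). replace (-1/2 + 1) with (1/2) in E3 by field.
  assert (E4 := opp_RInt_swap (V := CRV) f (1/2) (c + 1)
    ltac:(apply ex_int, Hf)).
  unfold plus, opp in *; simpl in *. lra.
Qed.

(** The substitution reverses the interval and moves it to another window of length one; periodicity
    moves it back. *)
Lemma int1_reflect f x : continuous1 f -> (forall x, f (x + 1) = f x) ->
  int1 (fun t => f (x - t)) = int1 f.
Proof.
  intros Hf Hp. unfold int1 at 1.
  assert (E := RInt_comp_lin (V := CRV) f (-1) x (-1/2) (1/2)
      ltac:(apply ex_int, Hf)).
  unfold scal in E; simpl in E; unfold mult in E; simpl in E.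
  replace (-1 * (1/2) + x) with (x - 1/2) in E by field.
  replace (-1 * (-1/2) + x) with (x - 1/2 + 1) in E by field.
  assert (E2 := opp_RInt_swap (V := CRV) f (x - 1/2) (x - 1/2 + 1)
    ltac:(apply ex_int, Hf)).
  unfold opp in E2; simpl in E2. rewrite <- E2 in E.
  rewrite (RInt_period f (x - 1/2) Hf Hp) in E.
  assert (E3 := RInt_scal (V := CRV) (fun t => f (x - t)) (-1/2) (1/2) (-1)).
  unfold scal in E3; simpl in E3; unfold mult in E3; simpl in E3.
  assert (E4 : RInt (fun y => -1 * f (-1 * y + x)) (-1/2) (1/2)
     = RInt (fun y => -1 * f (x - y)) (-1/2) (1/2)).
  { apply RInt_ext; intros t _. simpl. replace (-1 * t + x) with (x - t) by ring. reflexivity. }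
  rewrite E4, E3 in E; [lra|].
  apply ex_int. intros t. apply (continuous_comp (fun t => x - t) f); [|apply Hf].
  continuous_by_derive.
Qed.

Lemma tint_reflect h x y : cont2 h -> periodic2 h ->
  torus_int (fun a b => h (x - a) (y - b)) = torus_int h.
Proof.
  intros Hh Hp.
  change (int1 (fun a => int1 (fun b => h (x - a) (y - b))) = int1 (fun a => int1 (fun b => h a b))).
  rewrite (int1_ext _ (fun a => int1 (fun b => h (x - a) b))).
  - apply (int1_reflect (fun a => int1 (fun b => h a b)) x); [now apply int1_continuous|].
    intros t. apply int1_ext; intros; apply Hp.
  - intros a. apply (int1_reflect (fun b => h (x - a) b)); [now apply cont2_slice|].
    intros; apply Hp.
Qed.

Lemma tint_odd h : cont2 h -> odd2 h -> torus_int h = 0.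
Proof.
  intros Hh Ho. change (int1 (fun a => int1 (fun b => h a b)) = 0).
  rewrite <- (int1_const 0). apply int1_ext; intros a.
  assert (E := RInt_comp_lin (V := CRV) (fun b => h a b) (-1) 0 (-1/2) (1/2)
      ltac:(apply ex_int, cont2_slice, Hh)).
  unfold scal in E; simpl in E; unfold mult in E; simpl in E.
  replace (-1 * (1/2) + 0) with (-1/2) in E by field.
  replace (-1 * (-1/2) + 0) with (1/2) in E by field.
  rewrite (RInt_ext _ (fun b => h a b)) in E.
  - assert (E2 := opp_RInt_swap (V := CRV) (fun b => h a b) (-1/2) (1/2)
      ltac:(apply ex_int, cont2_slice, Hh)).
    unfold opp in E2; simpl in E2. unfold int1. lra.
  - intros b _. rewrite Rplus_0_r. replace (-1 * b) with (- b) by ring.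
    rewrite (proj2 (Ho a b)). change (-1 * - h a b = h a b). ring.
Qed.

Lemma periodic_uniform_continuity f : cont2 f -> periodic2 f ->
  forall e, 0 < e -> exists del, 0 < del /\ forall x y h k,
    Rabs h < del -> Rabs k < del -> Rabs (f (x + h) (y + k) - f x y) < e.
Proof.
  intros Hf Hp e He.
  destruct (uniform_continuity_2d f (-2) 2 (-2) 2
      (fun u v _ _ => proj1 (cont2_pt f) Hf u v) (mkposreal e He)) as [del Hdel].
  exists (Rmin del 1). split; [apply Rmin_pos; [apply cond_pos | lra]|].
  intros x y h k Hh Hk.
  destruct (nearest_Z x) as [n Hn]. destruct (nearest_Z y) as [m Hm].
  assert (E : forall a b, f a b = f (a + IZR n) (b + IZR m)).
  { intros a b. rewrite (periodic_Z (fun t => f t (b + IZR m))); [|intros; apply Hp].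
    now rewrite (periodic_Z (fun t => f a t)); [|intros; apply Hp]. }
  rewrite (E x y), (E (x + h) (y + k)).
  generalize (Rmin_l del 1) (Rmin_r del 1); intros M1 M2.
  assert (Hh1 : Rabs h < 1) by lra. assert (Hk1 : Rabs k < 1) by lra.
  apply Rabs_def2 in Hh1. apply Rabs_def2 in Hk1.
  apply Hdel; try lra.
  - replace (x + h + IZR n - (x + IZR n)) with h by ring. lra.
  - replace (y + k + IZR m - (y + IZR m)) with k by ring. lra.
Qed.

(** The variable [(x, y)] sits in [f], not in the kernel, so that a derivative of the convolution
    falls on [f]. *)
Definition conv (f : R -> R -> R) (p q : R -> R) (x y : R) : R :=
  torus_int (fun a b => f (x - a) (y - b) * (p a * q b)).

Lemma cont2_reflect f x y : cont2 f -> cont2 (fun a b => f (x - a) (y - b)).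
Proof.
  intros Hf. apply (cont2_comp2 f (fun a _ => x - a) (fun _ b => y - b) Hf).
  - apply (cont2_fst (fun a => x - a)). intros t.
    continuous_by_derive.
  - apply (cont2_snd (fun b => y - b)). intros t.
    continuous_by_derive.
Qed.

Lemma cont2_tensor p q : continuous1 p -> continuous1 q -> cont2 (fun a b => p a * q b).
Proof.
  intros Hp Hq. apply (cont2_mult (fun a _ => p a) (fun _ b => q b));
    [now apply cont2_fst | now apply cont2_snd].
Qed.

Section Conv.

Variables p q : R -> R.
Hypothesis Hp : continuous1 p.
Hypothesis Hq : continuous1 q.

Lemma cont2_conv_integrand f x y : cont2 f ->
  cont2 (fun a b => f (x - a) (y - b) * (p a * q b)).
Proof.
  intros Hf. apply cont2_mult; [now apply cont2_reflect | now apply cont2_tensor].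
Qed.

Lemma conv_minus f g x y : cont2 f -> cont2 g ->
  conv (fun x y => f x y - g x y) p q x y = conv f p q x y - conv g p q x y.
Proof.
  intros Hf Hg. unfold conv. rewrite <- tint_minus; try now apply cont2_conv_integrand.
  apply tint_ext; intros; ring.
Qed.

Lemma conv_scal c f x y : cont2 f ->
  conv (fun x y => c * f x y) p q x y = c * conv f p q x y.
Proof.
  intros Hf. unfold conv. rewrite <- tint_scal; try now apply cont2_conv_integrand.
  apply tint_ext; intros; ring.
Qed.

Lemma conv_abs_le f B x y : cont2 f -> (forall x y, Rabs (f x y) <= B) ->
  (forall a, Rabs (p a) <= 1) -> (forall a, Rabs (q a) <= 1) ->
  Rabs (conv f p q x y) <= B.
Proof.
  intros Hf HB H1 H2. rewrite <- (tint_const B).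
  apply tint_abs_le; [now apply cont2_conv_integrand | apply cont2_const|].
  intros a b. rewrite !Rabs_mult.
  assert (Rabs (p a) * Rabs (q b) <= 1 * 1) by (apply Rmult_le_compat; auto using Rabs_pos).
  assert (A := HB (x - a) (y - b)). assert (A0 := Rabs_pos (f (x - a) (y - b))).
  assert (0 <= Rabs (p a) * Rabs (q b)) by (apply Rmult_le_pos; apply Rabs_pos). nra.
Qed.

Lemma conv_translate f h k x y :
  conv (fun x y => f (x + h) (y + k)) p q x y = conv f p q (x + h) (y + k).
Proof.
  unfold conv. apply tint_ext; intros a b. replace (x + h - a) with (x - a + h) by ring.
  replace (y + k - b) with (y - b + k) by ring. reflexivity.
Qed.

(** Moves [(x, y)] into the kernel, where addition formulas separate it from the integration
    variable and where the kernel can act as a test function. *)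
Lemma conv_kernel_translate f x y : cont2 f -> periodic2 f ->
  (forall t, p (t + 1) = p t) -> (forall t, q (t + 1) = q t) ->
  conv f p q x y = torus_int (fun a b => f a b * (p (x - a) * q (y - b))).
Proof.
  intros Hf Hfp Hpp Hqp. unfold conv.
  rewrite <- (tint_reflect (fun a b => f a b * (p (x - a) * q (y - b))) x y).
  - apply tint_ext; intros a b. replace (x - (x - a)) with a by ring.
    replace (y - (y - b)) with b by ring. reflexivity.
  - apply cont2_mult; [exact Hf|].
    apply (cont2_reflect (fun a b => p a * q b)). now apply cont2_tensor.
  - intros a b. split.
    + rewrite (proj1 (Hfp a b)), <- (Hpp (x - (a + 1))).
      replace (x - (a + 1) + 1) with (x - a) by ring. reflexivity.
    + rewrite (proj2 (Hfp a b)), <- (Hqp (y - (b + 1))).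
      replace (y - (b + 1) + 1) with (y - b) by ring. reflexivity.
Qed.

Lemma conv_periodic f : periodic2 f -> periodic2 (conv f p q).
Proof.
  intros Hf x y. split; apply tint_ext; intros a b; f_equal.
  - replace (x + 1 - a) with (x - a + 1) by ring. apply Hf.
  - replace (y + 1 - b) with (y - b + 1) by ring. apply Hf.
Qed.

End Conv.

Lemma periodic_dx f : Ck 1 f -> periodic2 f -> periodic2 (dx f).
Proof.
  intros Hf Hp x y; split; unfold dx.
  - apply is_derive_unique. apply is_derive_ext with (fun t => f (t + - 1) y).
    + intros t. rewrite <- (proj1 (Hp (t + - 1) y)). f_equal; ring.
    + replace (Derive (fun t => f t y) x) with (1 * Derive (fun t => f t y) x) by ring.
      apply (is_derive_comp (fun t => f t y) (fun t => t + - 1)).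
      * replace (x + 1 + - 1) with x by ring. apply (Ck_is_derive_x 0 f x y Hf).
      * auto_derive; [exact I | ring].
  - apply Derive_ext; intros t; apply Hp.
Qed.

(** Mean value theorem and uniform continuity of [dx f]. The uniformity in [(x, y)] is what lets the
    difference quotient pass under the integral. *)
Lemma slope_uniform_x f : Ck 1 f -> periodic2 f ->
  forall e, 0 < e -> exists del, 0 < del /\ forall h x y, Rabs h < del ->
    Rabs (f (x + h) y - f x y - h * dx f x y) <= e * Rabs h.
Proof.
  intros Hf Hp e He.
  assert (Hdp := periodic_dx f Hf Hp).
  destruct (periodic_uniform_continuity (dx f) (proj1 (proj2 (proj2 Hf))) Hdp e He)
    as [del [Hd H]].
  exists del. split; [exact Hd|]. intros h x y Hh.
  destruct (mvt (fun t => f t y) (fun t => dx f t y) x (x + h)) as [c [Hc E]].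
  { intros t _. now apply (Ck_is_derive_x 0). }
  rewrite E. replace (x + h - x) with h by ring.
  replace (dx f c y * h - h * dx f x y) with ((dx f c y - dx f x y) * h) by ring.
  rewrite Rabs_mult. apply Rmult_le_compat_r; [apply Rabs_pos|].
  specialize (H x y (c - x) 0). replace (x + (c - x)) with c in H by ring.
  rewrite Rplus_0_r in H. left; apply H; [|rewrite Rabs_R0; lra].
  apply Rle_lt_trans with (Rabs h); [|exact Hh].
  revert Hc. unfold Rmin, Rmax, Rabs. repeat destruct Rle_dec; repeat destruct Rcase_abs; lra.
Qed.

Lemma Ck_swap k f : Ck k f -> Ck k (fun x y => f y x).
Proof.
  revert f; induction k; intros f Hf; [now apply cont2_swap|].
  apply Ck_intro with (fun x y => dy f y x) (fun x y => dx f y x).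
  - apply cont2_swap. now apply Ck_cont2 with (S k).
  - intros x y. now apply (Ck_is_derive_y k f).
  - intros x y. now apply (Ck_is_derive_x k f).
  - apply (IHk (dy f)), Hf.
  - apply (IHk (dx f)), Hf.
Qed.

Lemma periodic_swap f : periodic2 f -> periodic2 (fun x y => f y x).
Proof. intros H x y; split; apply H. Qed.

Lemma periodic_dy f : Ck 1 f -> periodic2 f -> periodic2 (dy f).
Proof.
  intros Hf Hp.
  exact (periodic_swap _ (periodic_dx _ (Ck_swap 1 f Hf) (periodic_swap f Hp))).
Qed.

Lemma slope_uniform_y f : Ck 1 f -> periodic2 f ->
  forall e, 0 < e -> exists del, 0 < del /\ forall h x y, Rabs h < del ->
    Rabs (f x (y + h) - f x y - h * dy f x y) <= e * Rabs h.
Proof.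
  intros Hf Hp e He.
  destruct (slope_uniform_x _ (Ck_swap 1 f Hf) (periodic_swap f Hp) e He) as [del [Hd H]].
  exists del. split; [exact Hd|]. intros h x y Hh. exact (H h y x Hh).
Qed.

Lemma is_derive_of_slope (f : R -> R) x l :
  (forall e, 0 < e -> exists del, 0 < del /\ forall h, Rabs h < del ->
    Rabs (f (x + h) - f x - h * l) <= e * Rabs h) -> is_derive f x l.
Proof.
  intros H. apply is_derive_Reals. intros e He.
  destruct (H (e / 2) ltac:(lra)) as [del [Hd Hdel]].
  exists (mkposreal del Hd). intros h Hh0 Hh. simpl in Hh.
  specialize (Hdel h Hh).
  replace ((f (x + h) - f x) / h - l) with ((f (x + h) - f x - h * l) / h) by (field; lra).
  unfold Rdiv. rewrite Rabs_mult, Rabs_inv.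
  assert (A := Rabs_pos_lt h Hh0).
  apply Rle_lt_trans with (e / 2 * Rabs h * / Rabs h).
  - apply Rmult_le_compat_r; [left; now apply Rinv_0_lt_compat | exact Hdel].
  - replace (e / 2 * Rabs h * / Rabs h) with (e / 2) by (field; lra). lra.
Qed.

Section ConvDerive.

Variables (p q : R -> R) (f : R -> R -> R).
Hypothesis Hp : continuous1 p.
Hypothesis Hq : continuous1 q.
Hypothesis Hp1 : forall a, Rabs (p a) <= 1.
Hypothesis Hq1 : forall a, Rabs (q a) <= 1.
Hypothesis Hf : Ck 1 f.
Hypothesis Hfp : periodic2 f.

Lemma cont2_translate g h k : cont2 g -> cont2 (fun x y => g (x + h) (y + k)).
Proof.
  intros Hg. replace (fun x y => g (x + h) (y + k)) with (fun x y => g (1 * x + h) (y + k))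
    by (apply ext2; intros; f_equal; ring).
  now apply cont2_affine.
Qed.

(** Kernels bounded by 1 on a cell of area one do not increase the supremum, so the uniform slope
    estimate of [f] is inherited by the convolution. The direction [(a, b)] is general so that both
    partial derivatives follow. *)
Lemma conv_slope a b fd : cont2 fd ->
  (forall e, 0 < e -> exists del, 0 < del /\ forall h x y, Rabs h < del ->
    Rabs (f (x + a * h) (y + b * h) - f x y - h * fd x y) <= e * Rabs h) ->
  forall x y e, 0 < e -> exists del, 0 < del /\ forall h, Rabs h < del ->
    Rabs (conv f p q (x + a * h) (y + b * h) - conv f p q x y - h * conv fd p q x y) <= e * Rabs h.
Proof.
  intros Hd H x y e He. assert (Hc := Ck_cont2 1 f Hf).
  destruct (H e He) as [del [Hdel Hs]]. exists del. split; [exact Hdel|]. intros h Hh.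
  assert (Ht := cont2_translate f (a * h) (b * h) Hc).
  assert (Hhd : cont2 (fun x y => h * fd x y)) by (apply cont2_mult; [apply cont2_const | exact Hd]).
  assert (E : conv f p q (x + a * h) (y + b * h) - conv f p q x y - h * conv fd p q x y
    = conv (fun x y => f (x + a * h) (y + b * h) - f x y - h * fd x y) p q x y).
  { rewrite (conv_minus p q Hp Hq (fun x y => f (x + a * h) (y + b * h) - f x y) (fun x y => h * fd x y)),
      (conv_minus p q Hp Hq (fun x y => f (x + a * h) (y + b * h)) f), (conv_scal p q Hp Hq h fd),
      conv_translate; auto using cont2_minus. }
  rewrite E. apply conv_abs_le; auto using cont2_minus.
Qed.

Lemma conv_derive_x x y : is_derive (fun t => conv f p q t y) x (conv (dx f) p q x y).
Proof.
  apply is_derive_of_slope. intros e He.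
  destruct (conv_slope 1 0 (dx f)) with x y e as [del [Hd H]]; [apply Hf| |exact He|].
  - intros e' He'. destruct (slope_uniform_x f Hf Hfp e' He') as [del [Hd H]].
    exists del. split; [exact Hd|]. intros h s t Hh.
    rewrite Rmult_1_l, Rmult_0_l, Rplus_0_r. now apply H.
  - exists del. split; [exact Hd|]. intros h Hh. specialize (H h Hh).
    now rewrite Rmult_1_l, Rmult_0_l, Rplus_0_r in H.
Qed.

Lemma conv_derive_y x y : is_derive (fun t => conv f p q x t) y (conv (dy f) p q x y).
Proof.
  apply is_derive_of_slope. intros e He.
  destruct (conv_slope 0 1 (dy f)) with x y e as [del [Hd H]]; [apply Hf| |exact He|].
  - intros e' He'. destruct (slope_uniform_y f Hf Hfp e' He') as [del [Hd H]].
    exists del. split; [exact Hd|]. intros h s t Hh.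
    rewrite Rmult_1_l, Rmult_0_l, Rplus_0_r. now apply H.
  - exists del. split; [exact Hd|]. intros h Hh. specialize (H h Hh).
    now rewrite Rmult_1_l, Rmult_0_l, Rplus_0_r in H.
Qed.

End ConvDerive.

Lemma conv_odd f p q : cont2 f -> periodic2 f -> odd2 f -> continuous1 p -> continuous1 q ->
  (forall t, p (t + 1) = p t) -> (forall t, q (t + 1) = q t) ->
  (forall t, p (- t) = p t) -> (forall t, q (- t) = q t) -> odd2 (conv f p q).
Proof.
  intros Hf Hfp Ho Hp Hq Hpp Hqp Hpe Hqe x y.
  assert (Hc := cont2_conv_integrand p q Hp Hq f).
  split.
  - transitivity (torus_int (fun a b => (-1) * (f (x - a) (y - b) * (p a * q b)))).
    2: { rewrite tint_scal; [unfold conv; ring | now apply Hc]. }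
    unfold conv. change (int1 (fun a => int1 (fun b => f (- x - a) (y - b) * (p a * q b))) =
      int1 (fun a => int1 (fun b => -1 * (f (x - a) (y - b) * (p a * q b))))).
    rewrite <- (int1_reflect (fun a => int1 (fun b => f (- x - a) (y - b) * (p a * q b))) 0).
    + apply int1_ext; intros a. apply int1_ext; intros b.
      replace (- x - (0 - a)) with (- (x - a)) by ring. replace (0 - a) with (- a) by ring.
      rewrite (proj1 (Ho _ _)), Hpe. ring.
    + apply int1_continuous. now apply Hc.
    + intros a. apply int1_ext; intros b. rewrite Hpp.
      rewrite <- (proj1 (Hfp (- x - (a + 1)) (y - b))).
      now replace (- x - (a + 1) + 1) with (- x - a) by ring.
  - transitivity (torus_int (fun a b => (-1) * (f (x - a) (y - b) * (p a * q b)))).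
    2: { rewrite tint_scal; [unfold conv; ring | now apply Hc]. }
    unfold conv. apply int1_ext; intros a.
    transitivity (int1 (fun b => f (x - a) (- y - b) * (p a * q b))); [reflexivity|].
    rewrite <- (int1_reflect (fun b => f (x - a) (- y - b) * (p a * q b)) 0).
    + apply int1_ext; intros b.
      replace (- y - (0 - b)) with (- (y - b)) by ring. replace (0 - b) with (- b) by ring.
      rewrite (proj2 (Ho _ _)), Hqe. ring.
    + apply (cont2_slice (fun a b => f (x - a) (- y - b) * (p a * q b))). now apply Hc.
    + intros b. rewrite Hqp.
      rewrite <- (proj2 (Hfp (x - a) (- y - (b + 1)))).
      now replace (- y - (b + 1) + 1) with (- y - b) by ring.
Qed.

(** * Fourier modes and an approximate identity *)

Definition cosk (k : Z) (t : R) : R := cos (2 * PI * IZR k * t).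
Definition sink (k : Z) (t : R) : R := sin (2 * PI * IZR k * t).

Lemma cosk_derive k t : is_derive (cosk k) t (- (2 * PI * IZR k) * sink k t).
Proof. unfold cosk, sink. auto_derive; [exact I | ring]. Qed.

Lemma sink_derive k t : is_derive (sink k) t (2 * PI * IZR k * cosk k t).
Proof. unfold cosk, sink. auto_derive; [exact I | ring]. Qed.

Lemma cosk_continuous k : continuous1 (cosk k).
Proof. exact (continuous_derivable _ _ (cosk_derive k)). Qed.

Lemma sink_continuous k : continuous1 (sink k).
Proof. exact (continuous_derivable _ _ (sink_derive k)). Qed.

Lemma cosk_periodic k t : cosk k (t + 1) = cosk k t.
Proof.
  unfold cosk.
  replace (2 * PI * IZR k * (t + 1)) with (2 * PI * (IZR k * t + IZR k)) by ring.
  rewrite (periodic_Z (fun s => cos (2 * PI * s))).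
  - f_equal; ring.
  - intros x. rewrite Rmult_plus_distr_l, Rmult_1_r, cos_plus, cos_2PI, sin_2PI. ring.
Qed.

Lemma cosk_even k t : cosk k (- t) = cosk k t.
Proof. unfold cosk. rewrite <- cos_neg. f_equal; ring. Qed.

Lemma cosk_abs_le k t : Rabs (cosk k t) <= 1.
Proof. apply Rabs_le, COS_bound. Qed.

Lemma cosk_minus k x a : cosk k (x - a) = cosk k x * cosk k a + sink k x * sink k a.
Proof. unfold cosk, sink. rewrite <- cos_minus. f_equal; ring. Qed.

Lemma cosk_has_d2 k x : has_d2 (cosk k) x (- (2 * PI * IZR k) ^ 2 * cosk k x).
Proof.
  exists (fun t => - (2 * PI * IZR k) * sink k t). split.
  - apply filter_forall, cosk_derive.
  - replace (- (2 * PI * IZR k) ^ 2 * cosk k x) with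
      (- (2 * PI * IZR k) * (2 * PI * IZR k * cosk k x)) by ring.
    apply is_derive_scal, sink_derive.
Qed.

Lemma sink_has_d2 k x : has_d2 (sink k) x (- (2 * PI * IZR k) ^ 2 * sink k x).
Proof.
  exists (fun t => 2 * PI * IZR k * cosk k t). split.
  - apply filter_forall, sink_derive.
  - replace (- (2 * PI * IZR k) ^ 2 * sink k x) with
      (2 * PI * IZR k * (- (2 * PI * IZR k) * sink k x)) by ring.
    apply is_derive_scal, cosk_derive.
Qed.

Lemma cosk_as_sin k t : cosk k t = sin (2 * PI * IZR k * t + PI / 2).
Proof. unfold cosk. rewrite cos_sin. f_equal; ring. Qed.

Lemma sink_as_sin k t : sink k t = sin (2 * PI * IZR k * t + 0).
Proof. unfold sink. f_equal; ring. Qed.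

Lemma lap_at_tensor (p q : R -> R) x y l m :
  has_d2 p x (l * p x) -> has_d2 q y (m * q y) ->
  lap_at (fun x y => p x * q y) x y ((l + m) * (p x * q y)).
Proof.
  intros Hp Hq. exists (q y * (l * p x)), (p x * (m * q y)). split; [|split; [|ring]].
  - apply has_d2_ext with (fun t => q y * p t); [intros; ring|]. now apply has_d2_scal.
  - now apply has_d2_scal.
Qed.

(* The Fourier mode of [f] of frequencies [(± k, ± l)]. *)
Definition mode (f : R -> R -> R) (k l : Z) : R -> R -> R := conv f (cosk k) (cosk l).

Definition eigen (k l : Z) : R := - (4 * PI ^ 2 * (IZR k ^ 2 + IZR l ^ 2)).

(** The addition formula for the two cosines separates [(x, y)] from the integration variable. Even
    for merely continuous [f] a mode is therefore a combination of four products, hence smooth and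
    an eigenfunction of the Laplacian. *)
Lemma mode_formula f k l : cont2 f -> periodic2 f -> exists c1 c2 c3 c4, forall x y,
  mode f k l x y = c1 * (cosk k x * cosk l y) + c2 * (cosk k x * sink l y)
                 + (c3 * (sink k x * cosk l y) + c4 * (sink k x * sink l y)).
Proof.
  intros Hf Hp.
  exists (torus_int (fun a b => f a b * (cosk k a * cosk l b))),
         (torus_int (fun a b => f a b * (cosk k a * sink l b))),
         (torus_int (fun a b => f a b * (sink k a * cosk l b))),
         (torus_int (fun a b => f a b * (sink k a * sink l b))).
  intros x y. unfold mode.
  rewrite conv_kernel_translate; auto using cosk_continuous, cosk_periodic.
  assert (H : forall p q, continuous1 p -> continuous1 q -> cont2 (fun a b => f a b * (p a * q b))).
  { intros; apply cont2_mult; [assumption | now apply cont2_tensor]. }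
  assert (H' : forall c p q, continuous1 p -> continuous1 q ->
     cont2 (fun a b => c * (f a b * (p a * q b)))).
  { intros; apply cont2_mult; [apply cont2_const | now apply H]. }
  rewrite (tint_ext _ (fun a b =>
     cosk k x * cosk l y * (f a b * (cosk k a * cosk l b))
     + cosk k x * sink l y * (f a b * (cosk k a * sink l b))
     + (sink k x * cosk l y * (f a b * (sink k a * cosk l b))
     + sink k x * sink l y * (f a b * (sink k a * sink l b)))))
    by (intros; rewrite !cosk_minus; ring).
  generalize (cosk_continuous k) (cosk_continuous l) (sink_continuous k) (sink_continuous l).
  intros.
  rewrite !tint_plus, !tint_scal; auto using cont2_plus; ring.
Qed.

Lemma smooth_mode f k l : cont2 f -> periodic2 f -> smooth2 (mode f k l).
Proof.
  intros Hf Hp n. destruct (mode_formula f k l Hf Hp) as [c1 [c2 [c3 [c4 E]]]].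
  rewrite (ext2 _ _ (fun x y => eq_trans (E x y) ltac:(rewrite !cosk_as_sin, !sink_as_sin; reflexivity))).
  apply Ck_plus; apply Ck_plus; apply Ck_scal; apply smooth_sin_tensor.
Qed.

Lemma mode_lap f k l x y : cont2 f -> periodic2 f ->
  lap_at (mode f k l) x y (eigen k l * mode f k l x y).
Proof.
  intros Hf Hp. destruct (mode_formula f k l Hf Hp) as [c1 [c2 [c3 [c4 E]]]].
  rewrite (ext2 _ _ E). simpl.
  set (mu := - (2 * PI * IZR k) ^ 2). set (nu := - (2 * PI * IZR l) ^ 2).
  replace (eigen k l) with (mu + nu) by (unfold mu, nu, eigen; ring).
  replace ((mu + nu) * (c1 * (cosk k x * cosk l y) + c2 * (cosk k x * sink l y)
       + (c3 * (sink k x * cosk l y) + c4 * (sink k x * sink l y))))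
    with (c1 * ((mu + nu) * (cosk k x * cosk l y)) + c2 * ((mu + nu) * (cosk k x * sink l y))
       + (c3 * ((mu + nu) * (sink k x * cosk l y)) + c4 * ((mu + nu) * (sink k x * sink l y))))
    by ring.
  assert (Ck := cosk_has_d2 k x). assert (Cl := cosk_has_d2 l y).
  assert (Sk := sink_has_d2 k x). assert (Sl := sink_has_d2 l y).
  fold mu in Ck, Sk. fold nu in Cl, Sl.
  apply lap_at_plus; apply lap_at_plus; apply lap_at_scal.
  - exact (lap_at_tensor (cosk k) (cosk l) x y mu nu Ck Cl).
  - exact (lap_at_tensor (cosk k) (sink l) x y mu nu Ck Sl).
  - exact (lap_at_tensor (sink k) (cosk l) x y mu nu Sk Cl).
  - exact (lap_at_tensor (sink k) (sink l) x y mu nu Sk Sl).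
Qed.

(** The Kronecker symbol at 0, kept as an integral so that the total weight of the zero frequency in
    an expansion can be recognised as the mass of the expanded function. *)
Definition coef0 (k : Z) : R := int1 (cosk k).

Lemma coef0_eq k : coef0 k = if Z.eq_dec k 0 then 1 else 0.
Proof.
  unfold coef0. destruct (Z.eq_dec k 0) as [->|Hk].
  - rewrite (int1_ext _ (fun _ => 1)); [apply int1_const|].
    intros x. unfold cosk. rewrite Rmult_0_r, Rmult_0_l. apply cos_0.
  - assert (Hk' : IZR k <> 0) by (apply not_0_IZR, Hk).
    assert (HP := PI_RGT_0).
    assert (E : is_RInt (cosk k) (-1/2) (1/2)
        (minus (sink k (1/2) / (2 * PI * IZR k)) (sink k (-1/2) / (2 * PI * IZR k)))).
    { apply (is_RInt_derive (fun t => sink k t / (2 * PI * IZR k))).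
      - intros x _. unfold sink, cosk. auto_derive; [exact I | field; split; lra].
      - intros x _. apply cosk_continuous. }
    unfold int1. rewrite (is_RInt_unique _ _ _ _ E).
    replace (sink k (1/2)) with (sink k (-1/2 + 1)) by (f_equal; field).
    assert (Hs : sink k (-1/2 + 1) = sink k (-1/2)).
    { unfold sink.
      replace (2 * PI * IZR k * (-1/2 + 1)) with (2 * PI * (IZR k * (-1/2) + IZR k)) by ring.
      rewrite (periodic_Z (fun s => sin (2 * PI * s))).
      - f_equal; field.
      - intros x. rewrite Rmult_plus_distr_l, Rmult_1_r, sin_plus, cos_2PI, sin_2PI. ring. }
    rewrite Hs. unfold minus, plus, opp; simpl. ring.
Qed.

Lemma eigen_neq_0 k l : k <> 0%Z \/ l <> 0%Z -> eigen k l <> 0.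
Proof.
  intros H. unfold eigen. assert (HP := PI_RGT_0).
  assert (0 < IZR k ^ 2 + IZR l ^ 2).
  { assert (A := pow2_ge_0 (IZR k)). assert (B := pow2_ge_0 (IZR l)).
    destruct H as [H|H]; apply not_0_IZR in H.
    - assert (0 < IZR k ^ 2) by (apply pow2_gt_0; exact H). lra.
    - assert (0 < IZR l ^ 2) by (apply pow2_gt_0; exact H). lra. }
  assert (0 < 4 * PI ^ 2 * (IZR k ^ 2 + IZR l ^ 2)).
  { apply Rmult_lt_0_compat; [|assumption]. nra. }
  lra.
Qed.

(* The zero mode is discarded because [/ 0 = 0]. *)
Lemma eigen_inv (E : Z -> Z -> R) k l :
  / eigen k l * (eigen k l * E k l) = E k l - coef0 k * coef0 l * E 0%Z 0%Z.
Proof.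
  rewrite !coef0_eq.
  destruct (Z.eq_dec k 0) as [->|Hk]; [destruct (Z.eq_dec l 0) as [->|Hl]|].
  - unfold eigen. rewrite pow_i, Rplus_0_r, Rmult_0_r, Ropp_0, Rinv_0 by lia. ring.
  - field. apply eigen_neq_0; auto.
  - field. apply eigen_neq_0; auto.
Qed.

Lemma mode_0 f x y : cont2 f -> periodic2 f -> mode f 0 0 x y = torus_int f.
Proof.
  intros Hf Hp. unfold mode.
  rewrite conv_kernel_translate; auto using cosk_continuous, cosk_periodic.
  apply tint_ext; intros a b. unfold cosk. rewrite !Rmult_0_r, !Rmult_0_l, cos_0. ring.
Qed.

(** The de la Vallée Poussin kernel before normalisation: a nonnegative trigonometric polynomial of
    period one that concentrates at the integers as [n] grows. *)
Definition cpow (n : nat) (t : R) : R := (cos (PI * t) ^ 2) ^ n.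

(** Pairs of coefficient and frequency, from [cos^2 (pi t) = 1/2 + cos (2 pi t) / 2] and the product
    formula. Frequencies are not collected: they may be negative and occur several times. *)
Fixpoint cpow_modes (n : nat) : list (R * Z) :=
  match n with
  | O => (1, 0%Z) :: nil
  | S n => flat_map (fun p => (fst p / 2, snd p) :: (fst p / 4, (snd p + 1)%Z)
                              :: (fst p / 4, (snd p - 1)%Z) :: nil) (cpow_modes n)
  end.

Lemma cpow_expand n t : cpow n t = lsum (cpow_modes n) (fun p => fst p * cosk (snd p) t).
Proof.
  induction n as [|n IH].
  - unfold cpow, cosk; simpl. rewrite Rmult_0_r, Rmult_0_l, cos_0. ring.
  - unfold cpow in *. rewrite <- tech_pow_Rmult, IH.
    simpl cpow_modes. rewrite lsum_flat_map, <- lsum_scal.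
    apply lsum_ext; intros [c k]. simpl. unfold cosk. rewrite plus_IZR, minus_IZR.
    replace (2 * PI * (IZR k + 1) * t) with (2 * PI * IZR k * t + 2 * (PI * t)) by ring.
    replace (2 * PI * (IZR k - 1) * t) with (2 * PI * IZR k * t - 2 * (PI * t)) by ring.
    rewrite cos_plus, cos_minus, cos_2a_cos. field.
Qed.

Lemma cpow_continuous n : continuous1 (cpow n).
Proof.
  intros t. unfold cpow. continuous_by_derive.
Qed.

Lemma cpow_nonneg n t : 0 <= cpow n t.
Proof. apply pow_le, pow2_ge_0. Qed.

Definition cmass (n : nat) : R := int1 (cpow n).

Lemma cmass_pos n : 0 < cmass n.
Proof.
  unfold cmass, int1. apply RInt_gt_0; [lra| |intros; apply cpow_continuous].
  intros x Hx. apply pow_lt, pow_lt. assert (HP := PI_RGT_0).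
  apply cos_gt_0; nra.
Qed.

Lemma cmass_modes n : lsum (cpow_modes n) (fun p => fst p * coef0 (snd p)) = cmass n.
Proof.
  assert (E : forall x y : R, cpow n x
      = lsum (cpow_modes n) (fun p => fst p * cosk (snd p) x)) by (intros; apply cpow_expand).
  (* The integral over [x] is written as a torus integral of a function constant in [y], so that
     integration term by term applies. *)
  assert (T := tint_lsum (cpow_modes n) (fun p x _ => fst p * cosk (snd p) x)).
  assert (T2 : torus_int (fun x _ => cpow n x) = cmass n).
  { rewrite (tint_ext _ (fun x y => cpow n x * 1)) by (intros; ring).
    rewrite (tint_prod (cpow n) (fun _ => 1)); [|apply cpow_continuous|intros t; apply continuous_const].
    rewrite int1_const. unfold cmass; ring. }
  rewrite <- T2, (tint_ext _ _ E), T.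
  - apply lsum_ext. intros [c k]; simpl.
    rewrite (tint_ext _ (fun x y => c * (cosk k x * 1))) by (intros; ring).
    rewrite tint_scal by (apply (cont2_tensor (cosk k) (fun _ => 1));
      [apply cosk_continuous | intros t; apply continuous_const]).
    rewrite (tint_prod (cosk k) (fun _ => 1)); [|apply cosk_continuous|intros t; apply continuous_const].
    rewrite int1_const. unfold coef0; ring.
  - intros [c k]; simpl. apply cont2_mult; [apply cont2_const | apply cont2_fst, cosk_continuous].
Qed.

(* Wallis: integrate the derivative of [sin cos^(2n+1)]. *)
Lemma cpow_variance n :
  int1 (fun t => sin (PI * t) ^ 2 * cpow n t) = cmass n / (2 * INR n + 2).
Proof.
  assert (HP := PI_RGT_0).
  set (h := fun t => sin (PI * t) ^ 2 * cpow n t).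
  assert (Hh : continuous1 h).
  { intros t. unfold h, cpow. continuous_by_derive. }
  assert (E : is_RInt (fun t => PI * (cpow n t + (- (2 * INR n + 2)) * h t)) (-1/2) (1/2)
     (minus (sin (PI * (1/2)) * (cos (PI * (1/2)) * cpow n (1/2)))
            (sin (PI * (-1/2)) * (cos (PI * (-1/2)) * cpow n (-1/2))))).
  { apply (is_RInt_derive (fun t => sin (PI * t) * (cos (PI * t) * cpow n t))).
    - intros x _. unfold h, cpow. auto_derive; [exact I|].
      set (co := cos (PI * x)). set (si := sin (PI * x)).
      assert (E : si * si + co * co = 1)
        by (generalize (sin2_cos2 (PI * x)); unfold Rsqr; auto).
      (* The derivative of the power carries the exponent [pred n], so [n = 0] is treated apart. *)
      destruct n as [|n]; [simpl; nra|].
      rewrite S_INR. simpl pred. simpl pow. set (A := (co * (co * 1)) ^ n).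
      replace (si * (si * 1)) with (1 - co * co) by lra.
      replace (1 - co * co) with (si * si) by lra.
      replace (PI * (co * (co * 1) * A + - (2 * (INR n + 1) + 2) * (si * si * (co * (co * 1) * A))))
        with (PI * (co * co * A * (1 - si * si) - (2 * INR n + 3) * si * si * co * co * A)) by ring.
      replace (1 - si * si) with (co * co) by lra. ring.
    - intros x _. unfold h, cpow. continuous_by_derive. }
  apply (is_RInt_unique (V := CRV)) in E.
  replace (PI * (1/2)) with (PI / 2) in E by field.
  replace (PI * (-1/2)) with (- (PI / 2)) in E by field.
  rewrite cos_neg, cos_PI2 in E. unfold minus, plus, opp in E; simpl in E.
  assert (E2 : int1 (fun t => PI * (cpow n t + (- (2 * INR n + 2)) * h t))
     = PI * (cmass n + - (2 * INR n + 2) * int1 h)).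
  { rewrite (int1_scal PI (fun t => cpow n t + - (2 * INR n + 2) * h t)).
    - rewrite (int1_plus (cpow n) (fun t => - (2 * INR n + 2) * h t)), int1_scal;
        [reflexivity | exact Hh | apply cpow_continuous |].
      intros t. apply (continuous_scal_r (K := R_AbsRing) (V := RV) _ h), Hh.
    - intros t. unfold h, cpow. continuous_by_derive. }
  unfold int1 at 1 in E2. rewrite E2 in E. fold h.
  assert (Hn := pos_INR n).
  assert (E3 : cmass n - (2 * INR n + 2) * int1 h = 0).
  { apply (Rmult_eq_reg_l PI); [lra | lra]. }
  replace (cmass n) with ((2 * INR n + 2) * int1 h) by lra. field. lra.
Qed.

Definition Vk (n : nat) (t : R) : R := cpow n t / cmass n.

Lemma Vk_continuous n : continuous1 (Vk n).
Proof.
  intros t. apply (continuous_scal_l (K := R_AbsRing) (V := RV) (cpow n) (/ cmass n)).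
  apply cpow_continuous.
Qed.

Lemma Vk_nonneg n t : 0 <= Vk n t.
Proof.
  unfold Vk. apply Rdiv_le_0_compat; [apply cpow_nonneg | apply cmass_pos].
Qed.

Lemma Vk_mass n : int1 (Vk n) = 1.
Proof.
  assert (H := cmass_pos n).
  rewrite (int1_ext _ (fun t => / cmass n * cpow n t)) by (intros; unfold Vk; field; lra).
  rewrite int1_scal by apply cpow_continuous. fold (cmass n). field; lra.
Qed.

Lemma Vk_variance n : int1 (fun t => sin (PI * t) ^ 2 * Vk n t) = / (2 * INR n + 2).
Proof.
  assert (H := cmass_pos n). assert (Hn := pos_INR n).
  rewrite (int1_ext _ (fun t => / cmass n * (sin (PI * t) ^ 2 * cpow n t)))
    by (intros; unfold Vk; field; lra).
  rewrite int1_scal.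
  - rewrite cpow_variance. field; lra.
  - intros t. unfold cpow. continuous_by_derive.
Qed.

Definition Pn (n : nat) (f : R -> R -> R) : R -> R -> R := conv f (Vk n) (Vk n).

Lemma sin2_continuous : continuous1 (fun t => sin (PI * t) ^ 2).
Proof.
  intros t. continuous_by_derive.
Qed.

(** A Chebyshev argument: the kernel has mass one and its mean of [sin^2] is [1 / (2 n + 2)] in each
    variable, so the two variables together contribute [M / (n + 1)]. *)
Lemma Pn_error n f e M x y : cont2 f ->
  (forall a b, Rabs (f (x - a) (y - b) - f x y)
      <= e + M * (sin (PI * a) ^ 2 + sin (PI * b) ^ 2)) ->
  Rabs (Pn n f x y - f x y) <= e + M / (INR n + 1).
Proof.
  intros Hf H. assert (HV := Vk_continuous n). assert (Hn := pos_INR n).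
  assert (HVV := cont2_tensor _ _ HV HV).
  assert (HsV : continuous1 (fun t => sin (PI * t) ^ 2 * Vk n t)).
  { intros t. apply (continuous_mult (K := R_AbsRing) (fun t => sin (PI * t) ^ 2) (Vk n));
      [apply sin2_continuous | apply HV]. }
  assert (E : Pn n f x y - f x y
     = torus_int (fun a b => (f (x - a) (y - b) - f x y) * (Vk n a * Vk n b))).
  { rewrite (tint_ext _ (fun a b => f (x - a) (y - b) * (Vk n a * Vk n b)
       - f x y * (Vk n a * Vk n b))) by (intros; ring).
    rewrite tint_minus, tint_scal, tint_prod, Vk_mass; auto.
    - unfold Pn, conv. ring.
    - now apply cont2_conv_integrand.
    - apply cont2_mult; [apply cont2_const | assumption]. }
  rewrite E.
  assert (T1 := cont2_tensor _ _ HsV HV). assert (T2 := cont2_tensor _ _ HV HsV).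
  cbv beta in T1, T2.
  assert (C0 := cont2_mult _ _ (cont2_const e) HVV).
  assert (C1 := cont2_mult _ _ (cont2_const M) T1).
  assert (C2 := cont2_mult _ _ (cont2_const M) T2).
  cbv beta in C0, C1, C2.
  assert (E2 : torus_int (fun a b => (e * (Vk n a * Vk n b) +
      (M * ((sin (PI * a) ^ 2 * Vk n a) * Vk n b) + M * (Vk n a * (sin (PI * b) ^ 2 * Vk n b)))))
     = e + M / (INR n + 1)).
  { rewrite (tint_plus _ _ C0 (cont2_plus _ _ C1 C2)), (tint_plus _ _ C1 C2),
      (tint_scal e _ HVV), (tint_scal M _ T1), (tint_scal M _ T2),
      (tint_prod (Vk n) (Vk n)), (tint_prod (fun a => sin (PI * a) ^ 2 * Vk n a) (Vk n)),
      (tint_prod (Vk n) (fun a => sin (PI * a) ^ 2 * Vk n a)), Vk_variance, Vk_mass; auto.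
    field. lra. }
  rewrite <- E2. apply tint_abs_le.
  - apply cont2_mult; [|assumption]. apply cont2_minus; [now apply cont2_reflect | apply cont2_const].
  - exact (cont2_plus _ _ C0 (cont2_plus _ _ C1 C2)).
  - intros a b. rewrite Rabs_mult.
    assert (HVab : 0 <= Vk n a * Vk n b) by (apply Rmult_le_pos; apply Vk_nonneg).
    rewrite (Rabs_right (Vk n a * Vk n b)) by lra.
    specialize (H a b). nra.
Qed.

(** * Approximate solution of Poisson's equation *)

Lemma sin2_shift_Z t k : sin (PI * (t + IZR k)) ^ 2 = sin (PI * t) ^ 2.
Proof.
  apply (periodic_Z (fun t => sin (PI * t) ^ 2)). intros x.
  rewrite Rmult_plus_distr_l, Rmult_1_r, neg_sin. ring.
Qed.

Lemma sin2_lower del t : 0 < del < / 2 -> - / 2 <= t <= / 2 -> del <= Rabs t ->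
  sin (PI * del) ^ 2 <= sin (PI * t) ^ 2.
Proof.
  intros Hd Ht Hdt. assert (HP := PI_RGT_0).
  replace (sin (PI * t) ^ 2) with (sin (PI * Rabs t) ^ 2).
  - apply pow_incr. split.
    + apply sin_ge_0; nra.
    + assert (Rabs t <= / 2) by (apply Rabs_le; lra).
      apply sin_incr_1; nra.
  - unfold Rabs; destruct Rcase_abs; [|reflexivity].
    replace (PI * - t) with (- (PI * t)) by ring. rewrite sin_neg. ring.
Qed.

(** Up to integer shifts of [(a, b)]: if both components are shorter than [del] the modulus of
    continuity applies; otherwise the sum of squared sines is at least [sin^2 (pi del)] and the
    second term exceeds [2 B]. *)
Lemma modulus_sin2 f B e del : 0 < del < / 2 -> 0 <= e ->
  periodic2 f -> (forall x y, Rabs (f x y) <= B) ->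
  (forall x y h k, Rabs h < del -> Rabs k < del -> Rabs (f (x + h) (y + k) - f x y) <= e) ->
  forall x y a b, Rabs (f (x - a) (y - b) - f x y)
     <= e + 2 * B / sin (PI * del) ^ 2 * (sin (PI * a) ^ 2 + sin (PI * b) ^ 2).
Proof.
  intros Hd He Hp HB Hm x y a b. assert (HP := PI_RGT_0).
  assert (HB0 : 0 <= B) by (eapply Rle_trans; [apply Rabs_pos | apply (HB 0 0)]).
  assert (Hs0 : 0 < sin (PI * del)) by (apply sin_gt_0; nra).
  assert (Hs : 0 < sin (PI * del) ^ 2) by (now apply pow_lt).
  destruct (nearest_Z a) as [k Hk]. destruct (nearest_Z b) as [l Hl].
  rewrite <- (sin2_shift_Z a k), <- (sin2_shift_Z b l).
  assert (E : f (x - a) (y - b) = f (x + - (a + IZR k)) (y + - (b + IZR l))).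
  { replace (x - a) with (x + - (a + IZR k) + IZR k) by ring.
    replace (y - b) with (y + - (b + IZR l) + IZR l) by ring.
    rewrite (periodic_Z (fun t => f t (y + - (b + IZR l) + IZR l))) by (intros; apply Hp).
    now rewrite (periodic_Z (fun t => f (x + - (a + IZR k)) t)) by (intros; apply Hp). }
  rewrite E. clear E.
  set (a' := a + IZR k) in *. set (b' := b + IZR l) in *.
  assert (HC : 0 <= 2 * B / sin (PI * del) ^ 2) by (apply Rdiv_le_0_compat; lra).
  assert (P1 := pow2_ge_0 (sin (PI * a'))). assert (P2 := pow2_ge_0 (sin (PI * b'))).
  destruct (Rlt_dec (Rabs a') del) as [Ha|Ha]; [destruct (Rlt_dec (Rabs b') del) as [Hb|Hb]|].
  { rewrite <- Rabs_Ropp in Ha, Hb. specialize (Hm x y _ _ Ha Hb).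
    assert (0 <= 2 * B / sin (PI * del) ^ 2 * (sin (PI * a') ^ 2 + sin (PI * b') ^ 2))
      by (apply Rmult_le_pos; lra). lra. }
  all: assert (H : sin (PI * del) ^ 2 <= sin (PI * a') ^ 2 + sin (PI * b') ^ 2) by
    (generalize (sin2_lower del a' Hd Hk) (sin2_lower del b' Hd Hl); lra);
    apply (Rmult_le_compat_l (2 * B / sin (PI * del) ^ 2)) in H; [|lra];
    replace (2 * B / sin (PI * del) ^ 2 * sin (PI * del) ^ 2) with (2 * B) in H by (field; lra);
    eapply Rle_trans; [apply Rabs_triang|]; rewrite Rabs_Ropp;
    generalize (HB (x + - a') (y + - b')) (HB x y); lra.
Qed.

(** The rank [N] is chosen before [f], from its bound and modulus only; this will allow one [n] for
    all the solutions [u] as [eps] tends to 0. *)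
Lemma Pn_uniform B e del : 0 < del -> 0 < e -> exists N, forall n, (N <= n)%nat ->
  forall f, cont2 f -> periodic2 f -> (forall x y, Rabs (f x y) <= B) ->
  (forall x y h k, Rabs h < del -> Rabs k < del -> Rabs (f (x + h) (y + k) - f x y) <= e) ->
  forall x y, Rabs (Pn n f x y - f x y) <= 2 * e.
Proof.
  intros Hd He.
  set (d := Rmin del (/ 4)).
  assert (Hd' : 0 < d < / 2 /\ d <= del).
  { unfold d, Rmin; destruct Rle_dec; lra. }
  set (M := 2 * B / sin (PI * d) ^ 2).
  destruct (INR_unbounded (M / e)) as [N HN].
  exists N. intros n Hn f Hf Hp HB Hm x y.
  assert (HNn := le_INR _ _ Hn).
  assert (HM : M <= e * (INR n + 1)).
  { apply Rmult_lt_compat_l with (r := e) in HN; [|lra].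
    replace (e * (M / e)) with M in HN by (field; lra). nra. }
  apply Rle_trans with (e + M / (INR n + 1)).
  - apply Pn_error; [exact Hf|]. intros a b. apply modulus_sin2; try assumption; try lra.
    intros; apply Hm; lra.
  - assert (0 < INR n + 1) by (generalize (pos_INR n); lra).
    assert (M / (INR n + 1) <= e) by (apply Rle_div_l; lra). lra.
Qed.

Lemma Pn_cvg f : cont2 f -> periodic2 f -> forall e, 0 < e ->
  exists N, forall n, (N <= n)%nat -> forall x y, Rabs (Pn n f x y - f x y) <= e.
Proof.
  intros Hf Hp e He.
  destruct (periodic_max_abs f Hf Hp) as [x0 [y0 HB]].
  destruct (periodic_uniform_continuity f Hf Hp (e / 2) ltac:(lra)) as [del [Hd Hm]].
  destruct (Pn_uniform (Rabs (f x0 y0)) (e / 2) del Hd ltac:(lra)) as [N HN].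
  exists N. intros n Hn x y. replace e with (2 * (e / 2)) by field.
  apply HN; auto. intros; left; auto.
Qed.

(** * Expansion of the smoothing operator in modes and inversion of the Laplacian *)

Definition modes (n : nat) : list ((R * Z) * (R * Z)) := list_prod (cpow_modes n) (cpow_modes n).

Lemma lsum_list_prod {A B} (l : list A) (m : list B) F G :
  lsum (list_prod l m) (fun p => F (fst p) * G (snd p)) = lsum l F * lsum m G.
Proof.
  induction l as [|a l IH]; simpl; [ring|].
  rewrite lsum_app, IH.
  assert (E : lsum (map (fun y => (a, y)) m) (fun p => F (fst p) * G (snd p)) = F a * lsum m G).
  { clear. induction m as [|b m IH]; simpl; [ring | rewrite IH; ring]. }
  rewrite E. ring.
Qed.

Notation kx p := (snd (fst p)).
Notation ky p := (snd (snd p)).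

Definition mode_weight (n : nat) (p : (R * Z) * (R * Z)) : R :=
  fst (fst p) * fst (snd p) / cmass n ^ 2.

Lemma Vk_modes n s t : Vk n s * Vk n t
  = lsum (modes n) (fun p => mode_weight n p * (cosk (kx p) s * cosk (ky p) t)).
Proof.
  assert (Hc := cmass_pos n). unfold Vk. rewrite !cpow_expand.
  transitivity (/ cmass n ^ 2 * (lsum (cpow_modes n) (fun p => fst p * cosk (snd p) s) *
       lsum (cpow_modes n) (fun p => fst p * cosk (snd p) t))); [field; lra|].
  rewrite <- lsum_list_prod, <- lsum_scal. apply lsum_ext. intros [[c k] [d l]].
  unfold mode_weight; simpl. field; lra.
Qed.

Lemma Pn_modes n f x y : cont2 f ->
  Pn n f x y = lsum (modes n) (fun p => mode_weight n p * mode f (kx p) (ky p) x y).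
Proof.
  intros Hf.
  assert (HI : forall k l, cont2 (fun a b => f (x - a) (y - b) * (cosk k a * cosk l b)))
    by (intros; apply cont2_conv_integrand; auto using cosk_continuous).
  transitivity (torus_int (fun a b => lsum (modes n) (fun p => mode_weight n p *
     (f (x - a) (y - b) * (cosk (kx p) a * cosk (ky p) b))))).
  - apply tint_ext; intros a b. rewrite Vk_modes, <- lsum_scal. apply lsum_ext. intros; ring.
  - rewrite tint_lsum.
    + apply lsum_ext. intros p. now rewrite tint_scal.
    + intros p. apply cont2_mult; [apply cont2_const | apply HI].
Qed.

Definition green_weight (n : nat) (p : (R * Z) * (R * Z)) : R :=
  mode_weight n p * / eigen (kx p) (ky p).

Definition Un (n : nat) (f : R -> R -> R) (x y : R) : R :=
  lsum (modes n) (fun p => green_weight n p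
     * mode f (kx p) (ky p) x y).

(** Dividing by the eigenvalue and multiplying back loses exactly the zero mode, whose total weight
    is 1 because the kernel has mass one. [E] is arbitrary so as to serve both the modes of a
    function and the kernel itself. *)
Lemma green_weight_eigen n (E : Z -> Z -> R) :
  lsum (modes n) (fun p => green_weight n p * (eigen (kx p) (ky p) * E (kx p) (ky p)))
  = lsum (modes n) (fun p => mode_weight n p * E (kx p) (ky p)) - E 0%Z 0%Z.
Proof.
  assert (Hc := cmass_pos n).
  rewrite (lsum_ext _ _ (fun p => mode_weight n p * E (kx p) (ky p)
    + (- E 0%Z 0%Z / cmass n ^ 2) * ((fst (fst p) * coef0 (kx p)) * (fst (snd p) * coef0 (ky p))))).
  - rewrite lsum_plus, lsum_scal. unfold modes at 2.
    rewrite (lsum_list_prod (cpow_modes n) (cpow_modes n)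
      (fun p => fst p * coef0 (snd p)) (fun p => fst p * coef0 (snd p))), cmass_modes.
    field; lra.
  - intros p. unfold green_weight. rewrite Rmult_assoc, eigen_inv.
    unfold mode_weight. field; lra.
Qed.

Lemma Un_smooth n f : cont2 f -> periodic2 f -> smooth2 (Un n f).
Proof.
  intros Hf Hp k. unfold Un. apply Ck_lsum. intros p. apply Ck_scal. now apply smooth_mode.
Qed.

Lemma Un_lap n f x y : cont2 f -> periodic2 f ->
  lap_at (Un n f) x y (Pn n f x y - torus_int f).
Proof.
  intros Hf Hp. rewrite Pn_modes, <- (mode_0 f x y) by assumption.
  rewrite <- (green_weight_eigen n (fun k l => mode f k l x y)).
  apply lap_at_lsum. intros p. apply lap_at_scal. now apply mode_lap.
Qed.

Lemma mode_derive_x f k l x y : Ck 1 f -> periodic2 f ->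
  is_derive (fun t => mode f k l t y) x (mode (dx f) k l x y).
Proof.
  intros Hf Hp. apply conv_derive_x; auto using cosk_continuous, cosk_abs_le.
Qed.

Lemma mode_derive_y f k l x y : Ck 1 f -> periodic2 f ->
  is_derive (fun t => mode f k l x t) y (mode (dy f) k l x y).
Proof.
  intros Hf Hp. apply conv_derive_y; auto using cosk_continuous, cosk_abs_le.
Qed.

(** Derivatives pass through every mode onto [f]. This commutation is the source of all regularity:
    the approximations for [dx f] are the derivatives of those for [f]. *)
Lemma Un_dx n f : Ck 1 f -> periodic2 f -> dx (Un n f) = Un n (dx f).
Proof.
  intros Hf Hp. apply is_derive_dx. intros x y. unfold Un.
  apply (is_derive_lsum (modes n) (fun p t => green_weight n p
     * mode f (kx p) (ky p) t y)).
  intros p. apply is_derive_scal. now apply mode_derive_x.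
Qed.

Lemma Un_dy n f : Ck 1 f -> periodic2 f -> dy (Un n f) = Un n (dy f).
Proof.
  intros Hf Hp. apply is_derive_dy. intros x y. unfold Un.
  apply (is_derive_lsum (modes n) (fun p t => green_weight n p
     * mode f (kx p) (ky p) x t)).
  intros p. apply is_derive_scal. now apply mode_derive_y.
Qed.

Lemma Un_periodic n f : periodic2 f -> periodic2 (Un n f).
Proof.
  intros Hp x y. split; apply lsum_ext; intros p; unfold mode.
  - now rewrite (proj1 (conv_periodic _ _ f Hp x y)).
  - now rewrite (proj2 (conv_periodic _ _ f Hp x y)).
Qed.

Lemma Un_odd n f : cont2 f -> periodic2 f -> odd2 f -> odd2 (Un n f).
Proof.
  intros Hf Hp Ho.
  assert (Hm : forall k l, odd2 (mode f k l))
    by (intros; apply conv_odd; auto using cosk_continuous, cosk_periodic, cosk_even).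
  intros x y. unfold Un.
  split; (replace (- lsum (modes n) (fun p => green_weight n p
     * mode f (kx p) (ky p) x y)) with
     (lsum (modes n) (fun p => (-1) * (green_weight n p
     * mode f (kx p) (ky p) x y))) by (rewrite lsum_scal; ring));
  apply lsum_ext; intros p.
  - rewrite (proj1 (Hm _ _ x y)). ring.
  - rewrite (proj2 (Hm _ _ x y)). ring.
Qed.

Lemma Un_minus n f g x y : cont2 f -> cont2 g ->
  Un n (fun x y => f x y - g x y) x y = Un n f x y - Un n g x y.
Proof.
  intros Hf Hg. unfold Un.
  transitivity (lsum (modes n) (fun p => green_weight n p
     * mode f (kx p) (ky p) x y + (-1) * (green_weight n p
     * mode g (kx p) (ky p) x y))).
  - apply lsum_ext; intros p. unfold mode.
    rewrite conv_minus; auto using cosk_continuous. ring.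
  - rewrite lsum_plus, lsum_scal. ring.
Qed.

(** * Uniform limits of functions and of their first derivatives *)

Definition uniformly_cauchy (v : nat -> R -> R -> R) : Prop :=
  forall e, 0 < e -> exists N, forall n m, (N <= n)%nat -> (N <= m)%nat -> forall x y,
     Rabs (v n x y - v m x y) <= e.

Definition uniform_cvg (v : nat -> R -> R -> R) (V : R -> R -> R) : Prop :=
  forall e, 0 < e -> exists N, forall n, (N <= n)%nat -> forall x y, Rabs (v n x y - V x y) <= e.

Lemma uniform_limit (v : nat -> R -> R -> R) : uniformly_cauchy v -> exists V, uniform_cvg v V.
Proof.
  intros Hv.
  assert (Hx : forall x y, ex_finite_lim_seq (fun n => v n x y)).
  { intros x y. apply ex_lim_seq_cauchy_corr. intros [e He].
    destruct (Hv (e / 2) ltac:(lra)) as [N HN]. exists N. intros n m Hn Hm.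
    specialize (HN n m Hn Hm x y). simpl. lra. }
  exists (fun x y => real (Lim_seq (fun n => v n x y))).
  intros e He. destruct (Hv e He) as [N HN]. exists N. intros n Hn x y.
  assert (HL := Lim_seq_correct' _ (Hx x y)).
  assert (HL2 : is_lim_seq (fun m => Rabs (v n x y - v m x y))
     (Rabs (v n x y - real (Lim_seq (fun n => v n x y))))).
  { apply is_lim_seq_continuous.
    - apply continuity_pt_filterlim, continuous_Rabs.
    - apply is_lim_seq_minus'; [apply is_lim_seq_const | exact HL]. }
  apply (is_lim_seq_le_loc _ (fun _ => e) _ _ (ex_intro _ N (fun m Hm => HN n m Hn Hm x y)) HL2
    (is_lim_seq_const e)).
Qed.

Lemma uniform_limit_cont2 v V : (forall n, cont2 (v n)) -> uniform_cvg v V -> cont2 V.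
Proof.
  intros Hv HV. apply cont2_pt. intros x y [e He].
  destruct (HV (e / 4) ltac:(lra)) as [N HN].
  destruct (proj1 (cont2_pt _) (Hv N) x y (mkposreal (e / 4) ltac:(lra))) as [d Hd].
  exists d. intros s t Hs Ht. specialize (Hd s t Hs Ht). simpl in *.
  generalize (HN N (le_n N) x y) (HN N (le_n N) s t). intros A B.
  abs_lra.
Qed.

Lemma uniform_limit_derive (w w' : nat -> R -> R) (W W' : R -> R) :
  (forall n t, is_derive (w n) t (w' n t)) -> (forall t, continuity_pt W' t) ->
  (forall e, 0 < e -> exists N, forall n, (N <= n)%nat -> forall t, Rabs (w n t - W t) <= e) ->
  (forall e, 0 < e -> exists N, forall n, (N <= n)%nat -> forall t, Rabs (w' n t - W' t) <= e) ->
  forall t, is_derive W t (W' t).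
Proof.
  intros Hd Hc HW HW' t. apply is_derive_Reals.
  apply (derivable_pt_lim_CVU w w' W W' t t (mkposreal 1 Rlt_0_1)); auto.
  - unfold Boule. rewrite Rminus_diag, Rabs_R0. exact Rlt_0_1.
  - intros y n _. now apply is_derive_Reals.
  - intros y _ e He. destruct (HW (e / 2) ltac:(lra)) as [N HN]. exists N. intros n Hn.
    specialize (HN n Hn y). unfold Rdist. lra.
  - intros e He. destruct (HW' (e / 2) ltac:(lra)) as [N HN]. exists N. intros n y Hn _.
    specialize (HN n Hn y). rewrite Rabs_minus_sym. lra.
Qed.

Definition C1_converges (v : nat -> R -> R -> R) (u : R -> R -> R) : Prop :=
  forall e, 0 < e -> exists N, forall n, (N <= n)%nat -> forall x y,
     Rabs (v n x y - u x y) <= e /\ Rabs (dx (v n) x y - dx u x y) <= e /\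
     Rabs (dy (v n) x y - dy u x y) <= e.

Lemma C1_limit (u : nat -> R -> R -> R) :
  (forall n, Ck 1 (u n)) ->
  (forall e, 0 < e -> exists N, forall n m, (N <= n)%nat -> (N <= m)%nat -> forall x y,
     Rabs (u n x y - u m x y) <= e /\ Rabs (dx (u n) x y - dx (u m) x y) <= e /\
     Rabs (dy (u n) x y - dy (u m) x y) <= e) ->
  exists U, Ck 1 U /\ C1_converges u U.
Proof.
  intros Hu Hc.
  destruct (uniform_limit u) as [U HU].
  { intros e He. destruct (Hc e He) as [N HN]. exists N. intros n m Hn Hm x y.
    apply (HN n m Hn Hm x y). }
  destruct (uniform_limit (fun n => dx (u n))) as [Ux HUx].
  { intros e He. destruct (Hc e He) as [N HN]. exists N. intros n m Hn Hm x y.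
    apply (HN n m Hn Hm x y). }
  destruct (uniform_limit (fun n => dy (u n))) as [Uy HUy].
  { intros e He. destruct (Hc e He) as [N HN]. exists N. intros n m Hn Hm x y.
    apply (HN n m Hn Hm x y). }
  assert (Cx : cont2 Ux).
  { apply uniform_limit_cont2 with (fun n => dx (u n)); [|exact HUx].
    intros n. exact (proj1 (proj2 (proj2 (Hu n)))). }
  assert (Cy : cont2 Uy).
  { apply uniform_limit_cont2 with (fun n => dy (u n)); [|exact HUy].
    intros n. exact (proj2 (proj2 (proj2 (Hu n)))). }
  assert (HdU : forall x y, is_derive (fun t => U t y) x (Ux x y)).
  { intros x y. apply (uniform_limit_derive (fun n t => u n t y) (fun n t => dx (u n) t y)
      (fun t => U t y) (fun t => Ux t y)).
    - intros n t. now apply (Ck_is_derive_x 0).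
    - intros t. exact (cont2_slice_y _ y t (cont2_swap _ Cx)).
    - intros e He. destruct (HU e He) as [N HN]. exists N. intros; now apply HN.
    - intros e He. destruct (HUx e He) as [N HN]. exists N. intros; now apply HN. }
  assert (HdU' : forall x y, is_derive (fun t => U x t) y (Uy x y)).
  { intros x y. apply (uniform_limit_derive (fun n t => u n x t) (fun n t => dy (u n) x t)
      (fun t => U x t) (fun t => Uy x t)).
    - intros n t. now apply (Ck_is_derive_y 0).
    - intros t. now apply cont2_slice_y.
    - intros e He. destruct (HU e He) as [N HN]. exists N. intros; now apply HN.
    - intros e He. destruct (HUy e He) as [N HN]. exists N. intros; now apply HN. }
  exists U. split.
  - apply Ck_intro with Ux Uy; auto.
    apply uniform_limit_cont2 with u; [|exact HU]. intros n; apply Ck_cont2 with 1%nat, Hu.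
  - intros e He. rewrite (is_derive_dx U Ux HdU), (is_derive_dy U Uy HdU').
    destruct (HU e He) as [N1 H1]. destruct (HUx e He) as [N2 H2].
    destruct (HUy e He) as [N3 H3].
    exists (max N1 (max N2 N3)). intros n Hn x y.
    split; [apply H1; lia | split; [apply H2; lia | apply H3; lia]].
Qed.

(** * Poisson's equation on the torus *)

Lemma has_d2_unique f x l m : has_d2 f x l -> has_d2 f x m -> l = m.
Proof.
  intros [f' [H1 H2]] [g' [H3 H4]].
  rewrite <- (is_derive_unique _ _ _ H2). apply is_derive_unique.
  apply is_derive_ext_loc with g'; [|exact H4].
  generalize (filter_and _ _ H1 H3). apply filter_imp. intros t [A B].
  rewrite <- (is_derive_unique _ _ _ A). symmetry. now apply is_derive_unique.
Qed.

Lemma lap_at_unique u x y l m : lap_at u x y l -> lap_at u x y m -> l = m.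
Proof.
  intros [p [q [A [B ->]]]] [p' [q' [A' [B' ->]]]].
  now rewrite (has_d2_unique _ _ _ _ A A'), (has_d2_unique _ _ _ _ B B').
Qed.

Lemma dx_plus_const v c : Ck 1 v -> dx (fun x y => v x y + c) = dx v.
Proof.
  intros Hv. apply is_derive_dx. intros x y. rewrite <- (Rplus_0_r (dx v x y)).
  apply (is_derive_plus (fun t => v t y) (fun _ => c)).
  - now apply (Ck_is_derive_x 0).
  - exact (is_derive_const c x).
Qed.

Lemma dy_plus_const v c : Ck 1 v -> dy (fun x y => v x y + c) = dy v.
Proof.
  intros Hv. apply is_derive_dy. intros x y. rewrite <- (Rplus_0_r (dy v x y)).
  apply (is_derive_plus (fun t => v x t) (fun _ => c)).
  - now apply (Ck_is_derive_y 0).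
  - exact (is_derive_const c y).
Qed.

(** Normalised to vanish at the origin, as the a priori bound requires, instead of having mean
    zero. *)
Definition Un0 (n : nat) (f : R -> R -> R) (x y : R) : R := Un n f x y + - Un n f 0 0.

(* [u] is the solution of [Δ u = f - mean f] with [u 0 0 = 0]; for merely
   continuous [f] it is only defined as a limit, see [poisson_lap]. *)
Definition poisson (f u : R -> R -> R) : Prop := Ck 1 u /\ C1_converges (fun n => Un0 n f) u.

Section Poisson.

Variable f : R -> R -> R.
Hypothesis Hf : cont2 f.
Hypothesis Hp : periodic2 f.

Lemma Un0_smooth n : smooth2 (Un0 n f).
Proof.
  intros k. apply (Ck_plus k (Un n f) (fun _ _ => - Un n f 0 0)); [now apply Un_smooth | apply Ck_const].
Qed.

Lemma Un0_periodic n : periodic2 (Un0 n f).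
Proof.
  intros x y. unfold Un0. now rewrite (proj1 (Un_periodic n f Hp x y)), (proj2 (Un_periodic n f Hp x y)).
Qed.

Lemma Un0_lap n x y : lap_at (Un0 n f) x y (Pn n f x y - torus_int f).
Proof.
  rewrite <- (Rplus_0_r (Pn n f x y - torus_int f)).
  apply (lap_at_plus (Un n f) (fun _ _ => - Un n f 0 0)); [now apply Un_lap | apply lap_at_const].
Qed.

Lemma Un0_zero n : Un0 n f 0 0 = 0.
Proof. unfold Un0; ring. Qed.

Lemma Un0_dx n : dx (Un0 n f) = dx (Un n f).
Proof. apply dx_plus_const. now apply Un_smooth. Qed.

Lemma Un0_dy n : dy (Un0 n f) = dy (Un n f).
Proof. apply dy_plus_const. now apply Un_smooth. Qed.

(** The difference of two approximations has Laplacian [Pn n f - Pn m f], which is uniformly small,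
    so the a priori bound makes the sequence Cauchy together with its gradient. *)
Lemma poisson_exists : exists u, poisson f u.
Proof.
  apply C1_limit; [intros n; apply Un0_smooth|].
  (* Two errors of [e / 16] keep the Laplacian below [e / 4], and the a priori constant is 4. *)
  intros e He. destruct (Pn_cvg f Hf Hp (e / 16) ltac:(lra)) as [N HN].
  exists N. intros n m Hn Hm.
  destruct (normalized_bound (fun x y => Un0 n f x y - Un0 m f x y)
    (fun x y => (Pn n f x y - torus_int f) - (Pn m f x y - torus_int f)) (e / 4)) as [A [B C]].
  - apply cont2_minus; apply (Un0_smooth _ 0%nat).
  - apply periodic2_minus; apply Un0_periodic.
  - rewrite !Un0_zero; ring.
  - intros x y. apply lap_at_minus; apply Un0_lap.
  - intros x y. generalize (HN n Hn x y) (HN m Hm x y). intros A B.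
    abs_lra.
  - replace (4 * (e / 4)) with e in * by field.
    intros x y. split; [apply A|]. split.
    + apply (B x y). apply (is_derive_minus (fun t => Un0 n f t y) (fun t => Un0 m f t y));
        apply (Ck_is_derive_x 0), Un0_smooth.
    + apply (C x y). apply (is_derive_minus (fun t => Un0 n f x t) (fun t => Un0 m f x t));
        apply (Ck_is_derive_y 0), Un0_smooth.
Qed.

(** The constant is [4 * 2]: the a priori constant times the bound [2 B] on [f] minus its mean. The
    slack [e] pays for the approximation. *)
Lemma poisson_bound u B : poisson f u -> (forall x y, Rabs (f x y) <= B) -> forall x y,
  Rabs (u x y) <= 8 * B /\ Rabs (dx u x y) <= 8 * B /\ Rabs (dy u x y) <= 8 * B.
Proof.
  intros [_ Hu] HB.
  assert (HT : Rabs (torus_int f) <= B).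
  { rewrite <- (tint_const B). apply tint_abs_le; auto using cont2_const. }
  assert (K : forall e, 0 < e -> forall x y,
    Rabs (u x y) <= 8 * B + e /\ Rabs (dx u x y) <= 8 * B + e /\ Rabs (dy u x y) <= 8 * B + e).
  { intros e He.
    destruct (Pn_cvg f Hf Hp (e / 16) ltac:(lra)) as [N1 HN1].
    destruct (Hu (e / 2) ltac:(lra)) as [N2 HN2].
    set (n := max N1 N2).
    destruct (normalized_bound (Un0 n f) (fun x y => Pn n f x y - torus_int f) (2 * B + e / 8))
      as [A1 [A2 A3]].
    - apply (Un0_smooth _ 0%nat).
    - apply Un0_periodic.
    - apply Un0_zero.
    - apply Un0_lap.
    - intros x y. generalize (HN1 n ltac:(unfold n; lia) x y) (HB x y). intros A1 A2.
      abs_lra.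
    - intros x y. destruct (HN2 n ltac:(unfold n; lia) x y) as [B1 [B2 B3]].
      specialize (A1 x y).
      specialize (A2 x y _ (Ck_is_derive_x 0 _ x y (Un0_smooth n 1%nat))).
      specialize (A3 x y _ (Ck_is_derive_y 0 _ x y (Un0_smooth n 1%nat))).
      abs_lra. }
  intros x y. repeat split; apply Rle_plus_epsilon; intros e He; now apply K.
Qed.

(** Proportionality of two values survives the limit; [c = 1] transfers periodicity and [c = -1]
    oddness. *)
Lemma poisson_limit_eq u x y x' y' c : poisson f u ->
  (forall n, Un0 n f x y = c * Un0 n f x' y') -> u x y = c * u x' y'.
Proof.
  intros [_ Hu] E.
  assert (L : forall x y, is_lim_seq (fun n => Un0 n f x y) (u x y)).
  { intros s t. apply is_lim_seq_spec. intros [e He].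
    destruct (Hu (e / 2) ltac:(lra)) as [N HN]. exists N. intros n Hn.
    destruct (HN n Hn s t) as [A _]. simpl. lra. }
  assert (L1 := is_lim_seq_unique _ _ (L x y)).
  assert (L2 := is_lim_seq_unique _ _ (is_lim_seq_scal_l _ c _ (L x' y'))).
  rewrite (Lim_seq_ext _ _ E), L2 in L1. simpl in L1. now injection L1.
Qed.

Lemma poisson_periodic u : poisson f u -> periodic2 u.
Proof.
  intros Hu x y. rewrite <- (Rmult_1_l (u x y)).
  split; apply poisson_limit_eq; try assumption; intros n; rewrite Rmult_1_l;
    [exact (proj1 (Un0_periodic n x y)) | exact (proj2 (Un0_periodic n x y))].
Qed.

Lemma poisson_odd u : odd2 f -> poisson f u -> odd2 u.
Proof.
  intros Ho Hu.
  assert (HU : forall n, odd2 (Un0 n f)).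
  { intros n. assert (HO := Un_odd n f Hf Hp Ho).
    assert (E : Un n f 0 0 = 0).
    { generalize (proj1 (HO 0 0)). rewrite Ropp_0. lra. }
    intros x y. unfold Un0. rewrite E, (proj1 (HO x y)), (proj2 (HO x y)). split; ring. }
  intros x y. replace (- u x y) with ((-1) * u x y) by ring.
  split; apply poisson_limit_eq; try assumption; intros n.
  - rewrite (proj1 (HU n x y)). ring.
  - rewrite (proj2 (HU n x y)). ring.
Qed.

End Poisson.

Lemma dx_minus u v : Ck 1 u -> Ck 1 v ->
  dx (fun x y => u x y - v x y) = (fun x y => dx u x y - dx v x y).
Proof.
  intros Hu Hv. apply is_derive_dx; intros x y.
  apply (is_derive_minus (fun t => u t y) (fun t => v t y)); now apply (Ck_is_derive_x 0).
Qed.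

Lemma dy_minus u v : Ck 1 u -> Ck 1 v ->
  dy (fun x y => u x y - v x y) = (fun x y => dy u x y - dy v x y).
Proof.
  intros Hu Hv. apply is_derive_dy; intros x y.
  apply (is_derive_minus (fun t => u x t) (fun t => v x t)); now apply (Ck_is_derive_y 0).
Qed.

Lemma poisson_minus f g u v : cont2 f -> cont2 g -> periodic2 f -> periodic2 g ->
  poisson f u -> poisson g v ->
  poisson (fun x y => f x y - g x y) (fun x y => u x y - v x y).
Proof.
  intros Hf Hg Hfp Hgp [Hu Cu] [Hv Cv]. split; [now apply Ck_minus|].
  intros e He. destruct (Cu (e / 2) ltac:(lra)) as [N1 H1]. destruct (Cv (e / 2) ltac:(lra)) as [N2 H2].
  exists (max N1 N2). intros n Hn x y.
  replace (Un0 n (fun x y => f x y - g x y)) with (fun x y => Un0 n f x y - Un0 n g x y).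
  - assert (S1 := Un0_smooth f Hf Hfp n 1%nat). assert (S2 := Un0_smooth g Hg Hgp n 1%nat).
    rewrite (dx_minus _ _ S1 S2), (dy_minus _ _ S1 S2),
      (dx_minus u v Hu Hv), (dy_minus u v Hu Hv).
    destruct (H1 n ltac:(lia) x y) as [A1 [A2 A3]]. destruct (H2 n ltac:(lia) x y) as [B1 [B2 B3]].
    abs_lra.
  - apply ext2. intros s t. unfold Un0. rewrite !Un_minus by assumption. ring.
Qed.

(** Both sides are limits of [dx (Un n f) = Un n (dx f)]. The constant appears because [v] is
    normalised at the origin and [dx u] is not. *)
Lemma poisson_dx f u v : Ck 1 f -> periodic2 f -> poisson f u -> poisson (dx f) v ->
  forall x y, dx u x y = v x y + dx u 0 0.
Proof.
  intros Hf Hp [_ Hu] [_ Hv] x y. apply cond_eq. intros e He.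
  assert (Hc := Ck_cont2 1 f Hf).
  destruct (Hu (e / 4) ltac:(lra)) as [N1 H1]. destruct (Hv (e / 4) ltac:(lra)) as [N2 H2].
  set (n := max N1 N2).
  destruct (H1 n ltac:(unfold n; lia) x y) as [_ [A _]].
  destruct (H1 n ltac:(unfold n; lia) 0 0) as [_ [A0 _]].
  destruct (H2 n ltac:(unfold n; lia) x y) as [B _].
  rewrite Un0_dx, Un_dx in A, A0 by assumption. unfold Un0 in B.
  abs_lra.
Qed.

Lemma poisson_dy f u v : Ck 1 f -> periodic2 f -> poisson f u -> poisson (dy f) v ->
  forall x y, dy u x y = v x y + dy u 0 0.
Proof.
  intros Hf Hp [_ Hu] [_ Hv] x y. apply cond_eq. intros e He.
  assert (Hc := Ck_cont2 1 f Hf).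
  destruct (Hu (e / 4) ltac:(lra)) as [N1 H1]. destruct (Hv (e / 4) ltac:(lra)) as [N2 H2].
  set (n := max N1 N2).
  destruct (H1 n ltac:(unfold n; lia) x y) as [_ [_ A]].
  destruct (H1 n ltac:(unfold n; lia) 0 0) as [_ [_ A0]].
  destruct (H2 n ltac:(unfold n; lia) x y) as [B _].
  rewrite Un0_dy, Un_dy in A, A0 by assumption. unfold Un0 in B.
  abs_lra.
Qed.

(** The gradient of [u] solves Poisson's equation with source [dx f] or [dy f], up to constants. The
    base case is the C^1 convergence built into [poisson]; each derivative of [f] then gives one of
    [∇ u]. *)
Lemma poisson_Ck k f u : Ck k f -> periodic2 f -> poisson f u -> Ck (S k) u.
Proof.
  revert f u; induction k as [|k IH]; intros f u Hf Hp Hu; [apply Hu|].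
  assert (H1 : Ck 1 f).
  { destruct Hf as [A [B [C D]]]. split; [exact A|]. split; [exact B|].
    split; eapply Ck_cont2; eassumption. }
  destruct (poisson_exists (dx f)) as [v Hv]; [apply H1 | now apply periodic_dx|].
  destruct (poisson_exists (dy f)) as [w Hw]; [apply H1 | now apply periodic_dy|].
  assert (Hu1 := proj1 Hu).
  apply Ck_intro with (dx u) (dy u).
  - now apply Ck_cont2 with 1%nat.
  - intros x y. now apply (Ck_is_derive_x 0).
  - intros x y. now apply (Ck_is_derive_y 0).
  - rewrite (ext2 _ _ (poisson_dx f u v H1 Hp Hu Hv)).
    apply Ck_plus; [|apply Ck_const]. apply (IH (dx f)); [apply Hf | now apply periodic_dx | exact Hv].
  - rewrite (ext2 _ _ (poisson_dy f u w H1 Hp Hu Hw)).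
    apply Ck_plus; [|apply Ck_const]. apply (IH (dy f)); [apply Hf | now apply periodic_dy | exact Hw].
Qed.

(** The second derivatives of the approximations converge too, being first derivatives of the
    approximations for [dx f] and [dy f]; their sum is [Pn n f] minus the mean. *)
Lemma poisson_lap f u : Ck 1 f -> periodic2 f -> poisson f u ->
  forall x y, laplacian u x y = f x y - torus_int f.
Proof.
  intros Hf Hp Hu x y. assert (Hc := Ck_cont2 1 f Hf).
  assert (Hpx := periodic_dx f Hf Hp). assert (Hpy := periodic_dy f Hf Hp).
  assert (Hcx : cont2 (dx f)) by exact (proj1 (proj2 (proj2 Hf))).
  assert (Hcy : cont2 (dy f)) by exact (proj2 (proj2 (proj2 Hf))).
  destruct (poisson_exists (dx f) Hcx Hpx) as [v Hv].
  destruct (poisson_exists (dy f) Hcy Hpy) as [w Hw].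
  unfold laplacian.
  rewrite (ext2 _ _ (poisson_dx f u v Hf Hp Hu Hv)), (ext2 _ _ (poisson_dy f u w Hf Hp Hu Hw)).
  rewrite (dx_plus_const v _ (proj1 Hv)), (dy_plus_const w _ (proj1 Hw)).
  apply cond_eq. intros e He.
  destruct (proj2 Hv (e / 4) ltac:(lra)) as [N1 H1].
  destruct (proj2 Hw (e / 4) ltac:(lra)) as [N2 H2].
  destruct (Pn_cvg f Hc Hp (e / 4) ltac:(lra)) as [N3 H3].
  set (n := max N1 (max N2 N3)).
  destruct (H1 n ltac:(unfold n; lia) x y) as [_ [A _]].
  destruct (H2 n ltac:(unfold n; lia) x y) as [_ [_ B]].
  assert (C := H3 n ltac:(unfold n; lia) x y).
  rewrite Un0_dx, <- Un_dx in A by assumption. rewrite Un0_dy, <- Un_dy in B by assumption.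
  assert (D : laplacian (Un n f) x y = Pn n f x y - torus_int f).
  { apply (lap_at_unique (Un n f) x y); [|now apply Un_lap].
    apply Ck_lap_at. now apply Un_smooth. }
  unfold laplacian in D.
  abs_lra.
Qed.

(** * Existence of solutions *)

(** Retains of [- Feps] only what the equation sees. Smoothness is a chain of successive
    derivatives, ready for [Ck_comp]; the value [-1] below [- eps] comes from oddness. *)
Record approx_sign (eps : R) (g : R -> R) : Prop := {
  as_smooth : exists H : nat -> R -> R, H 0%nat = g /\ forall n x, is_derive (H n) x (H (S n) x);
  as_odd : forall t, g (- t) = - g t;
  as_incr : forall s t, s <= t -> g s <= g t;
  as_one : forall t, eps <= t -> g t = 1 }.

Lemma as_range eps g t : approx_sign eps g -> -1 <= g t <= 1.
Proof.
  intros [_ Ho Hi H1]. split.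
  - assert (g (- Rmax eps (- t)) = -1).
    { rewrite Ho, H1 by apply Rmax_l. reflexivity. }
    rewrite <- H. apply Hi. generalize (Rmax_r eps (- t)). lra.
  - rewrite <- (H1 (Rmax eps t)) by apply Rmax_l. apply Hi, Rmax_r.
Qed.

Lemma as_nonneg eps g t : approx_sign eps g -> 0 <= t -> 0 <= g t.
Proof.
  intros [_ Ho Hi _] Ht. apply Rle_trans with (g 0); [|now apply Hi].
  generalize (Ho 0). rewrite Ropp_0. lra.
Qed.

(** * The mollified sign function is an approximate sign *)

Section Mollifier.

Variables (K : R -> R) (eps : R).
Hypothesis HK : mollifier K.
Hypothesis Heps : 0 < eps.

Lemma K_derive n x : is_derive (Derive_n K n) x (Derive_n K (S n) x).
Proof. apply Derive_correct. apply (proj1 HK (S n) x). Qed.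

Lemma K_continuous : continuous1 K.
Proof. exact (continuous_derivable K _ (K_derive 0)). Qed.

Lemma K_zero x : 1 <= Rabs x -> K x = 0.
Proof.
  destruct HK as [_ [_ [_ [[r [Hr H]] _]]]]. intros Hx. apply H. lra.
Qed.

Definition KepsD (n : nat) (s : R) : R := (/ eps) ^ S n * Derive_n K n (/ eps * s + 0).

Lemma KepsD_derive n s : is_derive (KepsD n) s (KepsD (S n) s).
Proof.
  unfold KepsD.
  replace ((/ eps) ^ S (S n) * Derive_n K (S n) (/ eps * s + 0)) with
    ((/ eps) ^ S n * (/ eps * Derive_n K (S n) (/ eps * s + 0))) by (simpl; ring).
  apply (is_derive_scal (fun s => Derive_n K n (/ eps * s + 0))).
  apply (is_derive_comp (Derive_n K n) (fun s => / eps * s + 0)); [apply K_derive|].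
  auto_derive; [exact I | ring].
Qed.

Lemma KepsD_0 s : KepsD 0 s = Keps K eps s.
Proof.
  unfold KepsD, Keps. simpl. rewrite Rmult_1_r. f_equal. f_equal. field; lra.
Qed.

Lemma Keps_continuous : continuous1 (Keps K eps).
Proof.
  intros s. apply (continuous_ext (KepsD 0)); [apply KepsD_0|].
  exact (continuous_derivable _ _ (KepsD_derive 0) s).
Qed.

Lemma Keps_zero s : eps <= Rabs s -> Keps K eps s = 0.
Proof.
  intros Hs. unfold Keps. rewrite K_zero; [ring|].
  unfold Rdiv. rewrite Rabs_mult, (Rabs_right (/ eps)).
  - apply Rle_div_r; lra.
  - left. now apply Rinv_0_lt_compat.
Qed.

Lemma Keps_nonneg s : 0 <= Keps K eps s.
Proof.
  unfold Keps. apply Rmult_le_pos; [left; now apply Rinv_0_lt_compat|].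
  apply HK.
Qed.

Lemma Keps_even s : Keps K eps (- s) = Keps K eps s.
Proof.
  unfold Keps. f_equal. replace (- s / eps) with (- (s / eps)) by (field; lra). apply HK.
Qed.

Lemma ex_int_Keps a b : ex_RInt (Keps K eps) a b.
Proof. apply ex_int, Keps_continuous. Qed.

Lemma Keps_mass : RInt (Keps K eps) (- eps) eps = 1.
Proof.
  assert (E := RInt_comp_lin (V := CRV) K (/ eps) 0 (- eps) eps
    ltac:(apply ex_int, K_continuous)).
  replace (/ eps * - eps + 0) with (-1) in E by (field; lra).
  replace (/ eps * eps + 0) with 1 in E by (field; lra).
  transitivity (RInt K (-1) 1); [|apply HK].
  rewrite <- E. apply RInt_ext. intros s _. unfold scal; simpl; unfold mult; simpl.
  unfold Keps. do 2 f_equal. field; lra.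
Qed.

Lemma RInt_Keps_zero a b : a <= b -> b <= - eps \/ eps <= a -> RInt (Keps K eps) a b = 0.
Proof.
  intros Hab H. rewrite (RInt_ext _ (fun _ => 0)).
  - rewrite (RInt_const (V := CRV)). unfold scal; simpl; unfold mult; simpl; ring.
  - intros s Hs. rewrite Rmin_left, Rmax_right in Hs by lra. apply Keps_zero.
    unfold Rabs; destruct Rcase_abs; lra.
Qed.

(** Closed form of [sgn] convolved with [Keps]. As a primitive of [2 Keps] it is visibly smooth and
    increasing, although the convolution is against a jump. *)
Definition Gp (t : R) : R := 2 * RInt (Keps K eps) (- eps) t - 1.

Lemma RInt_Keps_chasles a b c :
  RInt (Keps K eps) a b + RInt (Keps K eps) b c = RInt (Keps K eps) a c.
Proof.
  exact (RInt_Chasles (V := CRV) _ a b c (ex_int_Keps a b) (ex_int_Keps b c)).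
Qed.

Lemma Feps_Gp t : - Feps K eps t = Gp t.
Proof.
  unfold Feps. rewrite Ropp_involutive.
  assert (P : forall a b, a <= b -> b <= t ->
    is_RInt (fun s => sgn (t - s) * Keps K eps s) a b (RInt (Keps K eps) a b)).
  { intros a b Hab Hb. apply (is_RInt_ext (Keps K eps)).
    - intros s Hs. rewrite Rmin_left, Rmax_right in Hs by lra.
      change (Keps K eps s = sgn (t - s) * Keps K eps s).
      unfold sgn. destruct Rlt_dec; [ring | lra].
    - apply (RInt_correct (V := CRV)), ex_int_Keps. }
  assert (M : forall a b, a <= b -> t <= a ->
    is_RInt (fun s => sgn (t - s) * Keps K eps s) a b (- RInt (Keps K eps) a b)).
  { intros a b Hab Hb. apply (is_RInt_ext (fun s => opp (Keps K eps s))).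
    - intros s Hs. rewrite Rmin_left, Rmax_right in Hs by lra.
      change (- Keps K eps s = sgn (t - s) * Keps K eps s).
      unfold sgn. destruct Rlt_dec; [lra | ring].
    - apply (is_RInt_opp (V := RV)).
      apply (RInt_correct (V := CRV)), ex_int_Keps. }
  unfold Gp. assert (HM := Keps_mass).
  destruct (Rle_dec t (- eps)) as [H1|H1]; [|destruct (Rle_dec t eps) as [H2|H2]].
  - rewrite (is_RInt_unique (V := CRV) _ _ _ _ (M (- eps) eps ltac:(lra) H1)).
    assert (E := RInt_Keps_chasles t (- eps) t).
    rewrite (RInt_Keps_zero t (- eps)), (RInt_point t) in E by lra.
    unfold zero in E; simpl in E. lra.
  - assert (E := is_RInt_Chasles (V := RV) _ _ _ _ _ _ (P (- eps) t ltac:(lra) ltac:(lra))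
      (M t eps ltac:(lra) ltac:(lra))).
    rewrite (is_RInt_unique (V := CRV) _ _ _ _ E).
    unfold plus; simpl. generalize (RInt_Keps_chasles (- eps) t eps). lra.
  - rewrite (is_RInt_unique (V := CRV) _ _ _ _ (P (- eps) eps ltac:(lra) ltac:(lra))).
    generalize (RInt_Keps_chasles (- eps) eps t). rewrite (RInt_Keps_zero eps t) by lra. lra.
Qed.

Lemma Gp_derive t : is_derive Gp t (2 * KepsD 0 t).
Proof.
  unfold Gp. rewrite KepsD_0. rewrite <- (Rminus_0_r (2 * Keps K eps t)).
  apply (is_derive_minus (fun t => 2 * RInt (Keps K eps) (- eps) t) (fun _ => 1)).
  - apply is_derive_scal.
    apply (is_derive_RInt (V := RV) (Keps K eps) _ (- eps)).
    + apply filter_forall. intros x.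
      apply (RInt_correct (V := CRV)), ex_int_Keps.
    + apply Keps_continuous.
  - exact (is_derive_const 1 t).
Qed.

Lemma Gp_one t : eps <= t -> Gp t = 1.
Proof.
  intros Ht. unfold Gp. rewrite <- (RInt_Keps_chasles (- eps) eps t), Keps_mass,
    (RInt_Keps_zero eps t) by lra. ring.
Qed.

(** The sum [Gp s + Gp (- s)] has derivative zero since [Keps] is even, and it vanishes at
    [s = eps]. *)
Lemma Gp_odd t : Gp (- t) = - Gp t.
Proof.
  destruct (mvt (fun s => Gp s + Gp (- s)) (fun s => 2 * KepsD 0 s + - (2 * KepsD 0 (- s))) eps t)
    as [c [_ E]].
  - intros s _. apply (is_derive_plus Gp (fun s => Gp (- s))); [apply Gp_derive|].
    replace (- (2 * KepsD 0 (- s))) with ((-1) * (2 * KepsD 0 (- s))) by ring.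
    apply (is_derive_comp Gp (fun s => - s)); [apply Gp_derive|].
    auto_derive; [exact I | ring].
  - rewrite !KepsD_0, Keps_even, (Gp_one eps) in E by lra.
    assert (Gp (- eps) = -1).
    { unfold Gp. rewrite RInt_point. unfold zero; simpl. ring. }
    lra.
Qed.

Lemma Feps_approx_sign : approx_sign eps (fun t => - Feps K eps t).
Proof.
  replace (fun t => - Feps K eps t) with Gp by (apply functional_extensionality; intros; symmetry; apply Feps_Gp).
  split.
  - exists (fun n => match n with O => Gp | S m => fun t => 2 * KepsD m t end).
    split; [reflexivity|]. intros [|n] x; [apply Gp_derive|].
    apply (is_derive_scal (KepsD n)), KepsD_derive.
  - apply Gp_odd.
  - intros s t Hst. destruct (mvt Gp (fun t => 2 * KepsD 0 t) s t) as [c [_ E]].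
    + intros; apply Gp_derive.
    + rewrite KepsD_0 in E. generalize (Keps_nonneg c). nra.
  - intros; now apply Gp_one.
Qed.

End Mollifier.

Lemma Wsub_smooth : smooth2 Wsub.
Proof.
  intros k.
  assert (Hx : Ck k (fun x _ => sin2pi x)).
  { replace (fun x _ : R => sin2pi x) with (fun x _ : R => sin (2 * PI * x + 0))
      by (apply ext2; intros; unfold sin2pi; f_equal; ring).
    apply smooth_sin_fst. }
  assert (Hy : Ck k (fun _ y => sin2pi y)).
  { replace (fun _ y : R => sin2pi y) with (fun _ y : R => sin (2 * PI * y + 0))
      by (apply ext2; intros; unfold sin2pi; f_equal; ring).
    apply smooth_sin_snd. }
  assert (Hs : Ck k ss) by exact (Ck_mult k _ _ Hx Hy).
  replace Wsub with (fun x y => / 5000 * (ss x y * (9 + (3 * (sin2pi x * sin2pi x + sin2pi y * sin2pi y)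
    + 5 * (ss x y * ss x y))))) by (apply ext2; intros; unfold Wsub; ring).
  apply Ck_scal, Ck_mult; [exact Hs|].
  apply (Ck_plus k (fun _ _ => 9)); [apply Ck_const|].
  apply Ck_plus; apply Ck_scal.
  - apply Ck_plus; [exact (Ck_mult k _ _ Hx Hx) | exact (Ck_mult k _ _ Hy Hy)].
  - now apply Ck_mult.
Qed.

Lemma eventually_all (M : nat) (P : nat -> nat -> Prop) :
  (forall i, (i <= M)%nat -> exists N, forall n, (N <= n)%nat -> P i n) ->
  exists N, forall i, (i <= M)%nat -> forall n, (N <= n)%nat -> P i n.
Proof.
  induction M as [|M IH]; intros H.
  - destruct (H O (le_n O)) as [N HN]. exists N. intros i Hi. replace i with O by lia. exact HN.
  - destruct IH as [N1 H1]; [intros; apply H; lia|].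
    destruct (H (S M) (le_n _)) as [N2 H2]. exists (max N1 N2). intros i Hi n Hn.
    destruct (Nat.eq_dec i (S M)) as [->|]; [apply H2 | apply H1]; lia.
Qed.

Lemma grid_point (M : nat) x : (0 < M)%nat -> 0 <= x <= / 2 ->
  exists i, (i <= M)%nat /\ Rabs (x - INR i / (2 * INR M)) <= / (2 * INR M).
Proof.
  intros HM Hx. assert (HM' : 0 < INR M) by (now apply lt_0_INR).
  destruct (nfloor_ex (2 * INR M * x)) as [i Hi]; [nra|].
  exists i. split.
  - apply INR_le. nra.
  - replace (x - INR i / (2 * INR M)) with ((2 * INR M * x - INR i) * / (2 * INR M)) by (field; lra).
    assert (0 < / (2 * INR M)) by (apply Rinv_0_lt_compat; lra).
    rewrite Rabs_mult, (Rabs_right (/ (2 * INR M))) by lra.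
    rewrite <- (Rmult_1_l (/ (2 * INR M))) at 2. apply Rmult_le_compat_r; [lra|].
    apply Rabs_le; lra.
Qed.

Lemma gradient_lipschitz u C : Ck 1 u ->
  (forall x y, Rabs (dx u x y) <= C) -> (forall x y, Rabs (dy u x y) <= C) ->
  forall x y x' y', Rabs (u x y - u x' y') <= C * (Rabs (x - x') + Rabs (y - y')).
Proof.
  intros Hu Hx Hy x y x' y'.
  assert (A : Rabs (u x y - u x' y) <= C * Rabs (x - x')).
  { apply (bounded_derive_lipschitz (fun t => u t y)).
    - intros t. eexists. now apply (Ck_is_derive_x 0).
    - intros t l Hl. rewrite <- (is_derive_unique _ _ _ Hl). apply Hx. }
  assert (B : Rabs (u x' y - u x' y') <= C * Rabs (y - y')).
  { apply (bounded_derive_lipschitz (fun t => u x' t)).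
    - intros t. eexists. now apply (Ck_is_derive_y 0).
    - intros t l Hl. rewrite <- (is_derive_unique _ _ _ Hl). apply Hy. }
  replace (u x y - u x' y') with ((u x y - u x' y) + (u x' y - u x' y')) by ring.
  eapply Rle_trans; [apply Rabs_triang|]. lra.
Qed.

(** The Arzelà-Ascoli argument: pointwise convergence is uniform on a finite grid, and the common
    Lipschitz constant fills in between grid points. *)
Lemma equilipschitz_cauchy (u : nat -> R -> R -> R) (C : R) :
  (forall n x y x' y', Rabs (u n x y - u n x' y') <= C * (Rabs (x - x') + Rabs (y - y'))) ->
  (forall x y, 0 <= x <= / 2 -> 0 <= y <= / 2 -> ex_finite_lim_seq (fun n => u n x y)) ->
  forall e, 0 < e -> exists N, forall n m, (N <= n)%nat -> (N <= m)%nat ->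
    forall x y, 0 <= x <= / 2 -> 0 <= y <= / 2 -> Rabs (u n x y - u m x y) <= e.
Proof.
  intros HC Hl e He.
  assert (HC0 : 0 <= C).
  { generalize (Rabs_pos (u 0%nat 1 0 - u 0%nat 0 0)) (HC 0%nat 1 0 0 0).
    rewrite !Rminus_0_r, Rabs_R1, Rabs_R0. lra. }
  (* The grid is fine enough to cost [e / 4] for each of the two functions; the grid values cost
     [e / 8] each. *)
  destruct (INR_unbounded (4 * (C + 1) / e)) as [M0 HM0].
  set (M := S M0).
  assert (HM : 0 < INR M) by (apply lt_0_INR; unfold M; lia).
  assert (HMe : C * / INR M <= e / 4).
  { assert (HS : INR M0 <= INR M) by (apply le_INR; unfold M; lia).
    assert (HM1 : 4 * (C + 1) / e * e < INR M * e) by (apply Rmult_lt_compat_r; lra).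
    replace (4 * (C + 1) / e * e) with (4 * (C + 1)) in HM1 by (field; lra).
    apply Rle_div_l; lra. }
  set (pt := fun i : nat => INR i / (2 * INR M)).
  assert (Hpt : forall i, (i <= M)%nat -> 0 <= pt i <= / 2).
  { intros i Hi. apply le_INR in Hi. unfold pt. split.
    - apply Rdiv_le_0_compat; [apply pos_INR | lra].
    - apply Rle_div_l; lra. }
  assert (HN : exists N, forall i, (i <= M)%nat -> forall n, (N <= n)%nat ->
     forall j, (j <= M)%nat -> Rabs (u n (pt i) (pt j) - real (Lim_seq (fun n => u n (pt i) (pt j)))) <= e / 8).
  { apply (eventually_all M (fun i n => forall j, (j <= M)%nat ->
       Rabs (u n (pt i) (pt j) - real (Lim_seq (fun n => u n (pt i) (pt j)))) <= e / 8)).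
    intros i Hi.
    destruct (eventually_all M (fun j n =>
       Rabs (u n (pt i) (pt j) - real (Lim_seq (fun n => u n (pt i) (pt j)))) <= e / 8)) as [N HN].
    - intros j Hj. assert (L := Lim_seq_correct' _ (Hl _ _ (Hpt i Hi) (Hpt j Hj))).
      apply is_lim_seq_spec in L. destruct (L (mkposreal (e / 8) ltac:(lra))) as [N HN].
      exists N. intros n Hn. left. exact (HN n Hn).
    - exists N. intros n Hn j Hj. now apply HN. }
  destruct HN as [N HN]. exists N. intros n m Hn Hm x y Hx Hy.
  destruct (grid_point M x ltac:(unfold M; lia) Hx) as [i [Hi Hxi]]. fold (pt i) in Hxi.
  destruct (grid_point M y ltac:(unfold M; lia) Hy) as [j [Hj Hyj]]. fold (pt j) in Hyj.
  assert (A := HN i Hi n Hn j Hj). assert (B := HN i Hi m Hm j Hj).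
  assert (D : forall k, Rabs (u k x y - u k (pt i) (pt j)) <= e / 4).
  { intros k. eapply Rle_trans; [apply HC|].
    apply Rle_trans with (C * (/ INR M)); [|exact HMe].
    apply Rmult_le_compat_l; [exact HC0|].
    replace (/ INR M) with (/ (2 * INR M) + / (2 * INR M)) by (field; lra). lra. }
  assert (Dn := D n). assert (Dm := D m).
  abs_lra.
Qed.

Section Existence.

Variables (eps : R) (g : R -> R).
Hypothesis Hg : approx_sign eps g.
Hypothesis Heps : 0 < eps <= 7 / 10000.

Definition source (u : R -> R -> R) (x y : R) : R := - g (u x y).

Lemma source_Ck k u : Ck k u -> Ck k (source u).
Proof.
  intros Hu. destruct (as_smooth _ _ Hg) as [H [H0 HH]].
  unfold source. replace (fun x y => - g (u x y)) with (fun x y => (-1) * H 0%nat (u x y))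
    by (apply ext2; intros; rewrite H0; ring).
  apply Ck_scal. now apply Ck_comp.
Qed.

Lemma source_cont2 u : cont2 u -> cont2 (source u).
Proof. apply (source_Ck 0). Qed.

Lemma source_periodic u : periodic2 u -> periodic2 (source u).
Proof using Type.
  intros Hp x y. unfold source. rewrite (proj1 (Hp x y)), (proj2 (Hp x y)). split; reflexivity.
Qed.

Lemma source_odd u : odd2 u -> odd2 (source u).
Proof using Hg.
  intros Ho x y. unfold source.
  rewrite (proj1 (Ho x y)), (proj2 (Ho x y)), (as_odd _ _ Hg). split; reflexivity.
Qed.

Lemma source_bound u x y : Rabs (source u x y) <= 1.
Proof. unfold source. apply Rabs_le. generalize (as_range _ _ (u x y) Hg). lra. Qed.

Definition admissible (u : R -> R -> R) : Prop := Ck 1 u /\ periodic2 u /\ odd2 u.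

(** Oddness makes the source have mean zero, so the solution of Poisson's equation has exactly the
    source as Laplacian, and it is again odd and periodic: the iteration stays in the class. *)
Lemma admissible_step u v : admissible u -> poisson (source u) v ->
  admissible v /\ (forall x y, lap_at v x y (- g (u x y))).
Proof.
  intros [H1 [H2 H3]] Hv.
  assert (Hc := Ck_cont2 1 u H1).
  assert (Hs := source_Ck 1 u H1). assert (Hsc := source_cont2 u Hc).
  assert (Hsp := source_periodic u H2). assert (Hso := source_odd u H3).
  split.
  - split; [apply Hv|]. split.
    + exact (poisson_periodic (source u) Hsp v Hv).
    + exact (poisson_odd (source u) Hsc Hsp v Hso Hv).
  - intros x y. replace (- g (u x y)) with (laplacian v x y).
    + apply Ck_lap_at. now apply (poisson_Ck 1 (source u)).
    + rewrite (poisson_lap (source u) v) by assumption.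
      rewrite tint_odd by assumption. unfold source. ring.
Qed.

Lemma Wsub_admissible : admissible Wsub.
Proof. split; [apply Wsub_smooth | split; [apply Wsub_periodic | apply Wsub_odd]]. Qed.

(* [Wsub] is subharmonic where [5 ss^2 <= 1]; elsewhere [Wsub >= 9/5000 * 4/10 > eps],
   so that [g Wsub = 1]. *)
Lemma Wsub_subsolution x y : 0 <= x <= / 2 -> 0 <= y <= / 2 ->
  - (/ 5000 * ((2 * PI) ^ 2 * (18 * ss x y * (1 - 5 * ss x y ^ 2)))) <= g (Wsub x y).
Proof.
  intros Hx Hy. assert (Hs := ss_range x y Hx Hy). assert (HW := Wsub_ge x y Hx Hy).
  assert (HP : 0 <= PI ^ 2 <= 16) by (generalize PI_RGT_0 PI_4; intros; nra).
  set (s := ss x y) in *.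
  replace (- (/ 5000 * ((2 * PI) ^ 2 * (18 * s * (1 - 5 * s ^ 2)))))
    with (72 / 5000 * (PI ^ 2 * (s * (5 * s ^ 2 - 1)))) by field.
  destruct (Rle_dec (5 * s ^ 2) 1) as [H|H].
  - assert (0 <= g (Wsub x y)) by (apply (as_nonneg _ _ _ Hg); lra).
    assert (PI ^ 2 * (s * (5 * s ^ 2 - 1)) <= 0); [|lra].
    assert (0 <= PI ^ 2 * (s * (1 - 5 * s ^ 2))); [|lra].
    apply Rmult_le_pos; [lra|]. apply Rmult_le_pos; lra.
  - rewrite (as_one _ _ Hg).
    (* The normalisation [/ 5000] in [Wsub] is decided here: [72 / 5000 * 16 * 4 < 1], with
       [PI <= 4]. *)
    + assert (s * (5 * s ^ 2 - 1) <= 4) by nra.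
      assert (PI ^ 2 * (s * (5 * s ^ 2 - 1)) <= 16 * 4); [|lra].
      apply Rmult_le_compat; try lra. apply Rmult_le_pos; nra.
    + assert (4 / 10 <= s) by nra. lra.
Qed.

Lemma iteration_exists : exists u : nat -> R -> R -> R,
  u 0%nat = Wsub /\ (forall n, admissible (u n)) /\
  forall n, poisson (source (u n)) (u (S n)).
Proof.
  (* The solution operator is made total, with a dummy value on bad sources, so that choice yields a
     function that can be iterated. *)
  assert (HT : forall f : R -> R -> R, exists u, cont2 f -> periodic2 f -> poisson f u).
  { intros f. destruct (classic (cont2 f /\ periodic2 f)) as [[H1 H2]|H].
    - destruct (poisson_exists f H1 H2) as [u Hu]. now exists u.
    - exists f. tauto. }
  destruct (functional_choice _ HT) as [T HT'].
  set (u := fix u n := match n with O => Wsub | S n => T (source (u n)) end).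
  assert (Ha : forall n, admissible (u n) /\ poisson (source (u n)) (u (S n))).
  { induction n as [|n [IH1 IH2]].
    - split; [apply Wsub_admissible|]. apply HT'.
      + apply source_cont2, (Wsub_smooth 0%nat).
      + apply source_periodic, Wsub_periodic.
    - assert (H := proj1 (admissible_step _ _ IH1 IH2)). split; [exact H|].
      apply HT'.
      + apply source_cont2. apply (Ck_cont2 1), H.
      + apply source_periodic, H. }
  exists u. split; [reflexivity|]. split; intros n; apply (Ha n).
Qed.

(** As [g] is increasing, [v2 - v1] is superharmonic on the cell with zero boundary values. This
    propagates the order of the iterates. *)
Lemma poisson_comparison u1 u2 v1 v2 :
  admissible u1 -> admissible u2 -> poisson (source u1) v1 -> poisson (source u2) v2 ->
  (forall x y, 0 <= x <= / 2 -> 0 <= y <= / 2 -> u1 x y <= u2 x y) ->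
  forall x y, 0 <= x <= / 2 -> 0 <= y <= / 2 -> v1 x y <= v2 x y.
Proof.
  intros A1 A2 P1 P2 H x y Hx Hy.
  destruct (admissible_step _ _ A1 P1) as [[B1 [B2 B3]] B4].
  destruct (admissible_step _ _ A2 P2) as [[C1 [C2 C3]] C4].
  assert (0 <= v2 x y - v1 x y); [|lra].
  apply (odd2_nonneg (fun x y => v2 x y - v1 x y) (fun x y => - g (u2 x y) - - g (u1 x y))); auto.
  - apply cont2_minus; now apply (Ck_cont2 1).
  - now apply periodic2_minus.
  - now apply odd2_minus.
  - intros; now apply lap_at_minus.
  - intros s t Hs Ht. generalize (as_incr _ _ Hg _ _ (H s t ltac:(lra) ltac:(lra))). lra.
Qed.

(** The constant depends on [g], hence on [eps]; it is used only to pass to the limit in the source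
    at fixed [eps]. *)
Lemma g_locally_lipschitz B : 0 < B -> exists L, 0 < L /\
  forall s t, Rabs s <= B -> Rabs t <= B -> Rabs (g s - g t) <= L * Rabs (s - t).
Proof.
  intros HB. destruct (as_smooth _ _ Hg) as [H [H0 HH]].
  destruct (continuity_ab_maj (fun t => Rabs (H 1%nat t)) (- B) B) as [m [Hm _]]; [lra| |].
  - intros t _. apply continuity_pt_filterlim.
    apply (continuous_comp (H 1%nat) Rabs); [apply (family_continuous H HH) | apply continuous_Rabs].
  - exists (Rabs (H 1%nat m) + 1). split; [generalize (Rabs_pos (H 1%nat m)); lra|].
    intros s t Hs Ht. apply Rabs_le_between in Hs. apply Rabs_le_between in Ht.
    destruct (mvt g (H 1%nat) t s) as [c [Hc E]].
    { intros r _. rewrite <- H0. apply HH. }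
    rewrite E, Rabs_mult. apply Rmult_le_compat_r; [apply Rabs_pos|].
    assert (A := Hm c).
    assert (- B <= c <= B) by (revert Hc; unfold Rmin, Rmax; destruct Rle_dec; lra).
    specialize (A H1). lra.
Qed.

Lemma solution_exists : exists u,
  smooth2 u /\ periodic2 u /\ odd2 u /\
  (forall x y, laplacian u x y = - g (u x y)) /\
  (forall x y, Rabs (u x y) <= 8 /\ Rabs (dx u x y) <= 8 /\ Rabs (dy u x y) <= 8) /\
  forall x y, 0 <= x <= / 2 -> 0 <= y <= / 2 -> Wsub x y <= u x y.
Proof.
  destruct iteration_exists as [u [Hu0 [Ha Hs]]].
  assert (Hinc : forall n x y, 0 <= x <= / 2 -> 0 <= y <= / 2 -> u n x y <= u (S n) x y).
  { induction n as [|n IH].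
    - intros x y Hx Hy.
      destruct (admissible_step _ _ (Ha 0%nat) (Hs 0%nat)) as [[B1 [B2 B3]] B4].
      assert (0 <= u 1%nat x y - u 0%nat x y); [|lra].
      apply (odd2_nonneg (fun x y => u 1%nat x y - u 0%nat x y)
        (fun x y => - g (u 0%nat x y)
          - / 5000 * ((2 * PI) ^ 2 * (18 * ss x y * (1 - 5 * ss x y ^ 2))))); auto.
      + apply cont2_minus; [now apply (Ck_cont2 1) | rewrite Hu0; apply (Wsub_smooth 0%nat)].
      + rewrite Hu0. apply periodic2_minus; [exact B2 | apply Wsub_periodic].
      + rewrite Hu0. apply odd2_minus; [exact B3 | apply Wsub_odd].
      + intros s t. apply lap_at_minus; [apply B4 | rewrite Hu0; apply Wsub_lap].
      + intros s t Hs' Ht'. rewrite Hu0.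
        generalize (Wsub_subsolution s t ltac:(lra) ltac:(lra)). lra.
    - now apply (poisson_comparison (u n) (u (S n))). }
  assert (HW : forall n x y, 0 <= x <= / 2 -> 0 <= y <= / 2 -> Wsub x y <= u n x y).
  { induction n as [|n IH]; intros x y Hx Hy; [rewrite Hu0; lra|].
    eapply Rle_trans; [now apply IH | now apply Hinc]. }
  (* Only the iterates after [Wsub] are solutions of Poisson's equation, whence the index [S n]; [8]
     is the constant of [poisson_bound] for a source bounded by 1. *)
  assert (Hb : forall n x y, Rabs (u (S n) x y) <= 8 /\ Rabs (dx (u (S n)) x y) <= 8 /\
     Rabs (dy (u (S n)) x y) <= 8).
  { intros n x y. replace 8 with (8 * 1) by ring.
    apply (poisson_bound (source (u n))); auto.
    - apply source_cont2, (Ck_cont2 1), (Ha n).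
    - apply source_periodic, (Ha n).
    - intros; apply source_bound. }
  assert (Hlip : forall n x y x' y',
     Rabs (u (S n) x y - u (S n) x' y') <= 8 * (Rabs (x - x') + Rabs (y - y'))).
  { intros n. apply gradient_lipschitz; [apply (Ha (S n)) | intros x y; apply (Hb n x y)..]. }
  (* Monotonicity holds on the quarter cell only; there it gives pointwise limits, and oddness
     spreads the uniform estimate over the plane. *)
  assert (Hcauchy : uniformly_cauchy (fun n => u (S n))).
  { intros e He.
    destruct (equilipschitz_cauchy (fun n => u (S n)) 8 Hlip) with (e := e) as [N HN]; auto.
    - intros x y Hx Hy. apply (ex_finite_lim_seq_incr _ 8).
      + intros n. now apply Hinc.
      + intros n. destruct (Hb n x y) as [A _]. abs_lra.
    - exists N. intros n m Hn Hm. apply odd2_abs_bound.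
      + apply periodic2_minus; [apply (Ha (S n)) | apply (Ha (S m))].
      + apply odd2_minus; [apply (Ha (S n)) | apply (Ha (S m))].
      + intros; now apply HN. }
  destruct (uniform_limit _ Hcauchy) as [w Hw].
  assert (Hwlim : forall x y, is_lim_seq (fun n => u (S n) x y) (w x y)).
  { intros x y. apply is_lim_seq_spec. intros [e He].
    destruct (Hw (e / 2) ltac:(lra)) as [N HN]. exists N. intros n Hn.
    specialize (HN n Hn x y). simpl. lra. }
  assert (Hwc : cont2 w).
  { apply (uniform_limit_cont2 (fun n => u (S n))); [|exact Hw].
    intros n. apply (Ck_cont2 1), (Ha (S n)). }
  assert (Heq : forall x y x' y' c, (forall n, u (S n) x y = c * u (S n) x' y') -> w x y = c * w x' y').
  { intros x y x' y' c E.
    assert (L := is_lim_seq_scal_l _ c _ (Hwlim x' y')).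
    apply (is_lim_seq_ext _ (fun n => u (S n) x y)) in L; [|intros; symmetry; apply E].
    apply is_lim_seq_unique in L. assert (L' := is_lim_seq_unique _ _ (Hwlim x y)).
    rewrite L in L'. simpl in L'. now injection L'. }
  assert (Hwp : periodic2 w).
  { intros x y. rewrite <- (Rmult_1_l (w x y)). split; apply Heq; intros n; rewrite Rmult_1_l;
      [exact (proj1 (proj1 (proj2 (Ha (S n))) x y)) | exact (proj2 (proj1 (proj2 (Ha (S n))) x y))]. }
  assert (Hwo : odd2 w).
  { intros x y. replace (- w x y) with ((-1) * w x y) by ring.
    split; apply Heq; intros n.
    - rewrite (proj1 (proj2 (proj2 (Ha (S n))) x y)). ring.
    - rewrite (proj2 (proj2 (proj2 (Ha (S n))) x y)). ring. }
  assert (Hwb : forall x y, Rabs (w x y) <= 8).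
  { intros x y. apply Rle_plus_epsilon. intros e He. destruct (Hw e He) as [N HN].
    specialize (HN N (le_n N) x y). destruct (Hb N x y) as [A _].
    abs_lra. }
  assert (Hsc := source_cont2 w Hwc). assert (Hsp := source_periodic w Hwp).
  destruct (poisson_exists (source w) Hsc Hsp) as [v Hv].
  (* The iterates [u (S (S n))] tend to [w], and also to [v] because their sources tend uniformly to
     [source w]. An error [e / (32 L)] in [u] becomes [e / 32] in the source and [e / 4] in the
     solution. *)
  assert (Hvw : v = w).
  { apply ext2. intros x y. apply cond_eq. intros e He.
    destruct (g_locally_lipschitz 8 ltac:(lra)) as [L [HL HLip]].
    destruct (Hw (e / (32 * L))) as [N1 HN1]; [apply Rdiv_lt_0_compat; lra|].
    destruct (Hw (e / 4) ltac:(lra)) as [N2 HN2].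
    set (n := max N1 N2).
    assert (Hn1 := HN2 (S n) ltac:(unfold n; lia) x y).
    assert (Hn2 : Rabs (u (S (S n)) x y - v x y) <= 8 * (e / 32)).
    { assert (Hcn : cont2 (u (S n))) by (apply (Ck_cont2 1), (Ha (S n))).
      assert (Hpn : periodic2 (u (S n))) by apply (Ha (S n)).
      assert (Hcs := source_cont2 _ Hcn). assert (Hps := source_periodic _ Hpn).
      assert (P := poisson_minus _ _ _ _ Hcs Hsc Hps Hsp (Hs (S n)) Hv).
      refine (proj1 (poisson_bound _ _ _ _ (e / 32) P _ x y)).
      - now apply cont2_minus.
      - now apply periodic2_minus.
      - intros s t. unfold source.
        replace (- g (u (S n) s t) - - g (w s t)) with (g (w s t) - g (u (S n) s t)) by ring.
        eapply Rle_trans; [apply HLip; [apply Hwb | apply (Hb n s t)]|].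
        rewrite Rabs_minus_sym. specialize (HN1 n ltac:(unfold n; lia) s t).
        replace (e / 32) with (L * (e / (32 * L))) by (field; lra).
        apply Rmult_le_compat_l; lra. }
    abs_lra. }
  subst v.
  (* Bootstrap: [w] is its own solution of Poisson's equation, so each round gains one
     derivative. *)
  assert (Hsm : smooth2 w).
  { assert (K : forall k, Ck (S k) w).
    { induction k as [|k IH]; [apply Hv|].
      apply (poisson_Ck (S k) (source w)); [now apply source_Ck | exact Hsp | exact Hv]. }
    intros k. apply Ck_S, K. }
  exists w. split; [exact Hsm|]. split; [exact Hwp|]. split; [exact Hwo|]. split; [|split].
  - intros x y. rewrite (poisson_lap (source w) w); [|apply source_Ck, Hsm | exact Hsp | exact Hv].
    rewrite tint_odd; [unfold source; ring | exact Hsc | now apply source_odd].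
  - intros x y. replace 8 with (8 * 1) by ring.
    apply (poisson_bound (source w)); auto. intros; apply source_bound.
  - intros x y Hx Hy. apply Rle_plus_epsilon. intros e He. destruct (Hw e He) as [N HN].
    specialize (HN N (le_n N) x y). specialize (HW (S N) x y Hx Hy).
    abs_lra.
Qed.

End Existence.

(** * Comparison of two solutions *)

Definition cell_solution (g : R -> R) (u : R -> R -> R) : Prop :=
  smooth2 u /\ periodic2 u /\ odd2 u /\
  (forall x y, laplacian u x y = - g (u x y)) /\
  (forall x y, Rabs (u x y) <= 8 /\ Rabs (dx u x y) <= 8 /\ Rabs (dy u x y) <= 8) /\
  forall x y, 0 <= x <= / 2 -> 0 <= y <= / 2 -> Wsub x y <= u x y.

(* [600 > 5000 / 9], the inverse of the constant in [Wsub_ge]. *)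
Lemma saturated eps e g u x y : approx_sign e g -> cell_solution g u -> e <= eps ->
  0 <= x <= / 2 -> 0 <= y <= / 2 -> 600 * eps <= ss x y -> g (u x y) = 1.
Proof.
  intros Hg [_ [_ [_ [_ [_ HW]]]]] He Hx Hy Hs.
  apply (as_one _ _ Hg). specialize (HW x y Hx Hy). generalize (Wsub_ge x y Hx Hy) (ss_range x y Hx Hy).
  lra.
Qed.

Lemma solution_nonneg g u x y : cell_solution g u ->
  0 <= x <= / 2 -> 0 <= y <= / 2 -> 0 <= u x y.
Proof.
  intros [_ [_ [_ [_ [_ HW]]]]] Hx Hy.
  specialize (HW x y Hx Hy). generalize (Wsub_ge x y Hx Hy) (ss_range x y Hx Hy). lra.
Qed.

Section Close.

Variables (e1 e2 : R) (g1 g2 : R -> R) (u1 u2 : R -> R -> R).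
Hypothesis Hg1 : approx_sign e1 g1.
Hypothesis Hg2 : approx_sign e2 g2.
Hypothesis He : 0 < e2 <= e1.
Hypothesis He1 : e1 <= 7 / 10000.
Hypothesis Hu1 : cell_solution g1 u1.
Hypothesis Hu2 : cell_solution g2 u2.

(** On the quarter cell both sources lie in [[0, 1]], so they differ by at most 1, which the barrier
    absorbs where [ss < 600 e1]; elsewhere [e2 <= e1] makes both equal to 1. The sign [s] treats
    both inequalities at once. *)
Lemma solutions_le s x y : s = 1 \/ s = -1 ->
  0 <= x <= / 2 -> 0 <= y <= / 2 -> s * (u1 x y - u2 x y) <= 600 * e1.
Proof.
  intros Hs Hx Hy.
  assert (H1 := Hu1). assert (H2 := Hu2).
  destruct H1 as [S1 [P1 [O1 [L1 _]]]]. destruct H2 as [S2 [P2 [O2 [L2 _]]]].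
  assert (H : 0 <= Phi (600 * e1) (ss x y) - s * (u1 x y - u2 x y)).
  { apply (min_principle (fun x y => Phi (600 * e1) (ss x y) - s * (u1 x y - u2 x y)) 0 (/ 2) 0 (/ 2));
      try assumption.
    - apply cont2_minus.
      + apply cont2_comp; [|apply ss_cont]. intros t. apply Phi_continuous; lra.
      + apply cont2_mult; [apply cont2_const|].
        apply cont2_minus; [exact (S1 0%nat) | exact (S2 0%nat)].
    - intros a b Ha Hb Hbd.
      assert (Hbd' : a = 0 \/ a = / 2 \/ b = 0 \/ b = / 2) by tauto.
      rewrite (odd2_zero u1 a b P1 O1 Hbd'), (odd2_zero u2 a b P2 O2 Hbd').
      generalize (Phi_nonneg (600 * e1) (ss a b) ltac:(lra)). lra.
    - intros a b Ha Hb.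
      destruct (barrier_lap (600 * e1) a b ltac:(lra) Ha Hb) as [l [Hl1 [Hl2 Hl3]]].
      exists (l - s * (- g1 (u1 a b) - - g2 (u2 a b))). split.
      + apply (lap_at_minus (fun x y => Phi (600 * e1) (ss x y)) (fun x y => s * (u1 x y - u2 x y)));
          [exact Hl1|].
        apply (lap_at_scal s (fun x y => u1 x y - u2 x y)).
        rewrite <- L1, <- L2. apply lap_at_minus; apply Ck_lap_at; [apply S1 | apply S2].
      + assert (N1 := as_nonneg _ _ _ Hg1 (solution_nonneg _ _ a b Hu1 ltac:(lra) ltac:(lra))).
        assert (N2 := as_nonneg _ _ _ Hg2 (solution_nonneg _ _ a b Hu2 ltac:(lra) ltac:(lra))).
        assert (R1 := as_range _ _ (u1 a b) Hg1). assert (R2 := as_range _ _ (u2 a b) Hg2).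
        destruct (Rlt_dec (ss a b) (600 * e1)) as [Hlt|Hlt].
        * specialize (Hl3 Hlt). destruct Hs as [->| ->]; lra.
        * rewrite (saturated e1 e1 g1 u1 a b), (saturated e1 e2 g2 u2 a b) by (auto; lra). lra. }
  generalize (Phi_le (600 * e1) (ss x y) ltac:(lra) (proj1 (ss_range x y Hx Hy))). lra.
Qed.

Lemma solutions_close x y : Rabs (u1 x y - u2 x y) <= 600 * e1.
Proof.
  apply (odd2_abs_bound (fun x y => u1 x y - u2 x y)).
  - apply periodic2_minus; [apply Hu1 | apply Hu2].
  - apply odd2_minus; [apply Hu1 | apply Hu2].
  - intros a b Ha Hb. apply Rabs_le.
    generalize (solutions_le 1 a b ltac:(auto) Ha Hb) (solutions_le (-1) a b ltac:(auto) Ha Hb). lra.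
Qed.

Lemma difference_smooth : smooth2 (fun x y => u1 x y - u2 x y).
Proof. intros k. apply Ck_minus; [apply Hu1 | apply Hu2]. Qed.

(** Over the whole plane the sources range in [[-1, 1]] and differ by at most 2; [3] leaves room for
    the strict inequality in the gradient estimates. *)
Lemma difference_laplacian x y : Rabs (laplacian (fun x y => u1 x y - u2 x y) x y) < 3.
Proof.
  clear He He1.
  assert (E : laplacian (fun x y => u1 x y - u2 x y) x y = - g1 (u1 x y) - - g2 (u2 x y)).
  { apply (lap_at_unique (fun x y => u1 x y - u2 x y) x y).
    - apply Ck_lap_at, difference_smooth.
    - destruct Hu1 as [S1 [_ [_ [L1 _]]]]. destruct Hu2 as [S2 [_ [_ [L2 _]]]].
      rewrite <- L1, <- L2. apply lap_at_minus; apply Ck_lap_at; [apply S1 | apply S2]. }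
  rewrite E. generalize (as_range _ _ (u1 x y) Hg1) (as_range _ _ (u2 x y) Hg2).
  intros; apply Rabs_def1; lra.
Qed.

Lemma difference_gradient x y :
  Rabs (dx (fun x y => u1 x y - u2 x y) x y) <= 1202 * sqrt e1 /\
  Rabs (dy (fun x y => u1 x y - u2 x y) x y) <= 1202 * sqrt e1.
Proof.
  assert (Hs : 0 < sqrt e1) by (apply sqrt_lt_R0; lra).
  (* The gradient estimate with [d = sqrt e1]: the two terms are [1200 sqrt e1] and
     [3/2 sqrt e1]. *)
  assert (E : 2 * (600 * e1) / sqrt e1 + sqrt e1 * 3 / 2 <= 1202 * sqrt e1).
  { replace (2 * (600 * e1) / sqrt e1) with (1200 * sqrt e1).
    - lra.
    - rewrite <- (sqrt_sqrt e1) at 2 by lra. field; lra. }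
  split; (eapply Rle_trans; [|exact E]).
  - apply (gradient_bound_x (fun x y => u1 x y - u2 x y) (laplacian (fun x y => u1 x y - u2 x y)))
      with x y; auto using solutions_close, difference_laplacian.
    + apply (difference_smooth 0%nat).
    + intros; apply Ck_lap_at, difference_smooth.
    + apply (Ck_is_derive_x 0), difference_smooth.
  - apply (gradient_bound_y (fun x y => u1 x y - u2 x y) (laplacian (fun x y => u1 x y - u2 x y)))
      with x y; auto using solutions_close, difference_laplacian.
    + apply (difference_smooth 0%nat).
    + intros; apply Ck_lap_at, difference_smooth.
    + apply (Ck_is_derive_y 0), difference_smooth.
Qed.

End Close.

(** * Hoelder continuity of the gradient when the Laplacian is bounded *)

Lemma Rpower_pos x a : 0 < Rpower x a.
Proof. apply exp_pos. Qed.

Lemma Rpower_mono_base x y a : 0 <= a -> 0 < x <= y -> Rpower x a <= Rpower y a.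
Proof. intros Ha Hxy. apply Rle_Rpower_l; lra. Qed.

(** Twice the increment of step [h] is the increment of step [2 h] minus a second difference. A
    bound [D] at step [2 h] thus returns at step [h] multiplied by [2^b / 2 < 1], and the second
    difference is absorbed once [C <= D (2 - 2^b)]. *)
Lemma zygmund (b : R) : 0 < b < 1 -> forall G C, 0 <= G -> 0 <= C -> exists D, 0 < D /\
  forall F : R -> R, (forall x, Rabs (F x) <= G) ->
  (forall x h, 0 < h -> Rabs (F (x + h) + F (x - h) - 2 * F x) <= C * Rpower h b) ->
  forall x h, 0 < h -> Rabs (F (x + h) - F x) <= D * Rpower h b.
Proof.
  intros Hb G C HG HC.
  set (k := Rpower 2 b).
  assert (Hk : 0 < k < 2).
  { split; [apply Rpower_pos|]. unfold k. rewrite <- (Rpower_1 2) at 2 by lra.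
    apply Rpower_lt; lra. }
  assert (HCk : 0 <= C / (2 - k)) by (apply Rdiv_le_0_compat; lra).
  exists (2 * G + C / (2 - k) + 1). split; [lra|].
  set (D := 2 * G + C / (2 - k) + 1).
  intros F HF HZ.
  assert (HD : C <= D * (2 - k)).
  { unfold D. replace C with (C / (2 - k) * (2 - k)) at 1 by (field; lra).
    apply Rmult_le_compat_r; lra. }
  assert (HD1 : 2 * G <= D) by (unfold D; lra).
  (* Induction down the dyadic scales; steps [h >= 1] are covered by [|F| <= G]. *)
  assert (K : forall n x h, / 2 ^ n <= h -> Rabs (F (x + h) - F x) <= D * Rpower h b).
  { induction n as [|n IH]; intros x h Hh.
    - simpl in Hh. rewrite Rinv_1 in Hh.
      assert (1 <= Rpower h b).
      { rewrite <- (Rpower_O h) by lra. apply Rle_Rpower; lra. }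
      assert (Rabs (F (x + h) - F x) <= 2 * G).
      { generalize (HF (x + h)) (HF x). intros A B. abs_lra. }
      nra.
    - assert (Hp : 0 < / 2 ^ S n) by (apply Rinv_0_lt_compat, pow_lt; lra).
      assert (H2 : / 2 ^ n <= 2 * h).
      { simpl in Hh. rewrite Rinv_mult in Hh. lra. }
      specialize (IH x (2 * h) H2). specialize (HZ (x + h) h ltac:(lra)).
      replace (x + h + h) with (x + 2 * h) in HZ by ring.
      replace (x + h - h) with x in HZ by ring.
      rewrite <- Rpower_mult_distr in IH by lra.
      fold k in IH. assert (HP := Rpower_pos h b).
      set (P := Rpower h b) in *.
      apply Rabs_le_between in IH. apply Rabs_le_between in HZ. apply Rabs_le. nra. }
  intros x h Hh.
  destruct (pow_lt_1_zero (/ 2) ltac:(rewrite Rabs_right; lra) h Hh) as [n Hn].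
  apply (K n). specialize (Hn n (le_n n)). rewrite pow_inv in Hn.
  abs_lra.
Qed.

Lemma shift_derive (f f' : R -> R) a t :
  (forall s, is_derive f s (f' s)) -> is_derive (fun s => f (a + s)) t (f' (a + t)).
Proof.
  intros H. replace (f' (a + t)) with (1 * f' (a + t)) by ring.
  apply (is_derive_comp f (fun s => a + s)); [apply H|]. auto_derive; [exact I | ring].
Qed.

Lemma cont2_shift_x v h : cont2 v -> cont2 (fun x y => v (h + x) y).
Proof.
  intros Hv. rewrite (ext2 _ (fun x y => v (1 * x + h) (y + 0))) by (intros; f_equal; ring).
  now apply cont2_affine.
Qed.

Lemma lap_at_shift_x v h x y l : lap_at v (h + x) y l -> lap_at (fun x y => v (h + x) y) x y l.
Proof.
  intros Hv. apply lap_at_ext with (fun x y => v (1 * x + h) (y + 0)); [intros; f_equal; ring|].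
  apply lap_at_affine; [ring|].
  now replace (1 * x + h) with (h + x) by ring; rewrite Rplus_0_r.
Qed.

(** The iterates of [a -> (1 + a) / 2] from 0; they exceed any exponent below 1. *)
Definition holder_exp (k : nat) : R := 1 - / 2 ^ k.

Lemma holder_exp_range k : 0 <= holder_exp k < 1.
Proof.
  unfold holder_exp. assert (0 < / 2 ^ k) by (apply Rinv_0_lt_compat, pow_lt; lra).
  assert (/ 2 ^ k <= 1); [|lra].
  rewrite <- Rinv_1. apply Rinv_le_contravar; [lra|]. apply pow_R1_Rle; lra.
Qed.

Lemma holder_exp_S k : 2 * holder_exp (S k) = 1 + holder_exp k.
Proof.
  unfold holder_exp. simpl. rewrite Rinv_mult. lra.
Qed.

Definition bounded_laplacian (M N : R) (v : R -> R -> R) : Prop :=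
  Ck 2 v /\ (forall x y, Rabs (v x y) <= M) /\ forall x y, Rabs (laplacian v x y) < N.

Definition gradient_le (c : R) (v : R -> R -> R) : Prop :=
  forall x y, Rabs (dx v x y) <= c /\ Rabs (dy v x y) <= c.

Definition gradient_holder (a c : R) (v : R -> R -> R) : Prop :=
  forall x1 y1 x2 y2, (x1, y1) <> (x2, y2) ->
    Rabs (dx v x1 y1 - dx v x2 y2) <= c * Rpower (sqrt ((x1 - x2) ^ 2 + (y1 - y2) ^ 2)) a /\
    Rabs (dy v x1 y1 - dy v x2 y2) <= c * Rpower (sqrt ((x1 - x2) ^ 2 + (y1 - y2) ^ 2)) a.

(* Only increments in [x], the step of the induction on the exponent. *)
Definition gradient_holder_x (a c : R) (v : R -> R -> R) : Prop :=
  forall x y h, 0 < h ->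
    Rabs (dx v (x + h) y - dx v x y) <= c * Rpower h a /\
    Rabs (dy v (x + h) y - dy v x y) <= c * Rpower h a.

(* If [∇v] is [a]-Hoelder in [x] then the second differences of [v] of step [h] are
   [O(h^(1+a))]; as their Laplacian is bounded, the gradient estimate makes their
   gradient [O(h^((1+a)/2))], so [∇v] is [(1+a)/2]-Hoelder in [x]. *)
Lemma holder_gradient_x (M N : R) (k : nat) : exists D, 0 < D /\
  forall v, bounded_laplacian M N v -> gradient_holder_x (holder_exp k) D v.
Proof.
  set (G := Rabs (2 * M / 1 + 1 * N / 2)).
  assert (HG0 : 0 <= G) by apply Rabs_pos.
  assert (HG : forall v, bounded_laplacian M N v -> gradient_le G v).
  { intros v [Hv [HM HN]] x y.
    split; (apply Rle_trans with (2 * M / 1 + 1 * N / 2); [|apply Rle_abs]).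
    - apply (gradient_bound_x v (laplacian v) M N 1) with x y; auto; [..|lra|].
      + now apply (Ck_cont2 2).
      + intros; now apply Ck_lap_at.
      + now apply (Ck_is_derive_x 1).
    - apply (gradient_bound_y v (laplacian v) M N 1) with x y; auto; [..|lra|].
      + now apply (Ck_cont2 2).
      + intros; now apply Ck_lap_at.
      + now apply (Ck_is_derive_y 1). }
  induction k as [|k [D [HD IH]]].
  - exists (2 * G + 1). split; [lra|]. intros v Hv x y h Hh.
    unfold holder_exp. simpl. rewrite Rinv_1, Rminus_diag, Rpower_O by assumption.
    destruct (HG v Hv (x + h) y) as [A B]. destruct (HG v Hv x y) as [A' B'].
    abs_lra.
  - set (a := holder_exp k) in *. set (b := holder_exp (S k)).
    assert (Hab : 2 * b = 1 + a) by apply holder_exp_S.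
    assert (Ha := holder_exp_range k). fold a in Ha.
    (* Here the strict bound on the Laplacian leaves no function to estimate. *)
    destruct (Rle_dec N 0) as [HN0|HN0].
    { exists 1. split; [lra|]. intros v [_ [_ HN]]. exfalso.
      generalize (HN 0 0) (Rabs_pos (laplacian v 0 0)). lra. }
    destruct (zygmund b ltac:(lra) G (2 * D + 2 * N)) as [D' [HD' HZ]]; [lra..|].
    exists D'. split; [exact HD'|]. intros v HvMN. assert (H := HvMN). destruct H as [Hv [HM HN]].
    assert (K : forall x y h, 0 < h ->
      Rabs (dx v (x + h) y + dx v (x - h) y - 2 * dx v x y) <= (2 * D + 2 * N) * Rpower h b /\
      Rabs (dy v (x + h) y + dy v (x - h) y - 2 * dy v x y) <= (2 * D + 2 * N) * Rpower h b).
    { intros x y h Hh.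
      set (w := fun x y => v (h + x) y + v (- h + x) y - 2 * v x y).
      set (L := fun x y => laplacian v (h + x) y + laplacian v (- h + x) y - 2 * laplacian v x y).
      assert (Hd := Rpower_pos h b).
      assert (Hvx : forall t s, is_derive (fun s => v s t) s (dx v s t))
        by (intros; now apply (Ck_is_derive_x 1)).
      assert (Hvy : forall t s, is_derive (fun s => v t s) s (dy v t s))
        by (intros; now apply (Ck_is_derive_y 1)).
      assert (Hwc : cont2 w).
      { assert (Hc := Ck_cont2 2 v Hv).
        apply cont2_minus; [apply cont2_plus; now apply cont2_shift_x|].
        apply cont2_mult; [apply cont2_const | exact Hc]. }
      assert (HwL : forall x y, lap_at w x y (L x y)).
      { intros s t. apply (lap_at_minus (fun x y => v (h + x) y + v (- h + x) y));
          [apply (lap_at_plus (fun x y => v (h + x) y)); apply lap_at_shift_x | apply lap_at_scal];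
          now apply Ck_lap_at. }
      assert (HwM : forall x y, Rabs (w x y) <= D * Rpower h (1 + a)).
      { intros s t.
        (* The second difference is the increment over [[s, s + h]] of [v r - v (r - h)], whose
           derivative is an increment of [dx v] of step [h], bounded by induction. *)
        destruct (mvt (fun r => v r t - v (- h + r) t) (fun r => dx v r t - dx v (- h + r) t) s (h + s))
          as [c [_ E]].
        - intros r _. apply (is_derive_minus (fun r => v r t) (fun r => v (- h + r) t));
            [apply Hvx | apply (shift_derive (fun r => v r t) (fun r => dx v r t)), Hvx].
        - replace (w s t) with (v (h + s) t - v (- h + (h + s)) t - (v s t - v (- h + s) t)).
          + rewrite E, Rabs_mult. replace (h + s - s) with h by ring.
            rewrite (Rabs_right h) by lra. rewrite Rpower_plus, Rpower_1 by assumption.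
            destruct (IH v HvMN (- h + c) t h Hh) as [A _].
            replace (- h + c + h) with c in A by ring. nra.
          + unfold w. replace (- h + (h + s)) with s by ring. ring. }
      assert (HwN : forall x y, Rabs (L x y) < 4 * N).
      { intros s t. generalize (HN (h + s) t) (HN (- h + s) t) (HN s t). unfold L. intros. abs_lra. }
      (* The gradient estimate with [d = h^b]; since [1 + a = 2 b], both of its terms are of order
         [h^b]. *)
      assert (E : 2 * (D * Rpower h (1 + a)) / Rpower h b + Rpower h b * (4 * N) / 2
         = (2 * D + 2 * N) * Rpower h b).
      { replace (1 + a) with (b + b) by lra. rewrite Rpower_plus. field. lra. }
      rewrite <- E. replace (x + h) with (h + x) by ring. replace (x - h) with (- h + x) by ring.
      split.
      - apply (gradient_bound_x w L) with x y; auto.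
        apply (is_derive_minus (fun t => v (h + t) y + v (- h + t) y) (fun t => 2 * v t y));
          [|apply is_derive_scal, Hvx].
        apply (is_derive_plus (fun t => v (h + t) y) (fun t => v (- h + t) y));
          apply (shift_derive (fun r => v r y) (fun r => dx v r y)), Hvx.
      - apply (gradient_bound_y w L) with x y; auto.
        apply (is_derive_minus (fun t => v (h + x) t + v (- h + x) t) (fun t => 2 * v x t));
          [|apply is_derive_scal, Hvy].
        apply (is_derive_plus (fun t => v (h + x) t) (fun t => v (- h + x) t)); apply Hvy. }
    intros x y h Hh. split.
    + apply (HZ (fun x => dx v x y)); auto.
      * intros t. now apply HG.
      * intros t r Hr. now apply K.
    + apply (HZ (fun x => dy v x y)); auto.
      * intros t. now apply HG.
      * intros t r Hr. now apply K.
Qed.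

(** Interpolation between exponents: increments below a threshold [rho] use a Hoelder exponent
    [b > a], longer ones use the smallness of the gradient itself. *)
Lemma holder_vanishing_x M N a eta : 0 <= a < 1 -> 0 < eta -> exists gam, 0 < gam /\
  forall v, bounded_laplacian M N v -> gradient_le gam v -> gradient_holder_x a eta v.
Proof.
  intros Ha Heta.
  destruct (pow_lt_1_zero (/ 2) ltac:(rewrite Rabs_right; lra) (1 - a) ltac:(lra)) as [k Hk].
  specialize (Hk k (le_n k)). rewrite pow_inv in Hk. apply Rabs_def2 in Hk.
  set (b := holder_exp k). assert (Hb : a < b) by (unfold b, holder_exp; lra).
  destruct (holder_gradient_x M N k) as [D [HD H]]. fold b in H.
  (* The solution of [D rho^(b - a) = eta]. *)
  set (rho := Rpower (eta / D) (/ (b - a))).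
  assert (HeD : 0 < eta / D) by (now apply Rdiv_lt_0_compat).
  assert (Hrho : 0 < rho) by apply Rpower_pos.
  assert (Hrp : D * Rpower rho (b - a) = eta).
  { unfold rho. rewrite Rpower_mult. replace (/ (b - a) * (b - a)) with 1 by (field; lra).
    rewrite Rpower_1 by assumption. field; lra. }
  exists (eta * Rpower rho a / 2). split.
  { assert (A := Rpower_pos rho a). nra. }
  intros v Hv Hg x y h Hh.
  destruct (Rle_dec h rho) as [Hhr|Hhr].
  - assert (E : D * Rpower h b <= eta * Rpower h a).
    { replace b with ((b - a) + a) at 1 by ring. rewrite Rpower_plus, <- Rmult_assoc.
      apply Rmult_le_compat_r; [left; apply Rpower_pos|]. rewrite <- Hrp.
      apply Rmult_le_compat_l; [lra|]. apply Rpower_mono_base; lra. }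
    destruct (H v Hv x y h Hh) as [A B]. lra.
  - assert (E : eta * Rpower rho a <= eta * Rpower h a).
    { apply Rmult_le_compat_l; [lra|]. apply Rpower_mono_base; lra. }
    destruct (Hg (x + h) y) as [A B]. destruct (Hg x y) as [A' B'].
    abs_lra.
Qed.

Lemma laplacian_swap v x y : laplacian (fun x y => v y x) x y = laplacian v y x.
Proof. unfold laplacian. rewrite Rplus_comm. reflexivity. Qed.

(** An increment is made of a horizontal and a vertical leg, each no longer than the distance and
    each costing [eta / 2]. Exchanging the variables reduces vertical legs to the horizontal
    case. *)
Lemma holder_vanishing M N a eta : 0 <= a < 1 -> 0 < eta -> exists gam, 0 < gam /\
  forall v, bounded_laplacian M N v -> gradient_le gam v -> gradient_holder a eta v.
Proof.
  intros Ha Heta.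
  destruct (holder_vanishing_x M N a (eta / 2) Ha ltac:(lra)) as [gam [Hgam H]].
  exists gam. split; [exact Hgam|]. intros v Hv Hg x1 y1 x2 y2 Hne.
  set (d := sqrt ((x1 - x2) ^ 2 + (y1 - y2) ^ 2)).
  assert (Hd : 0 < d /\ Rabs (x1 - x2) <= d /\ Rabs (y1 - y2) <= d).
  { assert (A := pow2_ge_0 (x1 - x2)). assert (B := pow2_ge_0 (y1 - y2)).
    split; [|split].
    - apply sqrt_lt_R0. destruct (Req_dec x1 x2) as [->|Hx]; [destruct (Req_dec y1 y2) as [->|Hy]|].
      + now elim Hne.
      + assert (0 < (y1 - y2) ^ 2) by (apply pow2_gt_0; lra). lra.
      + assert (0 < (x1 - x2) ^ 2) by (apply pow2_gt_0; lra). lra.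
    - rewrite <- sqrt_Rsqr_abs. apply sqrt_le_1; unfold Rsqr; nra.
    - rewrite <- sqrt_Rsqr_abs. apply sqrt_le_1; unfold Rsqr; nra. }
  destruct Hd as [Hd [Hdx Hdy]].
  assert (Hpd := Rpower_pos d a).
  assert (Hmove : forall F : R -> R, (forall x h, 0 < h -> Rabs (F (x + h) - F x) <= eta / 2 * Rpower h a) ->
    forall s t, Rabs (s - t) <= d -> Rabs (F s - F t) <= eta / 2 * Rpower d a).
  { intros F HF s t Hst.
    assert (Hle : forall r h, 0 < h <= d -> Rabs (F (r + h) - F r) <= eta / 2 * Rpower d a).
    { intros r h Hh. eapply Rle_trans; [apply HF; lra|].
      apply Rmult_le_compat_l; [lra|]. apply Rpower_mono_base; lra. }
    destruct (Rtotal_order s t) as [Hlt|[->|Hlt]].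
    - rewrite Rabs_minus_sym. replace t with (s + (t - s)) by ring. apply Hle.
      rewrite Rabs_left in Hst by lra. lra.
    - rewrite Rminus_diag, Rabs_R0. apply Rmult_le_pos; lra.
    - replace s with (t + (s - t)) by ring. apply Hle. rewrite Rabs_right in Hst by lra. lra. }
  assert (Hx := H v Hv Hg).
  assert (Hy : gradient_holder_x a (eta / 2) (fun x y => v y x)).
  { apply H.
    - destruct Hv as [Hv [HM HN]]. split; [exact (Ck_swap 2 v Hv)|]. split; [auto|].
      intros x y. rewrite laplacian_swap. apply HN.
    - intros x y. destruct (Hg y x) as [A B]. split; [exact B | exact A]. }
  split.
  - replace (dx v x1 y1 - dx v x2 y2) with ((dx v x1 y1 - dx v x2 y1) + (dx v x2 y1 - dx v x2 y2)) by ring.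
    eapply Rle_trans; [apply Rabs_triang|].
    assert (A := Hmove (fun t => dx v t y1) (fun x h Hh => proj1 (Hx x y1 h Hh)) x1 x2 Hdx).
    assert (B := Hmove (fun t => dx v x2 t) (fun x h Hh => proj2 (Hy x x2 h Hh)) y1 y2 Hdy).
    simpl in A, B. lra.
  - replace (dy v x1 y1 - dy v x2 y2) with ((dy v x1 y1 - dy v x2 y1) + (dy v x2 y1 - dy v x2 y2)) by ring.
    eapply Rle_trans; [apply Rabs_triang|].
    assert (A := Hmove (fun t => dy v t y1) (fun x h Hh => proj2 (Hx x y1 h Hh)) x1 x2 Hdx).
    assert (B := Hmove (fun t => dy v x2 t) (fun x h Hh => proj1 (Hy x x2 h Hh)) y1 y2 Hdy).
    simpl in A, B. lra.
Qed.

(** * Convergence to the Bahouri-Chemin stream function *)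

(* The kernel of [Un n], as a test function of the integration variable. *)
Definition green (n : nat) (x y a b : R) : R :=
  lsum (modes n) (fun p => green_weight n p
     * (cosk (kx p) (x - a) * cosk (ky p) (y - b))).

Lemma cosk_reflect_smooth k l x y : smooth2 (fun a b => cosk k (x - a) * cosk l (y - b)).
Proof.
  intros n. assert (H := smooth_sin_tensor (- (2 * PI * IZR k)) (2 * PI * IZR k * x + PI / 2)
    (- (2 * PI * IZR l)) (2 * PI * IZR l * y + PI / 2) n).
  erewrite ext2; [exact H|]. intros a b. rewrite !cosk_as_sin. f_equal; f_equal; ring.
Qed.

Lemma green_smooth n x y : smooth2 (green n x y).
Proof.
  intros m. apply Ck_lsum. intros p. apply Ck_scal, cosk_reflect_smooth.
Qed.

Lemma green_periodic n x y : periodic2 (green n x y).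
Proof.
  intros a b. split; apply lsum_ext; intros p.
  - rewrite <- (cosk_periodic _ (x - (a + 1))). now replace (x - (a + 1) + 1) with (x - a) by ring.
  - rewrite <- (cosk_periodic _ (y - (b + 1))). now replace (y - (b + 1) + 1) with (y - b) by ring.
Qed.

Lemma cosk_reflect_has_d2 k x a :
  has_d2 (fun a => cosk k (x - a)) a (- (2 * PI * IZR k) ^ 2 * cosk k (x - a)).
Proof.
  replace (- (2 * PI * IZR k) ^ 2 * cosk k (x - a)) with
    ((-1) * (-1) * (- (2 * PI * IZR k) ^ 2 * cosk k ((-1) * a + x))) by
    (replace ((-1) * a + x) with (x - a) by ring; ring).
  apply has_d2_ext with (fun a => cosk k ((-1) * a + x)); [intros; f_equal; ring|].
  apply has_d2_affine, cosk_has_d2.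
Qed.

(** [green] is the trigonometric approximation of the Green function: its Laplacian is the smoothed
    Dirac mass minus 1, the missing zero mode. *)
Lemma green_laplacian n x y a b :
  laplacian (green n x y) a b = Vk n (x - a) * Vk n (y - b) - 1.
Proof.
  apply (lap_at_unique (green n x y) a b); [apply Ck_lap_at, green_smooth|].
  assert (E : cosk 0 (x - a) * cosk 0 (y - b) = 1).
  { unfold cosk. rewrite !Rmult_0_r, !Rmult_0_l, cos_0. ring. }
  rewrite Vk_modes, <- E, <- (green_weight_eigen n (fun k l => cosk k (x - a) * cosk l (y - b))).
  apply lap_at_lsum. intros [[c k] [d l]]. simpl. apply lap_at_scal.
  replace (eigen k l) with (- (2 * PI * IZR k) ^ 2 + - (2 * PI * IZR l) ^ 2)
    by (unfold eigen; ring).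
  apply (lap_at_tensor (fun a => cosk k (x - a)) (fun b => cosk l (y - b)));
    apply cosk_reflect_has_d2.
Qed.

Lemma Un_green n f x y : cont2 f -> periodic2 f ->
  Un n f x y = torus_int (fun a b => f a b * green n x y a b).
Proof.
  intros Hf Hp. unfold green.
  assert (HI : forall k l, cont2 (fun a b => f a b * (cosk k (x - a) * cosk l (y - b)))).
  { intros k l. apply cont2_mult; [exact Hf|].
    exact (cosk_reflect_smooth k l x y 0%nat). }
  rewrite (tint_ext _ (fun a b => lsum (modes n) (fun p =>
     green_weight n p *
     (f a b * (cosk (kx p) (x - a) * cosk (ky p) (y - b)))))).
  - rewrite tint_lsum.
    + apply lsum_ext. intros p. rewrite tint_scal by apply HI. f_equal.
      apply conv_kernel_translate; auto using cosk_continuous, cosk_periodic.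
    + intros p. apply cont2_mult; [apply cont2_const | apply HI].
  - intros a b. rewrite <- lsum_scal. apply lsum_ext. intros p. ring.
Qed.

Lemma Vk_periodic n t : Vk n (t + 1) = Vk n t.
Proof.
  unfold Vk. rewrite !cpow_expand. f_equal. apply lsum_ext. intros p. now rewrite cosk_periodic.
Qed.

(** Presents the smoothing of [f] as [f] tested against the Laplacian of a smooth periodic function,
    the form in which the weak equation for [psi0] applies. *)
Lemma Pn_green n f x y : cont2 f -> periodic2 f -> torus_int f = 0 ->
  Pn n f x y = torus_int (fun a b => f a b * laplacian (green n x y) a b).
Proof.
  intros Hf Hp H0. unfold Pn.
  rewrite conv_kernel_translate; auto using Vk_continuous, Vk_periodic.
  assert (HV : cont2 (fun a b => Vk n (x - a) * Vk n (y - b))).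
  { apply (cont2_reflect (fun a b => Vk n a * Vk n b)). apply cont2_tensor; apply Vk_continuous. }
  rewrite (tint_ext (fun a b => f a b * laplacian (green n x y) a b)
     (fun a b => f a b * (Vk n (x - a) * Vk n (y - b)) - f a b))
    by (intros; rewrite green_laplacian; ring).
  rewrite tint_minus; [rewrite H0; ring | now apply cont2_mult | exact Hf].
Qed.

(** Both sides are the Laplacian of [Un n u], computed directly on the left and by moving the
    derivatives onto [u] on the right. *)
Lemma Pn_Un_laplacian n u x y : smooth2 u -> periodic2 u ->
  Pn n u x y - torus_int u = Un n (laplacian u) x y.
Proof.
  intros Hu Hp.
  assert (S1 := Hu 1%nat). assert (S3 := Hu 3%nat).
  assert (Sx : Ck 2 (dx u)) by exact (proj1 (proj2 (proj2 S3))).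
  assert (Sy : Ck 2 (dy u)) by exact (proj2 (proj2 (proj2 S3))).
  assert (Sxx : Ck 1 (dx (dx u))) by exact (proj1 (proj2 (proj2 Sx))).
  assert (Syy : Ck 1 (dy (dy u))) by exact (proj2 (proj2 (proj2 Sy))).
  assert (Hpx := periodic_dx u S1 Hp). assert (Hpy := periodic_dy u S1 Hp).
  assert (Hc := Ck_cont2 1 _ S1). assert (Hcxx := Ck_cont2 1 _ Sxx). assert (Hcyy := Ck_cont2 1 _ Syy).
  transitivity (laplacian (Un n u) x y).
  - apply (lap_at_unique (Un n u) x y); [now apply Un_lap | now apply Ck_lap_at, Un_smooth].
  - unfold laplacian at 1. rewrite (Un_dx n u), (Un_dy n u) by assumption.
    rewrite (Un_dx n (dx u)) by (try apply Ck_S; assumption).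
    rewrite (Un_dy n (dy u)) by (try apply Ck_S; assumption).
    replace (dx (dx u)) with (fun x y => laplacian u x y - dy (dy u) x y)
      by (apply ext2; intros; unfold laplacian; ring).
    rewrite Un_minus; [ring | exact (cont2_plus _ _ Hcxx Hcyy) | exact Hcyy].
Qed.

Section SgnIntegral.

Variable h : R -> R.
Hypothesis Hh : continuous1 h.

Lemma is_RInt_sgn :
  is_RInt (fun t => sgn t * h t) (-1/2) (1/2) (RInt h 0 (1/2) - RInt h (-1/2) 0).
Proof.
  assert (P : is_RInt (fun t => sgn t * h t) 0 (1/2) (RInt h 0 (1/2))).
  { apply (is_RInt_ext h).
    - intros t Ht. rewrite Rmin_left, Rmax_right in Ht by lra.
      change (h t = sgn t * h t). unfold sgn. destruct Rlt_dec; [ring | lra].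
    - apply (RInt_correct (V := CRV)), ex_int, Hh. }
  assert (M : is_RInt (fun t => sgn t * h t) (-1/2) 0 (- RInt h (-1/2) 0)).
  { apply (is_RInt_ext (fun t => opp (h t))).
    - intros t Ht. rewrite Rmin_left, Rmax_right in Ht by lra.
      change (- h t = sgn t * h t). unfold sgn. destruct Rlt_dec; [lra | ring].
    - apply (is_RInt_opp (V := RV)).
      apply (RInt_correct (V := CRV)), ex_int, Hh. }
  assert (E := is_RInt_Chasles (V := RV) _ _ _ _ _ _ M P).
  unfold plus in E; simpl in E.
  replace (RInt h 0 (1/2) - RInt h (-1/2) 0) with (- RInt h (-1/2) 0 + RInt h 0 (1/2)) by ring.
  exact E.
Qed.

End SgnIntegral.

(** The exceptional set, near 0 and near both ends, has length [2 k + k + k]. *)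
Lemma abs_RInt_outside D B B' k : 0 < k < / 4 -> 0 <= B' -> ex_RInt D (-1/2) (1/2) ->
  (forall t, -1/2 <= t <= 1/2 -> Rabs (D t) <= B) ->
  (forall t, k <= Rabs t <= 1/2 - k -> Rabs (D t) <= B') ->
  Rabs (RInt D (-1/2) (1/2)) <= 4 * k * B + B'.
Proof.
  intros Hk HB0 Hex HB HB'.
  assert (Hsub : forall a b, -1/2 <= a -> a <= b -> b <= 1/2 -> ex_RInt D a b).
  { intros a b Ha Hab Hb.
    apply (ex_RInt_Chasles_2 (V := CRV)) with (-1/2); [lra|].
    apply (ex_RInt_Chasles_1 (V := CRV)) with (1/2); [lra|]. exact Hex. }
  assert (C : forall a b c, -1/2 <= a -> a <= b -> b <= c -> c <= 1/2 ->
     RInt D a c = RInt D a b + RInt D b c).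
  { intros a b c Ha Hab Hbc Hc. symmetry.
    apply (RInt_Chasles (V := CRV)); apply Hsub; lra. }
  assert (E : forall a b M, -1/2 <= a -> a <= b -> b <= 1/2 ->
     (forall t, a <= t <= b -> Rabs (D t) <= M) -> Rabs (RInt D a b) <= (b - a) * M).
  { intros a b M Ha Hab Hb HM. apply abs_RInt_le_const; [lra | apply Hsub; lra | exact HM]. }
  rewrite (C (-1/2) (-1/2 + k) (1/2)), (C (-1/2 + k) (- k) (1/2)), (C (- k) k (1/2)),
    (C k (1/2 - k) (1/2)) by lra.
  assert (E1 := E (-1/2) (-1/2 + k) B ltac:(lra) ltac:(lra) ltac:(lra)
    (fun t Ht => HB t ltac:(lra))).
  assert (E2 := E (-1/2 + k) (- k) B' ltac:(lra) ltac:(lra) ltac:(lra)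
    (fun t Ht => HB' t ltac:(rewrite Rabs_left by lra; lra))).
  assert (E3 := E (- k) k B ltac:(lra) ltac:(lra) ltac:(lra) (fun t Ht => HB t ltac:(lra))).
  assert (E4 := E k (1/2 - k) B' ltac:(lra) ltac:(lra) ltac:(lra)
    (fun t Ht => HB' t ltac:(rewrite Rabs_right by lra; lra))).
  assert (E5 := E (1/2 - k) (1/2) B ltac:(lra) ltac:(lra) ltac:(lra)
    (fun t Ht => HB t ltac:(lra))).
  apply Rabs_le_between in E1. apply Rabs_le_between in E2. apply Rabs_le_between in E3.
  apply Rabs_le_between in E4. apply Rabs_le_between in E5. apply Rabs_le. nra.
Qed.

(** The one-variable estimate is used twice: for [x] in the exceptional set the inner integral is at
    most [2 B], otherwise at most [4 k * 2 B]. *)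
Lemma torus_int_sgn_close (G f : R -> R -> R) (B k : R) :
  cont2 G -> cont2 f -> 0 < k < / 4 ->
  (forall x y, Rabs (G x y) <= 1) -> (forall x y, Rabs (f x y) <= B) ->
  (forall x y, k <= Rabs x <= 1/2 - k -> k <= Rabs y <= 1/2 - k -> G x y = sgn x * sgn y) ->
  Rabs (torus_int (fun x y => G x y * f x y) - torus_int (fun x y => sgn x * sgn y * f x y))
    <= 16 * k * B.
Proof.
  intros HG Hf Hk HG1 HB HGs.
  assert (HB0 : 0 <= B) by (eapply Rle_trans; [apply Rabs_pos | apply (HB 0 0)]).
  assert (HGf := cont2_mult _ _ HG Hf). cbv beta in HGf.
  (* The inner integral of the sign term is [sgn x * H x]; continuity of [H] makes this
     discontinuous outer integrand integrable. *)
  set (H := fun x => RInt (fun y => f x y) 0 (1/2) - RInt (fun y => f x y) (-1/2) 0).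
  assert (HH : continuous1 H).
  { intros x. apply (continuous_minus (V := RV) (fun x => RInt (fun y => f x y) 0 (1/2))
      (fun x => RInt (fun y => f x y) (-1/2) 0)); apply RInt_param_continuous; auto; lra. }
  assert (Hin : forall x, is_RInt (fun y => sgn x * sgn y * f x y) (-1/2) (1/2) (sgn x * H x)).
  { intros x. apply (is_RInt_ext (fun y => scal (sgn x) (sgn y * f x y))).
    - intros y _. change (sgn x * (sgn y * f x y) = sgn x * sgn y * f x y). ring.
    - apply (is_RInt_scal (V := RV)), is_RInt_sgn. now apply cont2_slice. }
  assert (HexG : forall x, ex_RInt (fun y => G x y * f x y) (-1/2) (1/2))
    by (intros x; apply ex_int; exact (cont2_slice _ x HGf)).
  assert (Hout : is_RInt (fun x => sgn x * H x) (-1/2) (1/2)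
     (torus_int (fun x y => sgn x * sgn y * f x y))).
  { unfold torus_int. rewrite (RInt_ext _ (fun x => sgn x * H x)).
    - apply (RInt_correct (V := CRV)). eexists. now apply is_RInt_sgn.
    - intros x _. apply (is_RInt_unique (V := CRV)), Hin. }
  assert (HoutG : is_RInt (fun x => RInt (fun y => G x y * f x y) (-1/2) (1/2)) (-1/2) (1/2)
     (torus_int (fun x y => G x y * f x y))).
  { apply (RInt_correct (V := CRV)), ex_int, (int1_continuous _ HGf). }
  assert (Hdiff := is_RInt_minus (V := RV) _ _ _ _ _ _ HoutG Hout).
  set (I := fun x => RInt (fun y => G x y * f x y) (-1/2) (1/2) - sgn x * H x).
  assert (HI : RInt I (-1/2) (1/2) = torus_int (fun x y => G x y * f x y)
      - torus_int (fun x y => sgn x * sgn y * f x y)).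
  { apply (is_RInt_unique (V := CRV)). exact Hdiff. }
  rewrite <- HI.
  assert (Hs1 : forall x y, Rabs (sgn x * sgn y) <= 1).
  { intros x y. unfold sgn. apply Rabs_le. destruct Rlt_dec, Rlt_dec; lra. }
  assert (HD : forall x y, Rabs (G x y * f x y - sgn x * sgn y * f x y) <= 2 * B).
  { intros x y. replace (G x y * f x y - sgn x * sgn y * f x y) with
      ((G x y - sgn x * sgn y) * f x y) by ring.
    rewrite Rabs_mult. apply Rmult_le_compat; auto using Rabs_pos.
    generalize (HG1 x y) (Hs1 x y). intros A1 A2. abs_lra. }
  assert (HIx : forall x, ex_RInt (fun y => G x y * f x y - sgn x * sgn y * f x y) (-1/2) (1/2) /\
     I x = RInt (fun y => G x y * f x y - sgn x * sgn y * f x y) (-1/2) (1/2)).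
  { intros x.
    assert (A := is_RInt_minus (V := RV) _ _ _ _ _ _
      (RInt_correct (V := CRV) _ _ _ (HexG x)) (Hin x)).
    split; [eexists; exact A|]. symmetry. apply (is_RInt_unique (V := CRV)).
    exact A. }
  replace (16 * k * B) with (4 * k * (2 * B) + 4 * k * (2 * B)) by ring.
  apply abs_RInt_outside; [exact Hk | nra | eexists; exact Hdiff | |].
  - intros x _. rewrite (proj2 (HIx x)).
    replace (2 * B) with ((1/2 - -1/2) * (2 * B)) by field.
    apply abs_RInt_le_const; [lra | apply HIx | intros; apply HD].
  - intros x Hx. rewrite (proj2 (HIx x)).
    rewrite <- (Rplus_0_r (4 * k * (2 * B))).
    apply abs_RInt_outside; [exact Hk | lra | apply HIx | intros; apply HD|].
    intros y Hy. rewrite (HGs x y Hx Hy), Rminus_diag, Rabs_R0. lra.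
Qed.

Lemma sin2pi_lower k : 0 < k < / 4 -> exists m, 0 < m /\
  forall t, k <= t <= 1/2 - k -> m <= sin2pi t.
Proof.
  intros Hk.
  destruct (continuity_ab_min sin2pi k (1/2 - k)) as [t0 [H1 H2]]; [lra| |].
  - intros t _. apply continuity_pt_filterlim, sin2pi_continuous.
  - exists (sin2pi t0). split; [apply sin2pi_pos; lra | exact H1].
Qed.

Lemma source_sgn eps g u k m x y : approx_sign eps g -> cell_solution g u ->
  0 < k -> 0 < m -> (forall t, k <= t <= 1/2 - k -> m <= sin2pi t) -> 600 * eps <= m * m ->
  k <= Rabs x <= 1/2 - k -> k <= Rabs y <= 1/2 - k -> g (u x y) = sgn x * sgn y.
Proof.
  intros Hg Hu Hk Hm Hs He Hx Hy.
  assert (Ho : odd2 u) by apply Hu.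
  assert (A : forall a b, k <= a <= 1/2 - k -> k <= b <= 1/2 - k -> g (u a b) = 1).
  { intros a b Ha Hb. apply (saturated eps eps g u a b Hg Hu); try lra.
    unfold ss. generalize (Hs a Ha) (Hs b Hb). intros; nra. }
  assert (F : forall t, k <= Rabs t -> (t = Rabs t /\ sgn t = 1) \/ (t = - Rabs t /\ sgn t = -1)).
  { intros t. unfold sgn, Rabs. destruct Rcase_abs, Rlt_dec; intros; lra. }
  specialize (A _ _ Hx Hy).
  destruct (F x (proj1 Hx)) as [[Ex ->]|[Ex ->]], (F y (proj1 Hy)) as [[Ey ->]|[Ey ->]];
    rewrite Ex, Ey.
  - rewrite A; ring.
  - rewrite (proj2 (Ho _ _)), (as_odd _ _ Hg), A. ring.
  - rewrite (proj1 (Ho _ _)), (as_odd _ _ Hg), A. ring.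
  - rewrite (proj1 (Ho _ _)), (proj2 (Ho _ _)), Ropp_involutive, A. ring.
Qed.

Lemma solution_cvg psi0 : is_psi0 psi0 -> forall x y eta, 0 < eta -> exists del, 0 < del /\
  forall eps g u, 0 < eps < del -> approx_sign eps g -> cell_solution g u ->
    Rabs (- u x y - psi0 x y) <= eta.
Proof.
  intros [Hc1 [Hp [H0 Hweak]]] x y eta Heta.
  assert (Hc := Ck_cont2 1 _ Hc1).
  destruct (Pn_cvg psi0 Hc Hp (eta / 4) ltac:(lra)) as [N1 HN1].
  (* All cell solutions share the bound 8 and the Lipschitz constant 8, so displacements below
     [eta / 128] change them by at most [8 * (2 * eta / 128) = eta / 8]. *)
  destruct (Pn_uniform 8 (eta / 8) (eta / 128)) as [N2 HN2]; [lra..|].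
  (* The order of choices matters: [n] does not depend on [eps], then come the bound [B] of the
     kernel, the strip width [k], and last the threshold on [eps]. Each of the three errors costs
     [eta / 4]. *)
  set (n := max N1 N2).
  destruct (periodic_max_abs (green n x y) (green_smooth n x y 0%nat) (green_periodic n x y))
    as [a0 [b0 HB]].
  set (B := Rabs (green n x y a0 b0)) in *.
  assert (HB0 : 0 <= B) by apply Rabs_pos.
  set (k := Rmin (/ 8) (eta / (64 * (B + 1)))).
  assert (Hk : 0 < k < / 4 /\ 16 * k * B <= eta / 4).
  { assert (A : 0 < eta / (64 * (B + 1))) by (apply Rdiv_lt_0_compat; lra).
    assert (K1 : k <= / 8) by apply Rmin_l. assert (K2 : k <= eta / (64 * (B + 1))) by apply Rmin_r.
    assert (K3 : 0 < k) by (apply Rmin_pos; lra).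
    split; [lra|]. apply (Rmult_le_compat_r (64 * (B + 1))) in K2; [|lra].
    replace (eta / (64 * (B + 1)) * (64 * (B + 1))) with eta in K2 by (field; lra). nra. }
  destruct Hk as [Hk Hk2].
  destruct (sin2pi_lower k Hk) as [m [Hm Hsin]].
  (* Off the strips [ss >= m * m >= 600 eps] up to sign, so [g u] equals the product of signs
     there. *)
  exists (m * m / 600). split; [apply Rdiv_lt_0_compat; nra|].
  intros eps g u He Hg Hu. assert (Hu' := Hu).
  destruct Hu' as [S [P [O [L [Bd W]]]]].
  assert (Hcu : cont2 u) by exact (S 0%nat).
  assert (EU : Pn n u x y = torus_int (fun a b => laplacian u a b * green n x y a b)).
  { rewrite <- Un_green, <- Pn_Un_laplacian, (tint_odd u); auto; [ring | |].
    - rewrite (ext2 _ _ L). exact (source_cont2 eps g Hg u Hcu).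
    - rewrite (ext2 _ _ L). exact (source_periodic g u P). }
  assert (EP : Pn n psi0 x y = torus_int (fun a b => sgn a * sgn b * green n x y a b)).
  { rewrite Pn_green by assumption. apply Hweak; [apply green_smooth | apply green_periodic]. }
  assert (EG : - Pn n u x y = torus_int (fun a b => g (u a b) * green n x y a b)).
  { rewrite EU. replace (- torus_int (fun a b => laplacian u a b * green n x y a b)) with
      ((-1) * torus_int (fun a b => laplacian u a b * green n x y a b)) by ring.
    rewrite <- tint_scal.
    - apply tint_ext; intros a b. rewrite L. ring.
    - apply cont2_mult; [|apply (green_smooth n x y 0%nat)].
      rewrite (ext2 _ _ L). exact (source_cont2 eps g Hg u Hcu). }
  assert (Hgu : cont2 (fun a b => g (u a b))).
  { replace (fun a b => g (u a b)) with (fun a b => 0 - source g u a b)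
      by (apply ext2; intros; unfold source; ring).
    apply cont2_minus; [apply cont2_const | exact (source_cont2 eps g Hg u Hcu)]. }
  assert (K := torus_int_sgn_close (fun a b => g (u a b)) (green n x y) B k Hgu
    (green_smooth n x y 0%nat) Hk
    (fun a b => Rabs_le _ _ (as_range _ _ (u a b) Hg)) HB
    (fun a b Ha Hb => source_sgn eps g u k m a b Hg Hu (proj1 Hk) Hm Hsin ltac:(lra) Ha Hb)).
  cbv beta in K. rewrite <- EG, <- EP in K.
  assert (K1 := HN1 n ltac:(unfold n; lia) x y).
  assert (K2 : Rabs (Pn n u x y - u x y) <= 2 * (eta / 8)).
  { apply HN2; auto; [unfold n; lia | intros; apply Bd |].
    intros a b s t Hs Ht.
    eapply Rle_trans; [apply (gradient_lipschitz u 8 (S 1%nat)); intros; apply Bd|].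
    replace (a + s - a) with s by ring. replace (b + t - b) with t by ring. lra. }
  abs_lra.
Qed.

(** * The estimates for psi_eps - psi0 *)

Lemma limit_abs_le (w : nat -> R) (l C : R) :
  is_lim_seq w l -> (forall n, Rabs (w n) <= C) -> Rabs l <= C.
Proof.
  intros Hl HC.
  assert (H : is_lim_seq (fun n => Rabs (w n)) (Rabs l)).
  { apply is_lim_seq_continuous; [|exact Hl]. apply continuity_pt_filterlim, continuous_Rabs. }
  exact (is_lim_seq_le _ (fun _ => C) (Rabs l) C HC H (is_lim_seq_const C)).
Qed.

Lemma supn_le h c : (forall x y, Rabs (h x y) <= c) -> Rbar_le (supn h) (Finite c).
Proof.
  intros H. apply (proj2 (Lub_Rbar_correct _)). intros r [x [y ->]]. apply H.
Qed.

Lemma C1_norm_le h c1 c2 : (forall x y, Rabs (h x y) <= c1) ->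
  (forall x y, Rabs (dx h x y) <= c2 /\ Rabs (dy h x y) <= c2) ->
  Rbar_le (C1_norm h) (Finite (c1 + (c2 + c2))).
Proof.
  intros H1 H2. unfold C1_norm.
  change (Finite (c1 + (c2 + c2))) with (Rbar_plus c1 (Rbar_plus c2 c2)).
  apply Rbar_plus_le_compat; [now apply supn_le|].
  apply Rbar_plus_le_compat; apply supn_le; apply H2.
Qed.

Lemma holder_semi_le a h c :
  (forall x1 y1 x2 y2, (x1, y1) <> (x2, y2) ->
    Rabs (h x1 y1 - h x2 y2) <= c * Rpower (sqrt ((x1 - x2) ^ 2 + (y1 - y2) ^ 2)) a) ->
  Rbar_le (holder_semi a h) (Finite c).
Proof.
  intros H. apply (proj2 (Lub_Rbar_correct _)). intros r [x1 [y1 [x2 [y2 [Hne ->]]]]].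
  simpl. apply Rle_div_l; [apply Rpower_pos|]. now apply H.
Qed.

Section Limit.

Variables (K : R -> R) (psi0 : R -> R -> R) (u : R -> R -> R -> R) (eps : R).
Hypothesis HK : mollifier K.
Hypothesis H0 : is_psi0 psi0.
Hypothesis Heps : 0 < eps < 7 / 10000.
Hypothesis Hu : forall e, 0 < e < 7 / 10000 -> cell_solution (fun t => - Feps K e t) (u e).

Let psi (x y : R) := - u eps x y.
Let err (x y : R) := psi x y - psi0 x y.
(** Starts at [eps] itself and decreases to 0, so bounds on [u (e n) - u eps] become, in the limit,
    bounds on the error. *)
Let e (n : nat) := eps / (INR n + 1).

Lemma e_range n : 0 < e n <= eps.
Proof.
  unfold e. assert (Hn := pos_INR n). split.
  - apply Rdiv_lt_0_compat; lra.
  - apply Rle_div_l; [lra|]. nra.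
Qed.

Lemma e_decr n m : (n <= m)%nat -> e m <= e n.
Proof.
  intros H. apply le_INR in H. assert (Hn := pos_INR n). unfold e, Rdiv.
  apply Rmult_le_compat_l; [lra|]. apply Rinv_le_contravar; lra.
Qed.

Lemma e_small d : 0 < d -> exists N, e N < d.
Proof.
  intros Hd. destruct (INR_unbounded (eps / d)) as [N HN]. exists N.
  unfold e. assert (Hp := pos_INR N). apply Rlt_div_l; [lra|].
  assert (A : eps / d * d < (INR N + 1) * d) by (apply Rmult_lt_compat_r; lra).
  replace (eps / d * d) with eps in A by (field; lra). lra.
Qed.

Lemma sol_e n : approx_sign (e n) (fun t => - Feps K (e n) t) /\
  cell_solution (fun t => - Feps K (e n) t) (u (e n)).
Proof.
  assert (He := e_range n). split; [apply Feps_approx_sign; [exact HK | lra] | apply Hu; lra].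
Qed.

Definition C1_bound (e : R) (v : R -> R -> R) : Prop := forall x y,
  Rabs (v x y) <= 600 * e /\ Rabs (dx v x y) <= 1202 * sqrt e /\ Rabs (dy v x y) <= 1202 * sqrt e.

Lemma difference_C1 n m : (n <= m)%nat -> C1_bound (e n) (fun x y => u (e n) x y - u (e m) x y).
Proof.
  intros Hnm x y. destruct (sol_e n) as [Gn Sn]. destruct (sol_e m) as [Gm Sm].
  assert (He : 0 < e m <= e n) by (split; [apply e_range | now apply e_decr]).
  assert (He' : e n <= 7 / 10000) by (generalize (e_range n); lra).
  split; [exact (solutions_close _ _ _ _ _ _ Gn Gm He He' Sn Sm x y)|].
  exact (difference_gradient _ _ _ _ _ _ Gn Gm He He' Sn Sm x y).
Qed.

(** The bounds on pairs make the solutions Cauchy in C^1, and pointwise convergence identifies the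
    limit. In this way the derivatives of [psi0] are also limits of derivatives of solutions. *)
Lemma psi_C1_limit : exists U, Ck 1 U /\ C1_converges (fun n => u (e n)) U /\
  forall x y, psi0 x y = - U x y.
Proof.
  assert (S : forall n, Ck 1 (u (e n))) by (intros n; apply (sol_e n)).
  destruct (C1_limit (fun n => u (e n)) S) as [U [HU1 HU2]].
  - intros d Hd.
    (* Makes both [600 e] and [1202 sqrt e] at most [d]. *)
    destruct (e_small (Rmin (d / 600) (d / 1202 * (d / 1202)))) as [N HN].
    { apply Rmin_pos; nra. }
    assert (HN1 := Rlt_le_trans _ _ _ HN (Rmin_l _ _)).
    assert (HN2 := Rlt_le_trans _ _ _ HN (Rmin_r _ _)).
    assert (K0 : forall n m, (N <= n)%nat -> (n <= m)%nat -> forall x y,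
      Rabs (u (e n) x y - u (e m) x y) <= d /\ Rabs (dx (u (e n)) x y - dx (u (e m)) x y) <= d /\
      Rabs (dy (u (e n)) x y - dy (u (e m)) x y) <= d).
    { intros n m Hn Hm x y. destruct (difference_C1 n m Hm x y) as [A [B C]].
      rewrite dx_minus in B by apply S. rewrite dy_minus in C by apply S.
      assert (He := e_decr N n Hn).
      assert (Hs : sqrt (e n) <= d / 1202).
      { rewrite <- (sqrt_square (d / 1202)) by lra. apply sqrt_le_1_alt. lra. }
      repeat split; lra. }
    exists N. intros n m Hn Hm x y. destruct (Nat.le_ge_cases n m) as [H|H]; [now apply K0|].
    rewrite (Rabs_minus_sym (u _ _ _)), (Rabs_minus_sym (dx _ _ _)), (Rabs_minus_sym (dy _ _ _)).
    now apply K0.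
  - exists U. split; [exact HU1|]. split; [exact HU2|]. intros x y. apply cond_eq. intros d Hd.
    destruct (HU2 (d / 4) ltac:(lra)) as [N1 HN1].
    destruct (solution_cvg psi0 H0 x y (d / 4) ltac:(lra)) as [del [Hdel H]].
    destruct (e_small del Hdel) as [N2 HN2]. set (n := max N1 N2).
    assert (He : 0 < e n < del).
    { split; [apply e_range|]. eapply Rle_lt_trans; [|exact HN2]. apply e_decr. unfold n; lia. }
    destruct (HN1 n ltac:(unfold n; lia) x y) as [A _].
    assert (B := H (e n) _ (u (e n)) He (proj1 (sol_e n)) (proj2 (sol_e n))). abs_lra.
Qed.

Lemma e_0 : e 0 = eps.
Proof. unfold e. simpl. field. Qed.

Lemma err_limit x y :
  is_lim_seq (fun n => u (e n) x y - u eps x y) (err x y) /\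
  is_lim_seq (fun n => dx (fun x y => u (e n) x y - u eps x y) x y) (dx err x y) /\
  is_lim_seq (fun n => dy (fun x y => u (e n) x y - u eps x y) x y) (dy err x y).
Proof.
  destruct psi_C1_limit as [U [HU1 [HU2 HU3]]].
  assert (S : forall n, Ck 1 (u (e n))) by (intros n; apply (sol_e n)).
  assert (S0 := S 0%nat). rewrite e_0 in S0.
  assert (E : err = (fun x y => U x y - u eps x y))
    by (apply ext2; intros; unfold err, psi; rewrite HU3; ring).
  rewrite E, dx_minus, dy_minus by assumption.
  repeat split; apply is_lim_seq_spec; intros [d Hd];
    destruct (HU2 (d / 2) ltac:(lra)) as [N HN]; exists N; intros n Hn;
    destruct (HN n Hn x y) as [A [B C]]; rewrite ?dx_minus, ?dy_minus by auto; simpl; abs_lra.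
Qed.

Lemma D_bound n : C1_bound eps (fun x y => u (e n) x y - u eps x y).
Proof.
  intros x y. assert (S : forall n, Ck 1 (u (e n))) by (intros m; apply (sol_e m)).
  assert (S0 := S 0%nat). destruct (difference_C1 0 n (Nat.le_0_l n) x y) as [A [B C]].
  rewrite dx_minus in B by auto. rewrite dy_minus in C by auto. rewrite e_0 in A, B, C, S0.
  rewrite dx_minus, dy_minus by auto.
  rewrite (Rabs_minus_sym (u _ _ _)), (Rabs_minus_sym (dx _ _ _)), (Rabs_minus_sym (dy _ _ _)).
  auto.
Qed.

Lemma err_bound : C1_bound eps err.
Proof.
  intros x y. destruct (err_limit x y) as [A [B C]].
  repeat split; [apply (limit_abs_le _ _ _ A) | apply (limit_abs_le _ _ _ B)
    | apply (limit_abs_le _ _ _ C)]; intros n; apply (D_bound n).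
Qed.

(** The class [bounded_laplacian] demands C^2, so the estimate is taken on differences of two smooth
    solutions and passed to the limit. Its parameters come from [600 eps <= 1] and from
    [difference_laplacian]. *)
Lemma err_holder a c gam : 1202 * sqrt eps <= gam ->
  (forall v, bounded_laplacian 1 3 v -> gradient_le gam v -> gradient_holder a c v) ->
  gradient_holder a c err.
Proof.
  intros Hgam Hv x1 y1 x2 y2 Hne.
  set (D := fun n x y => u (e n) x y - u eps x y).
  assert (H : forall n, Rabs (dx (D n) x1 y1 - dx (D n) x2 y2)
      <= c * Rpower (sqrt ((x1 - x2) ^ 2 + (y1 - y2) ^ 2)) a /\
    Rabs (dy (D n) x1 y1 - dy (D n) x2 y2) <= c * Rpower (sqrt ((x1 - x2) ^ 2 + (y1 - y2) ^ 2)) a).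
  { intros n. destruct (sol_e n) as [Gn Sn]. destruct (sol_e 0) as [G0 S0]. rewrite e_0 in G0, S0.
    apply Hv; [split; [|split]|intros x y; destruct (D_bound n x y) as [_ [A B]]; fold (D n) in A, B; lra|exact Hne].
    - exact (difference_smooth _ _ _ _ Sn S0 2%nat).
    - intros x y. destruct (D_bound n x y) as [A _]. unfold D. lra.
    - exact (difference_laplacian _ _ _ _ _ _ Gn G0 Sn S0). }
  destruct (err_limit x1 y1) as [_ [A1 B1]]. destruct (err_limit x2 y2) as [_ [A2 B2]].
  split; [apply (limit_abs_le _ _ _ (is_lim_seq_minus' _ _ _ _ A1 A2))
    | apply (limit_abs_le _ _ _ (is_lim_seq_minus' _ _ _ _ B1 B2))]; intros n; apply (H n).
Qed.

Lemma psi_solution :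
  smooth2 psi /\ periodic2 psi /\ torus_int psi = 0 /\
  torus_int (fun x y => Feps K eps (psi x y)) = 0 /\
  forall x y, laplacian psi x y = Feps K eps (psi x y).
Proof.
  destruct (sol_e 0) as [Hg H]. rewrite e_0 in Hg, H.
  destruct H as [S [P [O [L [B W]]]]].
  assert (Hpsi : psi = (fun x y => (-1) * u eps x y)) by (apply ext2; intros; unfold psi; ring).
  assert (Sp : smooth2 psi) by (intros k; rewrite Hpsi; apply Ck_scal, S).
  assert (Pp : periodic2 psi).
  { intros x y. unfold psi. now rewrite (proj1 (P x y)), (proj2 (P x y)). }
  assert (Op : odd2 psi).
  { intros x y. unfold psi. now rewrite (proj1 (O x y)), (proj2 (O x y)). }
  assert (EF : (fun x y => Feps K eps (psi x y)) = source (fun t => - Feps K eps t) psi).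
  { apply ext2; intros. unfold source. ring. }
  split; [exact Sp|]. split; [exact Pp|]. split; [|split].
  - apply tint_odd; [exact (Sp 0%nat) | exact Op].
  - rewrite EF. apply tint_odd.
    + apply (source_cont2 eps _ Hg), (Sp 0%nat).
    + exact (source_odd eps _ Hg psi Op).
  - intros x y. apply (lap_at_unique psi x y); [now apply Ck_lap_at|].
    replace (Feps K eps (psi x y)) with ((-1) * laplacian (u eps) x y).
    + rewrite Hpsi. apply (lap_at_scal (-1)). now apply Ck_lap_at.
    + rewrite L. generalize (as_odd _ _ Hg (u eps x y)). unfold psi. lra.
Qed.

End Limit.

Theorem theorem2p1 (K : R -> R) (psi0 : R -> R -> R) :
  mollifier K -> is_psi0 psi0 ->
  exists eps0 C1 : R, 0 < eps0 /\ 0 < C1 /\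
  exists psi : R -> R -> R -> R,
    (forall eps, 0 < eps < eps0 ->
       smooth2 (psi eps) /\ periodic2 (psi eps)
       (* psi_eps = Delta^{-1}(F_eps(psi_eps)) *)
       /\ torus_int (psi eps) = 0
       /\ torus_int (fun x y => Feps K eps (psi eps x y)) = 0
       /\ (forall x y, laplacian (psi eps) x y = Feps K eps (psi eps x y))
       /\ Rbar_le (C1_norm (fun x y => psi eps x y - psi0 x y))
                  (Finite (C1 * sqrt eps * sqrt (- ln eps))))
    /\ (forall alpha, 0 <= alpha < 1 ->
         forall eta, 0 < eta -> exists delta, 0 < delta /\
           forall eps, 0 < eps < Rmin delta eps0 ->
             Rbar_le (C1alpha_norm alpha (fun x y => psi eps x y - psi0 x y))
                     (Finite eta)).
Proof.
  intros HK H0.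
  assert (Hex : forall eps, exists u, 0 < eps < 7 / 10000 ->
    cell_solution (fun t => - Feps K eps t) u).
  { intros eps. destruct (classic (0 < eps < 7 / 10000)) as [He|He].
    - destruct (solution_exists eps _ (Feps_approx_sign K eps HK (proj1 He))) as [u Hu]; [lra|].
      exists u. intros _. exact Hu.
    - exists (fun _ _ => 0). tauto. }
  destruct (functional_choice _ Hex) as [u Hu].
  assert (Hsq : forall eps, 0 < eps < 7 / 10000 -> 0 < sqrt eps /\ eps <= sqrt eps).
  { intros eps He. assert (A : 0 < sqrt eps) by (apply sqrt_lt_R0; lra). split; [exact A|].
    assert (B := sqrt_sqrt eps ltac:(lra)). nra. }
  assert (HC1 : forall eps, 0 < eps < 7 / 10000 ->
    Rbar_le (C1_norm (fun x y => - u eps x y - psi0 x y)) (Finite (3004 * sqrt eps))).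
  { intros eps He. destruct (Hsq eps He) as [A B].
    replace (3004 * sqrt eps) with (600 * sqrt eps + (1202 * sqrt eps + 1202 * sqrt eps)) by ring.
    apply C1_norm_le.
    - intros x y. destruct (err_bound K psi0 u eps HK H0 He Hu x y) as [E _]. lra.
    - intros x y. now apply (err_bound K psi0 u eps HK H0 He Hu). }
  (* [3004 = 600 + 1202 + 1202], using [eps <= sqrt eps] in the first term. *)
  exists (7 / 10000), 3004. split; [lra|]. split; [lra|].
  exists (fun eps x y => - u eps x y). split.
  - intros eps He. destruct (psi_solution K u eps HK He Hu) as [A [B [C [D E]]]].
    repeat (split; [assumption|]).
    eapply Rbar_le_trans; [now apply HC1|]. simpl.
    destruct (Hsq eps He) as [S1 _].
    (* Holds since [eps <= 1/3 <= exp (-1)]. *)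
    assert (Hln : 1 <= sqrt (- ln eps)).
    { rewrite <- sqrt_1. apply sqrt_le_1_alt.
      assert (ln eps <= -1); [|lra].
      rewrite <- (ln_exp (-1)). apply ln_le; [lra|].
      replace (-1) with (- (1)) by ring. rewrite exp_Ropp. assert (H3 := exp_le_3). assert (Hp := exp_pos 1).
      apply Rle_trans with (/ 3); [lra|]. apply Rinv_le_contravar; lra. }
    rewrite <- (Rmult_1_r (3004 * sqrt eps)) at 1. apply Rmult_le_compat_l; lra.
  - intros alpha Ha eta Heta.
    destruct (holder_vanishing 1 3 alpha (eta / 4) Ha ltac:(lra)) as [gam [Hgam H]].
    (* [1202 rho <= gam] brings the gradient under the threshold, and [3004 rho <= eta / 2] leaves a
       quarter of [eta] to each Hoelder seminorm. *)
    set (rho := Rmin (gam / 1202) (eta / 6008)).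
    assert (Hrho : 0 < rho) by (apply Rmin_pos; lra).
    exists (rho * rho). split; [nra|]. intros eps Heps.
    assert (He : 0 < eps < 7 / 10000).
    { generalize (Rmin_r (rho * rho) (7 / 10000)). lra. }
    assert (Hs : sqrt eps <= rho).
    { rewrite <- (sqrt_square rho) by lra. apply sqrt_le_1_alt.
      generalize (Rmin_l (rho * rho) (7 / 10000)). lra. }
    assert (Hr1 : rho <= gam / 1202) by apply Rmin_l.
    assert (Hr2 : rho <= eta / 6008) by apply Rmin_r.
    assert (Hh := err_holder K psi0 u eps HK H0 He Hu alpha (eta / 4) gam ltac:(lra) H).
    unfold C1alpha_norm.
    replace (Finite eta) with (Rbar_plus (Finite (eta / 2)) (Rbar_plus (Finite (eta / 4)) (Finite (eta / 4))))
      by (simpl; f_equal; field).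
    apply Rbar_plus_le_compat; [|apply Rbar_plus_le_compat].
    + eapply Rbar_le_trans; [now apply HC1|]. simpl. lra.
    + apply holder_semi_le. intros; now apply Hh.
    + apply holder_semi_le. intros; now apply Hh.
Qed.
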